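(* Let $\mathcal{P}_1=\mathcal{A}ss$ with generating associative multiplication $\bullet$, and let $\mathcal{P}_2=\mathcal{M}ag$ with generating magmatic multiplication $\circ$. There are precisely two isomorphism classes of distributive laws of $\mathcal{P}_1$ over $\mathcal{P}_2$: the class of the trivial law $\mathcal{D}=0$, and the class of the truncated law, represented by any one of the following rewrite rules: \[ \begin{array}{lll} (b) & (x\circ y)\bullet z = 0, & x\bullet(y\circ z)=(x\bullet y)\circ z;\\ (c) & (x\circ y)\bullet z = x\circ(y\bullet z), & x\bullet(y\circ z)=0;\\ (e) & (x\circ y)\bullet z = 0, & x\bullet(y\circ z)=y\circ(x\bullet z);\\ (f) & (x\circ y)\bullet z = (x\bullet z)\circ y, & x\bullet(y\circ z)=0. \end{array} \]
   Context: Fix a field $\Bbbk$ of characteristic $0$; operads are symmetric operads in $\Bbbk$-vector spaces, and all generating operations have degree $0$. For a $\Sigma_2$-module $E$, $\mathcal{F}(E)$ is the free operad generated by $E$ placed in arity $2$; for a $\Sigma_3$-submodule $R\subseteq\mathcal{F}(E)(3)$, $\langle E;R\rangle=\mathcal{F}(E)/(R)$, where $(R)$ is the operad ideal generated by $R$. Let $\mathcal{P}_1=\langle E_1;R_1\rangle$, $\mathcal{P}_2=\langle E_2;R_2\rangle$ and $E=E_1\oplus E_2$. For $i,j\in\{1,2\}$ let $\mathcal{F}(E)(3)_{ij}\subseteq\mathcal{F}(E)(3)$ be the $\Sigma_3$-submodule generated by the compositions $\mu(1,\nu)$, $\mu(\nu,1)$ with $\mu\in E_i$ (root operation) and $\nu\in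 E_j$. Given a $\Sigma_3$-equivariant linear map $\mathcal{D}\colon\mathcal{F}(E)(3)_{12}\to\mathcal{F}(E)(3)_{21}$, let $R_{\mathcal{D}}$ be the submodule of all $x-\mathcal{D}(x)$, $x\in\mathcal{F}(E)(3)_{12}$, and let $\mathcal{P}=\langle E_1\oplus E_2;\,R_1\oplus R_{\mathcal{D}}\oplus R_2\rangle$ (the combined operad). The canonical maps $\mathcal{P}_i\to\mathcal{P}$ and operadic composition in $\mathcal{P}$ induce, via $(\mu;\nu_1,\dots,\nu_l)\mapsto\mu(\nu_1,\dots,\nu_l)$ with $\mu\in\mathcal{P}_2(l)$ and $\nu_s\in\mathcal{P}_1(m_s)$, $m_1+\cdots+m_l=n$, an equivariant map $\xi(n)\colon(\mathcal{P}_2\circ\mathcal{P}_1)(n)\to\mathcal{P}(n)$, where $\mathcal{P}_2\circ\mathcal{P}_1$ is the composite product of $\Sigma$-modules. The map $\mathcal{D}$ is called a distributive law of $\mathcal{P}_1$ over $\mathcal{P}_2$ if $\xi(n)$ is an isomorphism for every $n\ge2$. The map $\mathcal{D}=0$ is always a distributive law, called the trivial one. A law is written by rewrite rules $u=v$, meaning $\mathcal{D}(u)=v$ for $u$ running over $\Sigma_3$-module generators of $\mathcal{F}(E)(3)_{12}$. Two distributive laws are isomorphic if the corresponding combined operads are isomorphic. $\mathcal{A}ss$ is the operad of associative algebras: $E=\Bbbk[\Sigma_2]$ (one binary operation with no symmetry and its opposite) and $R$ is generated by the associativity relation. $\mathcal{M}ag$ is the operad of magmatic algebras: $E=\Bbbk[\Sigma_2]$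 (one binary operation with no symmetry and its opposite) and $R=0$. Here $E_1$ is spanned by $\bullet$ and its opposite, and $E_2$ by $\circ$ and its opposite. *)

(* Defs.v *)
From HB Require Import structures.
From mathcomp Require Import all_boot all_algebra perm generic_quotient finmap monalg boolp.

(******************************************************************************)
(*  Operads are used in their coordinate-free form: a symmetric operad P is a *)
(* functor from finite sets and bijections to k-vector spaces, with a unit in *)
(* P {*} and total compositions                                               *)
(*      P(J) (x) (x)_(j in J) P(K j)  ->  P({j : J & K j}).                   *)
(* P(n) is P 'I_n, with Sigma_n acting by relabelling; block permutations and *)
(* sums of arities are thereby absorbed into dependent sums of index sets.    *)
(*  Every E considered is a free Sigma_2-module k[Sigma_2] (x) k^G, i.e. is   *)
(* generated by a set G of binary operations without symmetry.                *)
(******************************************************************************)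

Set Implicit Arguments.
Unset Strict Implicit.
Unset Printing Implicit Defensive.

Import GRing.Theory.
Local Open Scope ring_scope.
Local Open Scope quotient_scope.

Section LinearAlgebra.
Context (k : fieldType) (V : lmodType k).

Definition submod_pred (Z : V -> Prop) :=
  Z 0 /\ forall (a : k) x y, Z x -> Z y -> Z (a *: x + y).

Definition span (W : V -> Prop) (x : V) : Prop :=
  forall Z, submod_pred Z -> (forall w, W w -> Z w) -> Z x.

Context (W : V -> Prop).

Lemma span_submod : submod_pred (span W).
Proof.
split=> [Z [Z0 _] _ //|a x y Wx Wy Z sZ sW].
by apply: sZ.2; [apply: Wx|apply: Wy].
Qed.

Lemma sub_span w : W w -> span W w.
Proof. by move=> Ww Z _; apply. Qed.

Lemma span_sub (Z : V -> Prop) :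
  submod_pred Z -> (forall w, W w -> Z w) -> forall x, span W x -> Z x.
Proof. by move=> sZ WZ x; apply. Qed.

Definition span_mem : {pred V} := fun x => `[< span W x >].

Lemma span_memP x : reflect (span W x) (x \in span_mem).
Proof. exact: asboolP. Qed.

Fact span_mem_closed : submod_closed span_mem.
Proof.
have [s0 sD] := span_submod.
split=> [|a x y /span_memP Wx /span_memP Wy]; first exact/span_memP.
by apply/span_memP; apply: sD.
Qed.

HB.instance Definition _ := GRing.isSubmodClosed.Build k V span_mem span_mem_closed.

Record span_type := SpanType { span_val :> V; _ : span_val \in span_mem }.

HB.instance Definition _ := [isSub for span_val].
HB.instance Definition _ := [Choice of span_type by <:].
HB.instance Definition _ := [SubChoice_isSubLmodule of span_type by <:].

Definition quot_eq (x y : V) : bool := x - y \in span_mem.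

Fact quot_eq_equiv : equiv_class_of quot_eq.
Proof.
split=> [x|x y|y x z]; rewrite /quot_eq ?subrr ?rpred0 //.
  by rewrite -opprB rpredN.
by move=> xy yz; rewrite -(subrK y x) -addrA rpredD.
Qed.

Canonical quot_eq_rel := EquivRelPack quot_eq_equiv.

Definition quot := {eq_quot quot_eq_rel}.
HB.instance Definition _ := Choice.on quot.
HB.instance Definition _ := EqQuotient.on quot.

Definition quot_pi (x : V) : quot := \pi_quot x.

Lemma quot_pi_eq x y : quot_pi x = quot_pi y <-> span W (x - y).
Proof.
split=> [/eqP|sxy]; first by rewrite eqmodE => /span_memP.
by apply/eqP; rewrite eqmodE; apply/span_memP.
Qed.

Lemma quot_piK : cancel (fun q : quot => repr q) quot_pi.
Proof. exact: reprK. Qed.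

Lemma repr_quot_pi x : span W (repr (quot_pi x) - x).
Proof. by apply/quot_pi_eq; rewrite quot_piK. Qed.

Lemma quot_piP (Q : quot -> Prop) : (forall x, Q (quot_pi x)) -> forall q, Q q.
Proof. by move=> h q; rewrite -(quot_piK q). Qed.

Definition quot_add (p q : quot) := quot_pi (repr p + repr q).
Definition quot_opp (p : quot) := quot_pi (- repr p).
Definition quot_scale (a : k) (p : quot) := quot_pi (a *: repr p).

Let mem_repr x : repr (quot_pi x) - x \in span_mem.
Proof. by apply/span_memP; apply: repr_quot_pi. Qed.

Lemma quot_pi_add x y : quot_add (quot_pi x) (quot_pi y) = quot_pi (x + y).
Proof.
by apply/quot_pi_eq; apply/span_memP; rewrite opprD addrACA rpredD.
Qed.

Lemma quot_pi_opp x : quot_opp (quot_pi x) = quot_pi (- x).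
Proof. by apply/quot_pi_eq; apply/span_memP; rewrite -opprD rpredN. Qed.

Lemma quot_pi_scale a x : quot_scale a (quot_pi x) = quot_pi (a *: x).
Proof. by apply/quot_pi_eq; apply/span_memP; rewrite -scalerBr rpredZ. Qed.

Fact quot_addA : associative quot_add.
Proof. by elim/quot_piP=> x; elim/quot_piP=> y; elim/quot_piP=> z; rewrite !quot_pi_add addrA. Qed.
Fact quot_addC : commutative quot_add.
Proof. by elim/quot_piP=> x; elim/quot_piP=> y; rewrite !quot_pi_add addrC. Qed.
Fact quot_add0 : left_id (quot_pi 0) quot_add.
Proof. by elim/quot_piP=> x; rewrite !quot_pi_add add0r. Qed.
Fact quot_addN : left_inverse (quot_pi 0) quot_opp quot_add.
Proof. by elim/quot_piP=> x; rewrite quot_pi_opp !quot_pi_add addNr. Qed.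

HB.instance Definition _ :=
  GRing.isZmodule.Build quot quot_addA quot_addC quot_add0 quot_addN.

Fact quot_scaleA a b q : quot_scale a (quot_scale b q) = quot_scale (a * b) q.
Proof. by elim/quot_piP: q => x; rewrite !quot_pi_scale scalerA. Qed.
Fact quot_scale1 : left_id 1 quot_scale.
Proof. by elim/quot_piP=> x; rewrite !quot_pi_scale scale1r. Qed.
Fact quot_scaleDr : right_distributive quot_scale +%R.
Proof.
move=> a; elim/quot_piP=> x; elim/quot_piP=> y.
by rewrite [_ + _]quot_pi_add !quot_pi_scale [RHS]quot_pi_add scalerDr.
Qed.
Fact quot_scaleDl q : {morph quot_scale^~ q : a b / a + b}.
Proof. by elim/quot_piP: q => x a b; rewrite !quot_pi_scale [RHS]quot_pi_add scalerDl. Qed.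

HB.instance Definition _ := GRing.Zmodule_isLmodule.Build k quot
  quot_scaleA quot_scale1 quot_scaleDr quot_scaleDl.

Fact quot_pi_linear : linear quot_pi.
Proof. by move=> a x y; rewrite -quot_pi_add -quot_pi_scale. Qed.

HB.instance Definition _ := GRing.isLinear.Build k V quot *:%R quot_pi quot_pi_linear.

End LinearAlgebra.

Arguments span_type {k V} W.
Arguments quot {k V} W.
Arguments quot_pi {k V} W x.

(* Linear extension to the free vector space {malg k[X]}; locked because      *)
(* unification otherwise unfolds it. *)
HB.lock Definition linext (k : fieldType) (X : choiceType) (V : lmodType k)
    (f : X -> V) (a : {malg k[X]}) : V :=
  \sum_(t <- msupp a) a@_t *: f t.
Arguments linext {k X V} f a.

Section Linext.
Context (k : fieldType) (X : choiceType) (V : lmodType k).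

Lemma linextE (f : X -> V) a : linext f a = \sum_(t <- msupp a) a@_t *: f t.
Proof. by rewrite unlock. Qed.

Implicit Types (f : X -> V) (a : {malg k[X]}).

Lemma linextEw f (d : {fset X}) a : (msupp a `<=` d)%fset ->
  linext f a = \sum_(t <- d) a@_t *: f t.
Proof.
move=> le; rewrite linextE -(big_fset_incl _ le) //= => t _ nt.
by rewrite mcoeff_outdom ?scale0r.
Qed.

Fact linext_linear f : linear (linext f).
Proof.
move=> c a b; pose d := (msupp (c *: a + b) `|` msupp a `|` msupp b)%fset.
have le1 : (msupp (c *: a + b) `<=` d)%fset by rewrite /d -fsetUA fsubsetUl.
have le2 : (msupp a `<=` d)%fset by rewrite /d fsubsetU // fsubsetUr.
have le3 : (msupp b `<=` d)%fset by rewrite /d fsubsetUr.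
rewrite (linextEw f le1) (linextEw f le2) (linextEw f le3).
rewrite scaler_sumr -big_split /=; apply: eq_bigr => t _.
by rewrite mcoeffD mcoeffZ scalerDl scalerA.
Qed.

HB.instance Definition _ f := GRing.isLinear.Build k {malg k[X]} V *:%R
  (linext f) (linext_linear f).

Lemma linextU f t : linext f << t >> = f t.
Proof. by rewrite (@linextEw _ [fset t]%fset) ?msuppU_le // big_seq_fset1 mcoeffUU scale1r. Qed.

Lemma malg_sumE (a : {malg k[X]}) : a = \sum_(t <- msupp a) a@_t *: << t >>.
Proof.
rewrite [LHS]monalgE; apply: eq_bigr => t _.
by apply/malgP=> u; rewrite mcoeffZ !mcoeffU mulrnAr mulr1.
Qed.

Lemma linext_unique (f : {malg k[X]} -> V) : linear f ->
  f =1 linext (fun t => f << t >>).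
Proof.
move=> lf a.
have f0 : f 0 = 0.
  by have := lf (-1) 0 0; rewrite scaler0 addr0 scaleN1r addNr.
rewrite {1}[a]malg_sumE linextE.
elim: (enum_fset _) => [|t s IHs]; first by rewrite !big_nil.
by rewrite !big_cons lf IHs.
Qed.

Lemma linear_malgP (f g : {malg k[X]} -> V) : linear f -> linear g ->
  (forall t, f << t >> = g << t >>) -> f =1 g.
Proof.
move=> lf lg fg a; rewrite (linext_unique lf) (linext_unique lg).
by rewrite !linextE; apply: eq_bigr => t _; rewrite fg.
Qed.

End Linext.

(* relabel f is only meaningful when f is bijective: its values on other maps *)
(* are unconstrained, and morphisms ignore them. *)
Record operad (k : fieldType) := Operad {
  op_space :> finType -> lmodType k;
  relabel : forall I J : finType, (I -> J) -> op_space I -> op_space J;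
  ounit : op_space unit;
  ocomp : forall (J : finType) (K : J -> finType),
    op_space J -> (forall j, op_space (K j)) -> op_space {j : J & K j};
  relabel_linear : forall (I J : finType) (f : I -> J),
    bijective f -> linear (relabel f);
  relabel_id : forall (I : finType) (x : op_space I), relabel id x = x;
  relabel_comp : forall (I J L : finType) (f : I -> J) (g : J -> L) x,
    bijective f -> bijective g -> relabel g (relabel f x) = relabel (g \o f) x;
  ocomp_linearl : forall (J : finType) (K : J -> finType)
      (nu : forall j, op_space (K j)),
    linear (fun mu => ocomp mu nu);
  ocomp_linearr : forall (J : finType) (K : J -> finType) (mu : op_space J)
      (nu : forall j, op_space (K j)) (j : J),
    linear (fun x : op_space (K j) => ocomp mu (dfwith nu x));
  ocomp_relabell : forall (J J' : finType) (K : J' -> finType) (f : J -> J')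
      (mu : op_space J) (nu : forall j, op_space (K j)),
    bijective f ->
    ocomp (relabel f mu) nu =
    relabel (fun u : {j : J & K (f j)} =>
               existT (fun j => K j) (f (tag u)) (tagged u))
            (ocomp mu (fun j => nu (f j)));
  ocomp_relabelr : forall (J : finType) (K K' : J -> finType)
      (f : forall j, K j -> K' j) (mu : op_space J)
      (nu : forall j, op_space (K j)),
    (forall j, bijective (f j)) ->
    ocomp mu (fun j => relabel (f j) (nu j)) =
    relabel (fun u : {j : J & K j} =>
               existT (fun j => K' j) (tag u) (f (tag u) (tagged u)))
            (ocomp mu nu);
  ocomp_unitl : forall (J : finType) (mu : op_space J),
    ocomp ounit (fun=> mu) = relabel (fun j => existT (fun=> J) tt j) mu;
  ocomp_unitr : forall (J : finType) (mu : op_space J),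
    ocomp mu (fun=> ounit) = relabel (fun j => existT (fun=> unit) j tt) mu;
  ocompA : forall (J : finType) (K : J -> finType)
      (L : {j : J & K j} -> finType) (la : op_space J)
      (mu : forall j, op_space (K j)) (nu : forall p, op_space (L p)),
    ocomp (ocomp la mu) nu =
    relabel (fun u : {j : J & {i : K j & L (existT (fun j => K j) j i)}} =>
               existT (fun p => L p)
                 (existT (fun j => K j) (tag u) (tag (tagged u)))
                 (tagged (tagged u)))
            (ocomp la (fun j => ocomp (mu j)
                                  (fun i => nu (existT (fun j => K j) j i))))
}.

Arguments relabel {k o I J} f x.
Arguments ounit {k o}.
Arguments ocomp {k o J K} mu nu.

Section Hom.
Context (k : fieldType).

Record operad_hom (P Q : operad k) (phi : forall I, P I -> Q I) : Prop :=
  OperadHom {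
  hom_linear : forall I, linear (phi I);
  hom_relabel : forall (I J : finType) (f : I -> J) x, bijective f ->
    phi J (relabel f x) = relabel f (phi I x);
  hom_unit : phi unit ounit = ounit;
  hom_comp : forall (J : finType) (K : J -> finType) (mu : P J)
      (nu : forall j, P (K j)),
    phi {j : J & K j} (ocomp mu nu) = ocomp (phi J mu) (fun j => phi (K j) (nu j))
}.

Definition operad_iso (P Q : operad k) : Prop :=
  exists phi : forall I, P I -> Q I,
    operad_hom phi /\ forall I, bijective (phi I).

End Hom.

Section Tree.
Context (G I : Type).
Inductive tree : Type := Leaf of I | Node of G & tree & tree.

Fixpoint leaves (t : tree) : seq I :=
  match t with
  | Leaf i => [:: i]
  | Node _ l r => leaves l ++ leaves r
  end.

Fixpoint tree_encode (t : tree) : GenTree.tree (I + G) :=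
  match t with
  | Leaf i => GenTree.Leaf (inl i)
  | Node g l r =>
      GenTree.Node 0 [:: GenTree.Leaf (inr g); tree_encode l; tree_encode r]
  end.

Fixpoint tree_decode (t : GenTree.tree (I + G)) : option tree :=
  match t with
  | GenTree.Leaf (inl i) => Some (Leaf i)
  | GenTree.Node _ [:: GenTree.Leaf (inr g); l; r] =>
      if tree_decode l is Some l' then
        if tree_decode r is Some r' then Some (Node g l' r') else None
      else None
  | _ => None
  end.

Lemma tree_encodeK : pcancel tree_encode tree_decode.
Proof. by elim=> //= g l -> r ->. Qed.
End Tree.

Arguments Leaf {G I} i.

HB.instance Definition _ (G I : eqType) :=
  Equality.copy (tree G I) (pcan_type (@tree_encodeK G I)).
HB.instance Definition _ (G I : choiceType) :=
  Choice.copy (tree G I) (pcan_type (@tree_encodeK G I)).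

Section Magma.
Context (k : fieldType) (G : choiceType).

Local Notation A X := {malg k[tree G X]}.

Definition graft (X : choiceType) (g : G) (a b : A X) : A X :=
  linext (fun s => linext (fun t => << Node g s t >>) b) a.

Fixpoint tsubst (I : Type) (X : choiceType) (nu : I -> A X) (t : tree G I) : A X :=
  match t with
  | Leaf i => nu i
  | Node g l r => graft g (tsubst nu l) (tsubst nu r)
  end.

Definition bind (I X : choiceType) (nu : I -> A X) : A I -> A X :=
  linext (tsubst nu).

Definition mrelabel (I X : choiceType) (f : I -> X) : A I -> A X :=
  bind (fun i => << Leaf (f i) >>).

Lemma linext_fun (T : choiceType) (V : lmodType k) (f g h : T -> V) (c : k) a :
  (forall t, h t = c *: f t + g t) ->
  linext h a = c *: linext f a + linext g a.
Proof.
move=> E; rewrite !linextE scaler_sumr -big_split; apply: eq_bigr => t _ /=.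
by rewrite E scalerDr !scalerA [c * _]mulrC.
Qed.

Section Graft.
Context (X : choiceType).
Implicit Types a b : A X.

Lemma graft_linl g b : linear (fun a => graft g a b).
Proof. by move=> c x y; rewrite /graft linearP. Qed.

Lemma graft_linr g a : linear (graft g a).
Proof. by move=> c x y; apply: linext_fun => t; rewrite linearP. Qed.

Lemma graftU g (s t : tree G X) : graft g << s >> << t >> = << Node g s t >>.
Proof. by rewrite /graft !linextU. Qed.
End Graft.

Lemma bind_lin (I X : choiceType) (nu : I -> A X) : linear (bind nu).
Proof. exact: linext_linear. Qed.

Lemma bindU (I X : choiceType) (nu : I -> A X) t : bind nu << t >> = tsubst nu t.
Proof. exact: linextU. Qed.

Lemma bind_graft (I X : choiceType) (nu : I -> A X) g (a b : A I) :
  bind nu (graft g a b) = graft g (bind nu a) (bind nu b).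
Proof.
move: a; apply: linear_malgP => [c x y|c x y|s].
- by rewrite graft_linl bind_lin.
- by rewrite bind_lin graft_linl.
move: b; apply: linear_malgP => [c x y|c x y|t].
- by rewrite graft_linr bind_lin.
- by rewrite bind_lin graft_linr.
by rewrite graftU !bindU.
Qed.

Lemma bind_tsubst (I : Type) (X Y : choiceType) (nu : I -> A X) (rho : X -> A Y) t :
  bind rho (tsubst nu t) = tsubst (fun i => bind rho (nu i)) t.
Proof. by elim: t => //= g l IHl r IHr; rewrite bind_graft IHl IHr. Qed.

Lemma bindA (I X Y : choiceType) (nu : I -> A X) (rho : X -> A Y) a :
  bind rho (bind nu a) = bind (fun i => bind rho (nu i)) a.
Proof.
move: a; apply: linear_malgP => [c x y|c x y|t].
- by rewrite !bind_lin.
- by rewrite !bind_lin.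
by rewrite !bindU bind_tsubst.
Qed.

Lemma eq_tsubst (I : Type) (X : choiceType) (nu nu' : I -> A X) t :
  nu =1 nu' -> tsubst nu t = tsubst nu' t.
Proof.
move=> E; elim: t => [i|g l IHl r IHr] /=; first exact: E.
by rewrite IHl IHr.
Qed.

Lemma eq_bind (I X : choiceType) (nu nu' : I -> A X) :
  nu =1 nu' -> bind nu =1 bind nu'.
Proof. by move=> E a; rewrite /bind !linextE; apply: eq_bigr => t _; rewrite (eq_tsubst t E). Qed.

Lemma bind_leaf (I : choiceType) (a : A I) : bind (fun i => << Leaf i >>) a = a.
Proof.
move: a; apply: linear_malgP => [||t] //; first exact: bind_lin.
rewrite bindU; elim: t => [i|g l IHl r IHr] //=.
by rewrite IHl IHr graftU.
Qed.

Lemma mrelabelU (I X : choiceType) (f : I -> X) i :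
  mrelabel f << Leaf i >> = << Leaf (f i) >>.
Proof. by rewrite /mrelabel bindU. Qed.

Lemma mrelabel_lin (I X : choiceType) (f : I -> X) : linear (mrelabel f).
Proof. exact: bind_lin. Qed.

Lemma mrelabel_id (I : choiceType) (a : A I) : mrelabel id a = a.
Proof. exact: bind_leaf. Qed.

Lemma bind_mrelabel (I X Y : choiceType) (f : I -> X) (nu : X -> A Y) a :
  bind nu (mrelabel f a) = bind (nu \o f) a.
Proof. by rewrite bindA; apply: eq_bind => i; rewrite bindU. Qed.

Lemma mrelabel_bind (I X Y : choiceType) (f : X -> Y) (nu : I -> A X) a :
  mrelabel f (bind nu a) = bind (fun i => mrelabel f (nu i)) a.
Proof. exact: bindA. Qed.

Lemma mrelabel_comp (I X Y : choiceType) (f : I -> X) (g : X -> Y) a :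
  mrelabel g (mrelabel f a) = mrelabel (g \o f) a.
Proof. by rewrite {1}/mrelabel bind_mrelabel. Qed.

(* All trees occurring in a satisfy p. *)
Definition supported (X : choiceType) (p : pred (tree G X)) (a : A X) : bool :=
  all p (msupp a).

Lemma supportedP (X : choiceType) (p : pred (tree G X)) (a : A X) :
  reflect (forall t, a@_t != 0 -> p t) (supported p a).
Proof.
apply: (iffP allP) => [h t|h t].
  by rewrite mcoeff_neq0; apply: h.
by move=> ta; apply: h; rewrite mcoeff_neq0.
Qed.

Fact supported_closed (X : choiceType) (p : pred (tree G X)) :
  submod_closed (supported p).
Proof.
split=> [|c a b /supportedP ha /supportedP hb]; apply/supportedP => t.
  by rewrite mcoeff0 eqxx.
rewrite mcoeffD mcoeffZ => nz; have [ta|/ha //] := eqVneq a@_t 0.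
by apply: hb; move: nz; rewrite ta mulr0 add0r.
Qed.

HB.instance Definition _ (X : choiceType) (p : pred (tree G X)) :=
  GRing.isSubmodClosed.Build k (A X) (supported p) (supported_closed p).

Lemma supportedU (X : choiceType) (p : pred (tree G X)) t :
  p t -> supported p << t >>.
Proof.
move=> pt; apply/supportedP => u; rewrite mcoeffU.
by case: (t =P u) => [<-|_] //; rewrite mulr0n eqxx.
Qed.

Lemma supported_linext (T X : choiceType) (q : pred T) (p : pred (tree G X)) f
    (a : {malg k[T]}) :
  all q (msupp a) -> (forall t, q t -> supported p (f t)) -> supported p (linext f a).
Proof.
move=> /allP qa pf; suff: linext f a \in supported p by [].
rewrite linextE big_seq; apply: rpred_sum => t ta.
by apply: rpredZ; apply: pf; apply: qa.
Qed.

Lemma sub_supported (X : choiceType) (p q : pred (tree G X)) (a : A X) :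
  subpred p q -> supported p a -> supported q a.
Proof. by move=> pq; apply: sub_all. Qed.

(* Each element of I labels exactly one leaf. *)
Definition mlinear (I : finType) (t : tree G I) : bool :=
  perm_eq (leaves t) (enum I).

Lemma supported_tsubst (I : choiceType) (X : choiceType) (nu : I -> A X)
    (s : I -> seq X) :
  (forall i, supported (fun t => perm_eq (leaves t) (s i)) (nu i)) ->
  forall t, supported (fun u => perm_eq (leaves u) (flatten (map s (leaves t))))
                      (tsubst nu t).
Proof.
move=> H; elim=> [i|g l IHl r IHr] /=; first by rewrite cats0.
apply: (supported_linext IHl) => t1 p1; apply: (supported_linext IHr) => t2 p2.
by apply: supportedU; rewrite /= map_cat flatten_cat perm_cat.
Qed.

Lemma supported_bind (J : finType) (K : J -> finType) (mu : A J)
    (nu : forall j, A (K j)) :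
  supported (@mlinear J) mu -> (forall j, supported (@mlinear (K j)) (nu j)) ->
  supported (@mlinear {j : J & K j})
    (bind (fun j => mrelabel (existT (fun j => K j) j) (nu j)) mu).
Proof.
move=> hmu hnu.
have h1 (X : finType) (Y : choiceType) (f : X -> Y) (a : A X) :
    supported (@mlinear X) a ->
    supported (fun t => perm_eq (leaves t) (map f (enum X))) (mrelabel f a).
  move=> ha; apply: (supported_linext ha) => t pt.
  apply: sub_supported (supported_tsubst (s := fun i => [:: f i]) _ t) => [u|i].
    by rewrite flatten_map1 => /perm_trans; apply; apply: perm_map.
  by apply: supportedU => /=.
apply: (supported_linext hmu) => t pt.
apply: sub_supported (supported_tsubst _ t) => [u|j]; last exact: h1.
move=> /perm_trans; apply; apply: (perm_trans (perm_flatten (perm_map _ pt))).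
apply: uniq_perm; rewrite ?enum_uniq //.
  apply: allpairs_uniq_dep => [|j _|[j x] [j' x'] _ _ []//]; exact: enum_uniq.
move=> [j x]; rewrite mem_enum; apply/flatten_mapP.
by exists j; [rewrite mem_enum | apply/mapP; exists x; rewrite ?mem_enum].
Qed.

End Magma.

(* The free operad on E = k[Sigma_2] (x) k^G: F(E)(I) has as basis the planar *)
(* binary trees with nodes labelled in G and leaves labelled bijectively by I;*)
(* g in G is the tree with one node, its opposite the tree with exchanged     *)
(* leaves. *)
Section FreeOperad.
Context (k : fieldType) (G : choiceType).

Local Notation A X := {malg k[tree G X]}.

Section Space.
Context (I : finType).

Definition multilinear : {pred A I} := supported (@mlinear G I).

Fact multilinear_closed : submod_closed multilinear.
Proof. exact: supported_closed. Qed.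

HB.instance Definition _ :=
  GRing.isSubmodClosed.Build k (A I) multilinear multilinear_closed.

Record free_space := FreeElt { free_val :> A I; _ : free_val \in multilinear }.

HB.instance Definition _ := [isSub for free_val].
HB.instance Definition _ := [Choice of free_space by <:].
HB.instance Definition _ := [SubChoice_isSubLmodule of free_space by <:].

Lemma free_valP (x : free_space) : supported (@mlinear G I) (free_val x).
Proof. exact: (valP x). Qed.

Lemma free_val_linear : linear free_val.
Proof. by []. Qed.

(* Junk value 0 when t is not multilinear. *)
Definition monomial (t : tree G I) : free_space := insubd 0 << t >>.

Lemma val_monomial t : mlinear t -> free_val (monomial t) = << t >>.
Proof. by move=> mt; apply: insubdK; apply: supportedU. Qed.

End Space.

(* The default 0 is reached only when f is not bijective, see val_relabel. *)
Definition free_relabel (I J : finType) (f : I -> J) (x : free_space I) :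
    free_space J :=
  insubd 0 (mrelabel f (free_val x)).

Definition free_unit : free_space unit := monomial (Leaf tt).

Definition free_comp (J : finType) (K : J -> finType) (mu : free_space J)
    (nu : forall j, free_space (K j)) : free_space {j : J & K j} :=
  FreeElt (supported_bind (free_valP mu) (fun j => free_valP (nu j))).

Lemma val_relabel (I J : finType) (f : I -> J) x : bijective f ->
  free_val (free_relabel f x) = mrelabel f (free_val x).
Proof.
move=> bf; apply: insubdK; apply: (supported_linext (free_valP x)) => t pt.
apply: sub_supported (supported_tsubst (s := fun i => [:: f i]) _ t) => [u|i].
  rewrite flatten_map1 => /perm_trans; apply.
  apply: (perm_trans (perm_map _ pt)).
  have fI : injective f by exact: bij_inj.
  apply: uniq_perm => [||j]; [|exact: enum_uniq|].
    by rewrite (map_inj_uniq fI); exact: enum_uniq.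
  case: bf => g fK gK; rewrite mem_enum -[j]gK.
  by apply: map_f; rewrite mem_enum.
by apply: supportedU => /=.
Qed.

Lemma val_unit : free_val free_unit = << Leaf tt >>.
Proof.
apply: val_monomial; apply: uniq_perm => [||[]] //; first exact: enum_uniq.
by rewrite mem_enum.
Qed.

Lemma free_val_inj (I : finType) : injective (@free_val I).
Proof. exact: val_inj. Qed.

Lemma free_relabel_linear (I J : finType) (f : I -> J) :
  bijective f -> linear (free_relabel f).
Proof.
move=> bf c x y; apply: free_val_inj; rewrite free_val_linear.
by rewrite 3!(val_relabel _ bf) free_val_linear mrelabel_lin.
Qed.

Lemma free_relabel_id (I : finType) (x : free_space I) : free_relabel id x = x.
Proof.
by apply: free_val_inj; rewrite val_relabel ?mrelabel_id //; exists id.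
Qed.

Lemma free_relabel_comp (I J L : finType) (f : I -> J) (g : J -> L) x :
  bijective f -> bijective g ->
  free_relabel g (free_relabel f x) = free_relabel (g \o f) x.
Proof.
move=> bf bg; apply: free_val_inj; rewrite !val_relabel ?mrelabel_comp //.
exact: bij_comp.
Qed.

Lemma free_comp_linearl (J : finType) (K : J -> finType)
    (nu : forall j, free_space (K j)) : linear (fun mu => free_comp mu nu).
Proof. by move=> c x y; apply: free_val_inj; apply: bind_lin. Qed.

Lemma tsubst_notin (I X : choiceType) (nu nu' : I -> A X) t :
  {in leaves t, nu =1 nu'} -> tsubst nu t = tsubst nu' t.
Proof.
elim: t => [i|g l IHl r IHr] /= h; first by rewrite h ?mem_head.
by rewrite IHl ?IHr // => i it; apply: h; rewrite mem_cat it ?orbT.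
Qed.

Lemma tsubst_slot (I X : choiceType) (nu nu1 nu2 : I -> A X) (c : k) i t :
  nu i = c *: nu1 i + nu2 i ->
  (forall j, j != i -> nu j = nu1 j /\ nu j = nu2 j) ->
  uniq (leaves t) -> i \in leaves t ->
  tsubst nu t = c *: tsubst nu1 t + tsubst nu2 t.
Proof.
move=> ni nj; elim: t => [j|g l IHl r IHr] /=; first by rewrite inE => _ /eqP <-.
rewrite cat_uniq mem_cat => /and3P[ul dlr ur].
have off s : i \notin leaves s ->
    tsubst nu s = tsubst nu1 s /\ tsubst nu s = tsubst nu2 s.
  move=> ns; split; apply: tsubst_notin => j js;
  by case: (nj j) => //; apply: contraNneq ns => <-.
case il: (i \in leaves l) => /= ir.
  have [|<- <-] := off r; first by apply: (hasPn _ _ il) => //; rewrite has_sym.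
  by rewrite IHl // graft_linl.
have [|<- <-] := off l; first by rewrite il.
by rewrite IHr // graft_linr.
Qed.

Lemma free_comp_linearr (J : finType) (K : J -> finType) (mu : free_space J)
    (nu : forall j, free_space (K j)) (j : J) :
  linear (fun x : free_space (K j) => free_comp mu (dfwith nu x)).
Proof.
move=> c x y; apply: free_val_inj; rewrite free_val_linear /=.
rewrite /bind !linextE scaler_sumr -big_split big_seq [RHS]big_seq /=.
apply: eq_bigr => t tmu; have /allP/(_ t tmu) mt := free_valP mu.
rewrite scalerA [c * _]mulrC -scalerA -scalerDr; congr (_ *: _).
apply: (@tsubst_slot _ _ _ _ _ c j).
- by rewrite !dfwith_in; apply: bind_lin.
- by move=> i ij; rewrite !dfwith_out // eq_sym.
- by rewrite (perm_uniq mt) enum_uniq.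
- by rewrite (perm_mem mt) mem_enum.
Qed.

Lemma bij_tag (J : finType) (K K' : J -> finType) (f : forall j, K j -> K' j) :
  (forall j, bijective (f j)) ->
  bijective (fun u : {j : J & K j} =>
               existT (fun j => K' j) (tag u) (f (tag u) (tagged u))).
Proof.
move=> bf; apply: inj_card_bij.
  move=> [i x] [j y] /= E; have ij := congr1 tag E; rewrite /= in ij.
  by case: j / ij y E => y /eqP; rewrite eq_Tagged => /eqP/(bij_inj (bf i)) ->.
rewrite !card_tagged leq_eqVlt; apply/orP; left; apply/eqP; congr sumn.
by apply: eq_map => j; rewrite (bij_eq_card (bf j)).
Qed.

Lemma bij_tagl (J J' : finType) (K : J' -> finType) (f : J -> J') :
  bijective f ->
  bijective (fun u : {j : J & K (f j)} =>
               existT (fun j => K j) (f (tag u)) (tagged u)).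
Proof.
move=> [g fK gK].
exists (fun u : {j : J' & K j} =>
  existT (fun j => K (f j)) (g (tag u))
    (ecast j (K j) (esym (gK (tag u))) (tagged u))).
- case=> i x /=; move: (gK _) => /=; rewrite fK => e.
  by rewrite eq_axiomK.
- case=> j x /=.
  suff H : forall j' (e : j' = j), existT (fun j => Finite.sort (K j)) j'
      (ecast j (K j) (esym e) x) = existT (fun j => Finite.sort (K j)) j x by exact: H.
  by move=> j' e; case: j / e x.
Qed.

Lemma bij_assoc (J : finType) (K : J -> finType) (L : {j : J & K j} -> finType) :
  bijective (fun u : {j : J & {i : K j & L (existT (fun j => K j) j i)}} =>
               existT (fun p => L p)
                 (existT (fun j => K j) (tag u) (tag (tagged u)))
                 (tagged (tagged u))).
Proof.
exists (fun v : {p : {j : J & K j} & L p} =>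
  match v with existT p x =>
    match p as p return L p -> _ with existT j i => fun x =>
      existT (fun j => {i : K j & L (existT (fun j => K j) j i)}) j
        (existT (fun i => L (existT (fun j => K j) j i)) i x) end x end).
- by case=> j [i x].
- by case=> [[j i] x].
Qed.

Lemma bij_pairl (J : finType) : bijective (fun j : J => existT (fun=> J) tt j).
Proof. by exists (fun u : {_ : unit & J} => tagged u) => [j|[[] j]]. Qed.

Lemma bij_pairr (J : finType) : bijective (fun j : J => existT (fun=> unit) j tt).
Proof. by exists (fun u : {_ : J & unit} => tag u) => [j|[j []]]. Qed.

Lemma free_comp_relabell (J J' : finType) (K : J' -> finType) (f : J -> J')
    (mu : free_space J) (nu : forall j, free_space (K j)) :
  bijective f ->
  free_comp (free_relabel f mu) nu =
  free_relabel (fun u : {j : J & K (f j)} =>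
                  existT (fun j => K j) (f (tag u)) (tagged u))
               (free_comp mu (fun j => nu (f j))).
Proof.
move=> bf; apply: free_val_inj; rewrite val_relabel; last exact: bij_tagl.
rewrite /= val_relabel // bind_mrelabel mrelabel_bind.
by apply: eq_bind => j; rewrite /= mrelabel_comp.
Qed.

Lemma free_comp_relabelr (J : finType) (K K' : J -> finType)
    (f : forall j, K j -> K' j) (mu : free_space J)
    (nu : forall j, free_space (K j)) :
  (forall j, bijective (f j)) ->
  free_comp mu (fun j => free_relabel (f j) (nu j)) =
  free_relabel (fun u : {j : J & K j} =>
                  existT (fun j => K' j) (tag u) (f (tag u) (tagged u)))
               (free_comp mu nu).
Proof.
move=> bf; apply: free_val_inj; rewrite val_relabel; last exact: bij_tag.
rewrite /= mrelabel_bind.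
by apply: eq_bind => j; rewrite val_relabel // !mrelabel_comp.
Qed.

Lemma free_comp_unitl (J : finType) (mu : free_space J) :
  free_comp free_unit (fun=> mu) = free_relabel (fun j => existT (fun=> J) tt j) mu.
Proof.
apply: free_val_inj; rewrite val_relabel; last exact: bij_pairl.
by rewrite /= val_unit bindU.
Qed.

Lemma free_comp_unitr (J : finType) (mu : free_space J) :
  free_comp mu (fun=> free_unit) = free_relabel (fun j => existT (fun=> unit) j tt) mu.
Proof.
apply: free_val_inj; rewrite val_relabel; last exact: bij_pairr.
by apply: eq_bind => j; rewrite val_unit mrelabelU.
Qed.

Lemma free_compA (J : finType) (K : J -> finType)
    (L : {j : J & K j} -> finType) (la : free_space J)
    (mu : forall j, free_space (K j)) (nu : forall p, free_space (L p)) :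
  free_comp (free_comp la mu) nu =
  free_relabel (fun u : {j : J & {i : K j & L (existT (fun j => K j) j i)}} =>
                  existT (fun p => L p)
                    (existT (fun j => K j) (tag u) (tag (tagged u)))
                    (tagged (tagged u)))
    (free_comp la (fun j => free_comp (mu j)
                              (fun i => nu (existT (fun j => K j) j i)))).
Proof.
apply: free_val_inj; rewrite val_relabel; last exact: bij_assoc.
rewrite /= bindA mrelabel_bind; apply: eq_bind => j.
rewrite bind_mrelabel mrelabel_comp mrelabel_bind; apply: eq_bind => i /=.
by rewrite mrelabel_comp.
Qed.

Definition free_operad : operad k :=
  Operad free_relabel_linear free_relabel_id free_relabel_comp
    free_comp_linearl free_comp_linearr free_comp_relabell free_comp_relabelr
    free_comp_unitl free_comp_unitr free_compA.

End FreeOperad.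

Section QuotientOperad.
Context (k : fieldType) (P : operad k).

Definition op_ideal (Z : forall I : finType, P I -> Prop) : Prop :=
  [/\ forall I, submod_pred (Z I),
      forall (I J : finType) (f : I -> J) x,
        bijective f -> Z I x -> Z J (relabel f x),
      forall (J : finType) (K : J -> finType) (mu : P J)
        (nu : forall j, P (K j)), Z J mu -> Z {j : J & K j} (ocomp mu nu) &
      forall (J : finType) (K : J -> finType) (mu : P J)
        (nu : forall j, P (K j)) j,
        Z (K j) (nu j) -> Z {j : J & K j} (ocomp mu nu)].

Context (n : nat) (R : P 'I_n -> Prop).

Definition ideal_gen (I : finType) (x : P I) : Prop :=
  forall Z : forall I : finType, P I -> Prop,
    op_ideal Z -> (forall r, R r -> Z 'I_n r) -> Z I x.

Lemma ideal_gen_ideal : op_ideal ideal_gen.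
Proof.
split.
- move=> I; split=> [Z iZ _|a x y Ix Iy Z iZ RZ].
    by case: iZ => sZ _ _ _; case: (sZ I).
  have [sZ _ _ _] := iZ; case: (sZ I) => _; apply; first exact: Ix.
  exact: Iy.
- by move=> I J f x bf Ix Z iZ RZ; have [_ + _ _] := iZ; apply=> //; apply: Ix.
- by move=> J K mu nu Im Z iZ RZ; have [_ _ + _] := iZ; apply=> //; apply: Im.
- move=> J K mu nu j In Z iZ RZ; have [_ _ _ rZ] := iZ.
  by apply: (rZ _ _ _ _ j); apply: In.
Qed.

Lemma ideal_gen_sub r : R r -> ideal_gen r.
Proof. by move=> Rr Z _; apply. Qed.

Lemma span_ideal (I : finType) (x : P I) : span (@ideal_gen I) x <-> ideal_gen x.
Proof.
split; last exact: sub_span.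
by have [sI _ _ _] := ideal_gen_ideal; apply: span_sub => //; apply: sI.
Qed.

Definition quot_space (I : finType) : lmodType k := quot (@ideal_gen I).

Definition qpi (I : finType) (x : P I) : quot_space I := quot_pi (@ideal_gen I) x.

Lemma qpi_eq (I : finType) (x y : P I) : qpi x = qpi y <-> ideal_gen (x - y).
Proof. by rewrite -span_ideal; apply: quot_pi_eq. Qed.

Lemma qpi_linear (I : finType) : linear (@qpi I).
Proof. exact: quot_pi_linear. Qed.

Lemma qpiK (I : finType) (q : quot_space I) : qpi (repr q) = q.
Proof. exact: quot_piK. Qed.

Lemma qpi_repr (I : finType) (x : P I) : ideal_gen (repr (qpi x) - x).
Proof. by apply/qpi_eq; rewrite qpiK. Qed.

Lemma qpi_ex (I : finType) (q : quot_space I) : exists x, q = qpi x.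
Proof. by exists (repr q); rewrite qpiK. Qed.

Lemma qpi_exf (J : finType) (K : J -> finType) (q : forall j, quot_space (K j)) :
  exists nu : forall j, P (K j), q = fun j => qpi (nu j).
Proof. by exists (fun j => repr (q j)); apply: functional_extensionality_dep => j; rewrite qpiK. Qed.

Definition quot_relabel (I J : finType) (f : I -> J) (q : quot_space I) :=
  qpi (relabel f (repr q)).

Definition quot_comp (J : finType) (K : J -> finType) (mu : quot_space J)
    (nu : forall j, quot_space (K j)) : quot_space {j : J & K j} :=
  qpi (ocomp (repr mu) (fun j => repr (nu j))).

Lemma lin_sub (U V : lmodType k) (f : U -> V) x y : linear f -> f (x - y) = f x - f y.
Proof. by move=> lf; rewrite addrC -scaleN1r lf scaleN1r addrC. Qed.

Lemma qrelabelE (I J : finType) (f : I -> J) x : bijective f ->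
  quot_relabel f (qpi x) = qpi (relabel f x).
Proof.
move=> bf; apply/qpi_eq; rewrite -lin_sub; last exact: relabel_linear.
by have [_ rI _ _] := ideal_gen_ideal; apply: rI => //; apply: qpi_repr.
Qed.

Lemma ideal_gen0 (I : finType) : ideal_gen (0 : P I).
Proof. by have [sI _ _ _] := ideal_gen_ideal; case: (sI I). Qed.

Lemma ideal_genD (I : finType) (x y : P I) :
  ideal_gen x -> ideal_gen y -> ideal_gen (x + y).
Proof.
have [sI _ _ _] := ideal_gen_ideal; case: (sI I) => _ h Ix Iy.
by rewrite -(scale1r x); apply: h.
Qed.

Lemma ocomp_congr (J : finType) (K : J -> finType) (mu mu' : P J)
    (nu nu' : forall j, P (K j)) :
  ideal_gen (mu - mu') -> (forall j, ideal_gen (nu j - nu' j)) ->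
  ideal_gen (ocomp mu nu - ocomp mu' nu').
Proof.
move=> Imu Inu; have [_ _ lI rI] := ideal_gen_ideal.
rewrite -(subrK (ocomp mu' nu) (ocomp mu nu)) -addrA; apply: ideal_genD.
  by rewrite -(@lin_sub _ _ (fun m => ocomp m nu)); [apply: lI|apply: ocomp_linearl].
pose nus (s : seq J) j := if j \in s then nu' j else nu j.
have -> : nu' = nus (enum J).
  by apply: functional_extensionality_dep => j; rewrite /nus mem_enum.
elim: (enum J) => [|i s IHs].
  have -> : nus [::] = nu by apply: functional_extensionality_dep.
  by rewrite subrr; apply: ideal_gen0.
rewrite -(subrK (ocomp mu' (nus s)) (ocomp mu' nu)) -addrA.
apply: ideal_genD => //.
have -> : nus (i :: s) = dfwith (nus s) (nu' i).
  apply: functional_extensionality_dep => j; case: dfwithP => [|j' ij].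
    by rewrite /nus mem_head.
  by rewrite /nus inE eq_sym (negPf ij).
have {1}-> : nus s = dfwith (nus s) (nus s i).
  by apply: functional_extensionality_dep => j; case: dfwithP.
rewrite -(@lin_sub _ _ (fun x => ocomp mu' (dfwith (nus s) x)));
  last exact: ocomp_linearr.
apply: (rI _ _ _ _ i); rewrite dfwith_in /nus.
by case: ifP => _; [rewrite subrr; apply: ideal_gen0|apply: Inu].
Qed.

Lemma qcompE (J : finType) (K : J -> finType) (mu : P J)
    (nu : forall j, P (K j)) :
  quot_comp (qpi mu) (fun j => qpi (nu j)) = qpi (ocomp mu nu).
Proof. by apply/qpi_eq; apply: ocomp_congr => [|j]; apply: qpi_repr. Qed.

Lemma dfwith_qpi (J : finType) (K : J -> finType) (nu : forall j, P (K j)) j x :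
  dfwith (fun j => qpi (nu j)) (qpi x) = fun i => qpi (@dfwith _ _ nu j x i).
Proof.
apply: functional_extensionality_dep => i; case: dfwithP => [|i' ii'].
  by rewrite dfwith_in.
by rewrite dfwith_out.
Qed.

Lemma quot_relabel_linear (I J : finType) (f : I -> J) :
  bijective f -> linear (quot_relabel f).
Proof.
move=> bf a p q; have [x ->] := qpi_ex p; have [y ->] := qpi_ex q.
by rewrite -qpi_linear !qrelabelE // relabel_linear // qpi_linear.
Qed.

Lemma quot_relabel_id (I : finType) (q : quot_space I) : quot_relabel id q = q.
Proof. by rewrite /quot_relabel relabel_id qpiK. Qed.

Lemma quot_relabel_comp (I J L : finType) (f : I -> J) (g : J -> L) q :
  bijective f -> bijective g ->
  quot_relabel g (quot_relabel f q) = quot_relabel (g \o f) q.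
Proof.
move=> bf bg; have [x ->] := qpi_ex q.
by rewrite !qrelabelE ?relabel_comp //; apply: bij_comp.
Qed.

Lemma quot_comp_linearl (J : finType) (K : J -> finType)
    (nu : forall j, quot_space (K j)) : linear (fun mu => quot_comp mu nu).
Proof.
move=> a p q; have [x ->] := qpi_ex p; have [y ->] := qpi_ex q.
have [m ->] := qpi_exf nu.
by rewrite -qpi_linear !qcompE (ocomp_linearl m) qpi_linear.
Qed.

Lemma quot_comp_linearr (J : finType) (K : J -> finType) (mu : quot_space J)
    (nu : forall j, quot_space (K j)) (j : J) :
  linear (fun x : quot_space (K j) => quot_comp mu (dfwith nu x)).
Proof.
move=> a p q; have [x ->] := qpi_ex p; have [y ->] := qpi_ex q.
have [l ->] := qpi_ex mu; have [m ->] := qpi_exf nu.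
by rewrite -qpi_linear !dfwith_qpi !qcompE (ocomp_linearr l m (j := j)) qpi_linear.
Qed.

Lemma quot_comp_relabell (J J' : finType) (K : J' -> finType) (f : J -> J')
    (mu : quot_space J) (nu : forall j, quot_space (K j)) :
  bijective f ->
  quot_comp (quot_relabel f mu) nu =
  quot_relabel (fun u : {j : J & K (f j)} =>
                  existT (fun j => K j) (f (tag u)) (tagged u))
               (quot_comp mu (fun j => nu (f j))).
Proof.
move=> bf; have [l ->] := qpi_ex mu; have [m ->] := qpi_exf nu.
rewrite qrelabelE // (qcompE l (fun j => m (f j))) qcompE qrelabelE.
  by rewrite ocomp_relabell.
exact: bij_tagl.
Qed.

Lemma quot_comp_relabelr (J : finType) (K K' : J -> finType)
    (f : forall j, K j -> K' j) (mu : quot_space J)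
    (nu : forall j, quot_space (K j)) :
  (forall j, bijective (f j)) ->
  quot_comp mu (fun j => quot_relabel (f j) (nu j)) =
  quot_relabel (fun u : {j : J & K j} =>
                  existT (fun j => K' j) (tag u) (f (tag u) (tagged u)))
               (quot_comp mu nu).
Proof.
move=> bf; have [l ->] := qpi_ex mu; have [m ->] := qpi_exf nu.
rewrite qcompE qrelabelE; last exact: bij_tag.
rewrite -ocomp_relabelr // -qcompE; congr quot_comp.
by apply: functional_extensionality_dep => j; rewrite qrelabelE.
Qed.

Lemma quot_comp_unitl (J : finType) (mu : quot_space J) :
  quot_comp (qpi ounit) (fun=> mu) = quot_relabel (fun j => existT (fun=> J) tt j) mu.
Proof.
have [l ->] := qpi_ex mu; rewrite (qcompE ounit (fun=> l)) qrelabelE.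
  by rewrite ocomp_unitl.
exact: bij_pairl.
Qed.

Lemma quot_comp_unitr (J : finType) (mu : quot_space J) :
  quot_comp mu (fun=> qpi ounit) = quot_relabel (fun j => existT (fun=> unit) j tt) mu.
Proof.
have [l ->] := qpi_ex mu; rewrite (qcompE l (fun=> ounit)) qrelabelE.
  by rewrite ocomp_unitr.
exact: bij_pairr.
Qed.

Lemma quot_compA (J : finType) (K : J -> finType)
    (L : {j : J & K j} -> finType) (la : quot_space J)
    (mu : forall j, quot_space (K j)) (nu : forall p, quot_space (L p)) :
  quot_comp (quot_comp la mu) nu =
  quot_relabel (fun u : {j : J & {i : K j & L (existT (fun j => K j) j i)}} =>
                  existT (fun p => L p)
                    (existT (fun j => K j) (tag u) (tag (tagged u)))
                    (tagged (tagged u)))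
    (quot_comp la (fun j => quot_comp (mu j)
                              (fun i => nu (existT (fun j => K j) j i)))).
Proof.
have [l ->] := qpi_ex la; have [m ->] := qpi_exf mu; have [n' ->] := qpi_exf nu.
rewrite 2!qcompE ocompA -qrelabelE; last exact: bij_assoc.
apply: congr1.
have E : (fun j => quot_comp (qpi (m j))
                      (fun i => qpi (n' (existT (fun j => K j) j i)))) =
          (fun j => qpi (ocomp (m j) (fun i => n' (existT (fun j => K j) j i)))).
  apply: functional_extensionality_dep => j.
  exact: (qcompE (m j) (fun i => n' (existT (fun j => K j) j i))).
by rewrite E; symmetry; apply: qcompE.
Qed.

Definition quot_operad : operad k :=
  Operad quot_relabel_linear quot_relabel_id quot_relabel_comp
    quot_comp_linearl quot_comp_linearr quot_comp_relabell quot_comp_relabelr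
    quot_comp_unitl quot_comp_unitr quot_compA.

Lemma qpi_hom : @operad_hom k P quot_operad qpi.
Proof.
split=> [I|I J f x bf||J K mu nu] //.
- exact: qpi_linear.
- by rewrite -qrelabelE.
- by rewrite -qcompE.
Qed.

End QuotientOperad.

Arguments quot_operad {k P n} R.
Arguments qpi {k P n} R {I} x.

Section FreeMap.
Context (k : fieldType) (G H : choiceType) (h : G -> H).

Fixpoint tree_map (I : Type) (t : tree G I) : tree H I :=
  match t with
  | Leaf i => Leaf i
  | Node g l r => Node (h g) (tree_map l) (tree_map r)
  end.

Lemma leaves_map (I : Type) (t : tree G I) : leaves (tree_map t) = leaves t.
Proof. by elim: t => //= g l -> r ->. Qed.

Definition mmap_gen (I : choiceType) : {malg k[tree G I]} -> {malg k[tree H I]} :=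
  linext (fun t => << tree_map t >>).

Lemma mmap_gen_linear (I : choiceType) : linear (@mmap_gen I).
Proof. exact: linext_linear. Qed.

Lemma mmap_gen_graft (I : choiceType) g (a b : {malg k[tree G I]}) :
  mmap_gen (graft g a b) = graft (h g) (mmap_gen a) (mmap_gen b).
Proof.
move: a; apply: linear_malgP => [c x y|c x y|s].
- by rewrite graft_linl mmap_gen_linear.
- by rewrite mmap_gen_linear graft_linl.
move: b; apply: linear_malgP => [c x y|c x y|t].
- by rewrite graft_linr mmap_gen_linear.
- by rewrite mmap_gen_linear graft_linr.
by rewrite graftU /mmap_gen !linextU graftU.
Qed.

Lemma mmap_gen_bind (I X : choiceType) (nu : I -> {malg k[tree G X]}) a :
  mmap_gen (bind nu a) = bind (fun i => mmap_gen (nu i)) (mmap_gen a).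
Proof.
move: a; apply: linear_malgP => [c x y|c x y|t].
- by rewrite bind_lin mmap_gen_linear.
- by rewrite mmap_gen_linear bind_lin.
have -> : mmap_gen << t >> = << tree_map t >> by exact: linextU.
rewrite !bindU.
by elim: t => [i|g l IHl r IHr] //=; rewrite mmap_gen_graft IHl IHr.
Qed.

Lemma mmap_gen_relabel (I X : choiceType) (f : I -> X) a :
  mmap_gen (mrelabel f a) = mrelabel f (mmap_gen a).
Proof.
by rewrite mmap_gen_bind; apply: eq_bind => i; rewrite /mmap_gen linextU.
Qed.

Lemma supported_mmap_gen (I : finType) (a : {malg k[tree G I]}) :
  supported (@mlinear G I) a -> supported (@mlinear H I) (mmap_gen a).
Proof.
move=> ha; apply: (supported_linext ha) => t pt.
by apply: supportedU; rewrite /mlinear leaves_map.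
Qed.

Definition free_map (I : finType) (x : free_operad k G I) : free_operad k H I :=
  FreeElt (supported_mmap_gen (free_valP x)).

Lemma free_map_hom : operad_hom free_map.
Proof.
split=> [I c x y|I J f x bf||J K mu nu]; apply: free_val_inj => /=.
- exact: mmap_gen_linear.
- by rewrite !val_relabel //= mmap_gen_relabel.
- by rewrite !val_unit /mmap_gen linextU.
- by rewrite mmap_gen_bind; apply: eq_bind => j; rewrite mmap_gen_relabel.
Qed.

End FreeMap.
Arguments free_map {k G H} h {I} x.

Section Induced.
Context (k : fieldType) (P Q : operad k) (m n : nat).
Context (R : P 'I_m -> Prop) (S : Q 'I_n -> Prop).
Context (phi : forall I, P I -> Q I).

(* Independent of the representative when phi is a morphism with             *)
(* phi R contained in the ideal (S), see quot_map_pi. *)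
Definition quot_map (I : finType) (q : quot_operad R I) : quot_operad S I :=
  qpi S (phi (repr (q : quot_space R I))).

Hypothesis phi_hom : operad_hom phi.
Hypothesis RS : forall r, R r -> ideal_gen S (phi r).

Lemma quot_map_pi (I : finType) (x : P I) : quot_map (qpi R x) = qpi S (phi x).
Proof.
apply/qpi_eq; have [pl pr pu pc] := phi_hom.
rewrite -lin_sub //; move: (@qpi_repr k P m R I x) => /(_ (fun I x => ideal_gen S (phi x))).
have [sI rI cl cr] := @ideal_gen_ideal k Q n S.
apply=> //; split=> [J|J L f y bf Sy|J K mu nu Sm|J K mu nu j Sn].
- have [s0 sD] := sI J; split=> [|a y z Sy Sz]; last by rewrite pl; apply: sD.
  by rewrite -(subrr 0) lin_sub // subrr.
- by rewrite pr //; apply: rI.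
- by rewrite pc; apply: cl.
- by rewrite pc; apply: (cr _ _ _ _ j).
Qed.

Lemma quot_map_hom : operad_hom quot_map.
Proof.
have [pl pr pu pc] := phi_hom; have [ql qr qu qc] := @qpi_hom k Q n S.
have [ql' qr' qu' qc'] := @qpi_hom k P m R.
split=> [I a p q|I J f p bf||J K mu nu].
- have [x ->] := qpi_ex p; have [y ->] := qpi_ex q.
  by rewrite -qpi_linear !quot_map_pi pl qpi_linear.
- have [x ->] := qpi_ex p.
  by rewrite -qr' // !quot_map_pi pr // qr.
- by rewrite -qu' quot_map_pi pu qu.
- have [l ->] := qpi_ex mu; have [l' ->] := qpi_exf nu.
  rewrite -qc' !quot_map_pi pc qc; congr ocomp.
  by apply: functional_extensionality_dep => j; rewrite quot_map_pi.
Qed.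

End Induced.

(* The composite product of Sigma-modules, by generators and relations:        *)
(* (P o Q)(I) is the quotient of                                              *)
(*   (+)_l (+)_(f : I -> 'I_l) P(l) (x) (x)_(s < l) Q(f^-1(s))                *)
(* by the action of Sigma_l. Non-surjective f contribute 0 if Q(empty) = 0. *)
Section Composite.
Context (k : fieldType) (P Q : operad k) (I : finType).

Record comp_gen := CompGen {
  cg_len : nat;
  cg_map : I -> 'I_cg_len;
  cg_root : P 'I_cg_len;
  cg_branch : forall s : 'I_cg_len, Q {i : I | cg_map i == s}
}.

Definition fiber_perm (l : nat) (f : I -> 'I_l) (s : {perm 'I_l}) (t : 'I_l)
    (u : {i : I | s (f i) == s t}) : {i : I | f i == t} :=
  exist _ (val u) (etrans (esym (inj_eq (@perm_inj _ s) _ _)) (valP u)).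

Definition cg (l : nat) (f : I -> 'I_l) (mu : P 'I_l)
    (nu : forall s, Q {i : I | f i == s}) : {malg k[{classic comp_gen}]} :=
  << (CompGen mu nu : {classic comp_gen}) >>.

Variant comp_rel : {malg k[{classic comp_gen}]} -> Prop :=
| comp_linearl (l : nat) (f : I -> 'I_l) a mu mu' nu :
    comp_rel (cg (f := f) (a *: mu + mu') nu - (a *: cg mu nu + cg mu' nu))
| comp_linearr (l : nat) (f : I -> 'I_l) a mu
    (nu : forall s, Q {i : I | f i == s}) s (x y : Q {i : I | f i == s}) :
    comp_rel (cg mu (dfwith nu (a *: x + y)) -
              (a *: cg mu (dfwith nu x) + cg mu (dfwith nu y)))
| comp_equiv (l : nat) (f : I -> 'I_l) (s : {perm 'I_l}) mu
    (nu : forall t, Q {i : I | s (f i) == t}) :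
    comp_rel (cg (relabel s mu) nu -
              cg mu (fun t => relabel (@fiber_perm l f s t) (nu (s t)))).

Definition composite : lmodType k := quot comp_rel.

Section Xi.
Context (T : operad k).
Context (cP : forall I, P I -> T I) (cQ : forall I, Q I -> T I).

(* mu(nu_1, ..., nu_l), for mu in P(l) and nu_s in Q(f^-1(s)). *)
Definition compose_gen (c : {classic comp_gen}) : T I :=
  relabel (fun u : {s : 'I_(cg_len c) & {i : I | cg_map c i == s}} =>
             val (tagged u))
          (ocomp (cP (cg_root c)) (fun s => cQ (@cg_branch c s))).

(* Independent of the representative, see compose_map_pi. *)
Definition compose_map (q : composite) : T I := linext compose_gen (repr q).

Hypotheses (cP_hom : operad_hom cP) (cQ_hom : operad_hom cQ).

Lemma fiber_bij (l : nat) (f : I -> 'I_l) :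
  bijective (fun u : {s : 'I_l & {i : I | f i == s}} => val (tagged u)).
Proof.
exists (fun i => existT (fun s => {i : I | f i == s}) (f i) (exist _ i (eqxx _))) => //.
case=> s [i fi] /=; case: _ / (eqP fi) (fi) => fi'.
by rewrite (bool_irrelevance fi' (eqxx _)).
Qed.

Lemma fiber_perm_bij (l : nat) (f : I -> 'I_l) (s : {perm 'I_l}) t :
  bijective (@fiber_perm l f s t).
Proof.
have H (u : {i : I | f i == t}) : s (f (val u)) == s t.
  by rewrite (eqP (valP u)).
by exists (fun u => exist _ (val u) (H u)) => u; apply: val_inj.
Qed.

Lemma compose_map_pi x : compose_map (quot_pi comp_rel x) = linext compose_gen x.
Proof.
suff H (y : {malg k[{classic comp_gen}]}) : span comp_rel y -> linext compose_gen y = 0.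
  apply/eqP; rewrite -subr_eq0 -(lin_sub _ _ (linext_linear compose_gen)).
  by apply/eqP; apply: H; apply: repr_quot_pi.
move: y; apply: (@span_sub _ _ comp_rel (fun y => linext compose_gen y = 0)) => [|y].
  split=> [|a u v u0 v0]; first by rewrite linear0.
  by rewrite linext_linear u0 v0 scaler0 addr0.
have [pl pr pu pc] := cP_hom; have [ql qr qu qc] := cQ_hom.
case=> [l f a mu mu' nu|l f a mu nu s u v|l f s mu nu]; rewrite lin_sub;
  try exact: linext_linear; rewrite ?linext_linear !linextU /compose_gen /=;
  apply/eqP; rewrite subr_eq0; apply/eqP.
- rewrite -(relabel_linear (fiber_bij f)) pl.
  by rewrite (ocomp_linearl (fun s => cQ (nu s))).
- rewrite -(relabel_linear (fiber_bij f)).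
  have E w : (fun t => cQ (dfwith nu w t)) =
             dfwith (fun t => cQ (nu t)) (cQ w) :> forall t, T {i | f i == t}.
    apply: functional_extensionality_dep => t; case: dfwithP => [|t' st].
      by rewrite dfwith_in.
    by rewrite dfwith_out.
  by rewrite !E ql ocomp_linearr.
have sB : bijective s by exact: (Bijective (permK s) (permKV s)).
rewrite pr // ocomp_relabell // relabel_comp;
  [|exact: bij_tagl|exact: fiber_bij].
have -> : (fun t => cQ (relabel (@fiber_perm l f s t) (nu (s t)))) =
          (fun t => relabel (@fiber_perm l f s t) (cQ (nu (s t)))).
  by apply: functional_extensionality_dep => t; rewrite qr //; apply: fiber_perm_bij.
rewrite ocomp_relabelr; last by move=> t; apply: fiber_perm_bij.
rewrite relabel_comp //; last exact: fiber_bij.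
by apply: bij_tag => t; apply: fiber_perm_bij.
Qed.

End Xi.
End Composite.

(* E_1 and E_2 have generators G1 and G2, so E = E_1 (+) E_2 has G1 + G2. *)
Section DistributiveLaws.
Context (k : fieldType) (G1 G2 : choiceType).

Local Notation F := (free_operad k (G1 + G2)%type).

(* A spanning set, stable under Sigma_3, of the submodule F(E)(3)_ij: all      *)
(* g(h,1) and g(1,h) with root g in E_i and h in E_j, up to permutation. *)
Definition quad_gen (A B : Type) (a : A -> G1 + G2) (b : B -> G1 + G2)
    (v : F 'I_3) : Prop :=
  exists (s : 'S_3) g h,
    v = monomial k
          (Node (a g) (Node (b h) (Leaf (s 0)) (Leaf (s 1))) (Leaf (s 2))) \/
    v = monomial k
          (Node (a g) (Leaf (s 0)) (Node (b h) (Leaf (s 1)) (Leaf (s 2)))).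

Definition F12 : lmodType k := span_type (quad_gen inl inr).
Definition F21 : lmodType k := span_type (quad_gen inr inl).

Record rewrite_law := RewriteLaw {
  law_map :> {linear F12 -> F21};
  law_equivariant : forall (s : 'S_3) (u v : F12),
    span_val v = relabel s (span_val u) ->
    span_val (law_map v) = relabel s (span_val (law_map u))
}.

Fact zero_law_equivariant (s : 'S_3) (u v : F12) :
  span_val v = relabel s (span_val u) ->
  span_val ((\0 : {linear F12 -> F21}) v) =
  relabel s (span_val ((\0 : {linear F12 -> F21}) u)).
Proof.
move=> _ /=; have rl := @relabel_linear k F 'I_3 'I_3 s.
have sB : bijective s by exact: (Bijective (permK s) (permKV s)).
have := lin_sub 0 0 (rl sB); rewrite !subrr => E; exact: esym E.
Qed.

Definition zero_law : rewrite_law := RewriteLaw zero_law_equivariant.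

Definition rewrites (D : rewrite_law) (u v : F 'I_3) : Prop :=
  exists2 w : F12, span_val w = u & span_val (D w) = v.

Section Combined.
Context (R1 : free_operad k G1 'I_3 -> Prop) (R2 : free_operad k G2 'I_3 -> Prop).
Context (D : rewrite_law).

Variant combined_rel : F 'I_3 -> Prop :=
| combined_rel1 r : R1 r -> combined_rel (free_map inl r)
| combined_relD (w : F12) : combined_rel (span_val w - span_val (D w))
| combined_rel2 r : R2 r -> combined_rel (free_map inr r).

Definition combined : operad k := quot_operad combined_rel.

Definition incl1 (I : finType) : quot_operad R1 I -> combined I :=
  @quot_map _ _ _ _ _ R1 combined_rel (fun I => @free_map k _ _ inl I) I.

Definition incl2 (I : finType) : quot_operad R2 I -> combined I :=
  @quot_map _ _ _ _ _ R2 combined_rel (fun I => @free_map k _ _ inr I) I.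

Lemma incl1_hom : operad_hom incl1.
Proof.
apply: quot_map_hom; first exact: free_map_hom.
by move=> r Rr; apply: ideal_gen_sub; constructor.
Qed.

Lemma incl2_hom : operad_hom incl2.
Proof.
apply: quot_map_hom; first exact: free_map_hom.
by move=> r Rr; apply: ideal_gen_sub; constructor.
Qed.

(* (P_2 o P_1)(n) -> P(n) *)
Definition xi (n : nat) :
    composite (quot_operad R2) (quot_operad R1) 'I_n -> combined 'I_n :=
  compose_map incl2 incl1.

Definition distributive : Prop := forall n, (2 <= n)%N -> bijective (@xi n).

End Combined.
End DistributiveLaws.

(* In the combined generating set unit + unit, the left unit is the            *)
(* associative product and the right one the magmatic product. *)
Declare Scope tree_scope.
Delimit Scope tree_scope with T.
Notation "s • t" := (Node (inl tt) s t)
  (at level 40, left associativity) : tree_scope.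
Notation "s ∘ t" := (Node (inr tt) s t)
  (at level 40, left associativity) : tree_scope.

Section AssMag.
Context (k : fieldType).

Local Notation x := (Leaf (0 : 'I_3)).
Local Notation y := (Leaf (1 : 'I_3)).
Local Notation z := (Leaf (2 : 'I_3)).

Definition Ass_rel (r : free_operad k unit 'I_3) : Prop :=
  r = monomial k (Node tt (Node tt x y) z) - monomial k (Node tt x (Node tt y z)).

Definition Mag_rel (r : free_operad k unit 'I_3) : Prop := False.

Definition AssMag_law : Type := rewrite_law k unit unit.

Definition AssMag_distributive (D : AssMag_law) : Prop :=
  distributive Ass_rel Mag_rel D.

Definition AssMag_iso (D D' : AssMag_law) : Prop :=
  operad_iso (combined Ass_rel Mag_rel D) (combined Ass_rel Mag_rel D').

Local Notation mono t := (monomial k (t%T : tree (unit + unit) 'I_3)).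

Definition rules (D : AssMag_law) (u v : free_operad k (unit + unit)%type 'I_3) :=
  rewrites D (mono ((x ∘ y) • z)) u /\ rewrites D (mono (x • (y ∘ z))) v.

Variant truncated_label := Label_b | Label_c | Label_e | Label_f.

Definition truncated (r : truncated_label) (D : AssMag_law) : Prop :=
  match r with
  | Label_b => rules D 0 (mono ((x • y) ∘ z))
  | Label_c => rules D (mono (x ∘ (y • z))) 0
  | Label_e => rules D 0 (mono (y ∘ (x • z)))
  | Label_f => rules D (mono ((x • z) ∘ y)) 0
  end.

End AssMag.

(* Main.v *)
From HB Require Import structures.
From mathcomp Require Import all_boot all_algebra perm finmap monalg boolp zify ring.
Require Import Defs.
Set Implicit Arguments.
Unset Strict Implicit.
Unset Printing Implicit Defensive.
Import GRing.Theory.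
Local Open Scope ring_scope.

(* Idea. In the presence of a monomial law every operation is a combination   *)
(* of magmatic trees whose leaves are words, and these trees carry operations *)
(* satisfying the law, so that they are independent; as they also index a     *)
(* basis of the composite, xi is bijective. They span for every law, and the  *)
(* composite does not depend on the law. Hence, for a distributive law D,     *)
(* expanding the products u • (v • (y ∘ z)) and (y ∘ z) • (v • w) and the     *)
(* overlap (u ∘ v) • (y ∘ z) in normal forms in two ways gives quadratic      *)
(* equations for the coefficients of D. Their solutions are either zero or    *)
(* given by an idempotent of rank one, on one side only; replacing x ∘ y by a *)
(* suitable p (x ∘ y) + q (y ∘ x) turns D into a truncated law. The four      *)
(* truncated laws differ by exchanging the arguments of the generators. An    *)
(* isomorphism from (b) to the trivial law would map • to a combination of •  *)
(* and its opposite; the rule of (b), read in the free algebra of the trivial *)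
(* law, would force the images of • and ∘ to be linearly dependent. Passing   *)
(* from operads to algebras on a set of letters loses nothing, because the    *)
(* multilinear part of the T-ideal is the operadic ideal.                     *)

(** The composite [Mag ∘ Ass] has as natural basis the magmatic trees whose leaves are words, each
    letter occurring once ([represents], [composite_ind]). Whatever the law, [xi] sends the basis
    element of such a tree to the class of the tree itself ([xi_basis]); a law is therefore
    distributive when these normal forms are a basis of the combined operad.

    For the trivial and the truncated laws, a rule either kills a product or passes the acting
    factor to one fixed side of a magmatic product. The multiplication of normal forms prescribed in
    this way is associative ([wmulA]) and obeys the rules ([model_rules]), so normal forms are
    independent; conversely the rules reduce every product to it ([collect_op]), so normal forms
    span. This gives [xi_map_bij].

    For any distributive law the normal forms are still independent ([cls_independent]), and
    products in arity four that can be expanded in two ways yield [left_equations],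
    [right_equations] and [overlap_equations]. On each side of the law four coefficients survive;
    they form an idempotent matrix A with A swap A = 0, and one of the two sides vanishes. A nonzero
    such matrix has a row (p, q) with p^2 different from q^2 ([idempotent_column]), and the
    generator p (x ∘ y) + q (y ∘ x) then obeys rule (b) or rule (f).

    In the combined operad of the trivial law, an associative operation has no magmatic part
    ([associative_coeffs]). An isomorphism from (b) would thus send [•] to a combination of [•] and
    its opposite, and rule (b) would make this image zero or remove the magmatic part of the image
    of [∘] ([rule_coeffs]); both contradict injectivity in arity two ([no_kernel]).

    Calculations take place in free algebras on letters; [tideal_ideal] returns their results to the
    operad. *)

Section LinearMaps.
Context (k : fieldType) (U V : lmodType k) (f : U -> V) (lf : linear f).

Lemma linear_map0 : f 0 = 0.
Proof. by rewrite -(subrr 0) lin_sub // subrr. Qed.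

Lemma linear_mapD x y : f (x + y) = f x + f y.
Proof. by rewrite -[x in LHS]scale1r lf scale1r. Qed.

Lemma linear_mapZ a x : f (a *: x) = a *: f x.
Proof. by rewrite -[_ *: _ in LHS]addr0 lf linear_map0 addr0. Qed.

Lemma linear_map_sum (T : Type) (s : seq T) (F : T -> U) :
  f (\sum_(i <- s) F i) = \sum_(i <- s) f (F i).
Proof.
elim: s => [|i s IHs]; first by rewrite !big_nil linear_map0.
by rewrite !big_cons linear_mapD IHs.
Qed.

Lemma submod_preim (Z : V -> Prop) : submod_pred Z -> submod_pred (fun x => Z (f x)).
Proof.
by move=> [Z0 ZD]; split=> [|a x y Zx Zy]; rewrite ?linear_map0 // lf; apply: ZD.
Qed.

End LinearMaps.

Section SubmodPred.
Context (k : fieldType) (V : lmodType k) (Z : V -> Prop) (sZ : submod_pred Z).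

Lemma submodD x y : Z x -> Z y -> Z (x + y).
Proof. by move=> Zx Zy; rewrite -[x]scale1r; apply: sZ.2. Qed.

Lemma submodZ a x : Z x -> Z (a *: x).
Proof. by move=> Zx; rewrite -[_ *: _]addr0; apply: sZ.2 => //; apply: sZ.1. Qed.

Lemma submod_sum (T : eqType) (s : seq T) (F : T -> V) :
  (forall i, i \in s -> Z (F i)) -> Z (\sum_(i <- s) F i).
Proof.
elim: s => [|i s IHs] h; first by rewrite big_nil; apply: sZ.1.
rewrite big_cons; apply: submodD; first by apply: h; rewrite mem_head.
by apply: IHs => j js; apply: h; rewrite inE js orbT.
Qed.

End SubmodPred.

Lemma submod_eq0 (k : fieldType) (U V : lmodType k) (f : U -> V) :
  linear f -> submod_pred (fun x => f x = 0).
Proof.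
move=> lf; split=> [|a x y fx fy]; first exact: linear_map0.
by rewrite lf fx fy scaler0 addr0.
Qed.

Lemma malg_ind (k : fieldType) (X : choiceType) (Z : {malg k[X]} -> Prop) :
  submod_pred Z -> (forall t, Z << t >>) -> forall a, Z a.
Proof.
move=> sZ ZU a; rewrite [a]malg_sumE; apply: submod_sum => // t _.
exact: submodZ.
Qed.

Lemma free_ind (k : fieldType) (G : choiceType) (I : finType)
    (Z : free_operad k G I -> Prop) :
  submod_pred Z -> (forall t, mlinear t -> Z (monomial k t)) -> forall x, Z x.
Proof.
move=> sZ Zm x.
have -> : x = \sum_(t <- msupp (free_val x)) (free_val x)@_t *: monomial k t.
  apply: free_val_inj; rewrite (linear_map_sum (@free_val_linear k G I)).
  rewrite [LHS]malg_sumE; apply: eq_big_seq => t tx.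
  rewrite (linear_mapZ (@free_val_linear k G I)) val_monomial //.
  by have /allP := free_valP x; apply.
apply: submod_sum => // t tx; apply: submodZ => //; apply: Zm.
by have /allP := free_valP x; apply.
Qed.

(** * Trees and the relabelling of their leaves *)

Section TreeRelabel.
Context (G : Type).

Fixpoint lmap (I X : Type) (f : I -> X) (t : tree G I) : tree G X :=
  match t with
  | Leaf i => Leaf (f i)
  | Node g l r => Node g (lmap f l) (lmap f r)
  end.

Lemma leaves_lmap (I X : Type) (f : I -> X) t : leaves (lmap f t) = map f (leaves t).
Proof. by elim: t => //= g l -> r ->; rewrite map_cat. Qed.

Lemma eq_lmap (I X : Type) (f f' : I -> X) : f =1 f' -> lmap f =1 lmap f'.
Proof. by move=> E; elim=> [i|g l IHl r IHr] /=; rewrite ?E ?IHl ?IHr. Qed.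

Lemma lmap_comp (I X Y : Type) (f : I -> X) (h : X -> Y) t :
  lmap h (lmap f t) = lmap (h \o f) t.
Proof. by elim: t => //= g l -> r ->. Qed.

Lemma leaves_neq0 (I : Type) (t : tree G I) : size (leaves t) != 0.
Proof. by elim: t => //= g l IHl r _; rewrite size_cat addn_eq0 (negPf IHl). Qed.

Lemma lift_tree (I : Type) (p : pred I) (sT : subType p) (t : tree G I) :
  all p (leaves t) -> exists t' : tree G sT, lmap val t' = t.
Proof.
elim: t => [i|g l IHl r IHr] /=.
  by rewrite andbT => pi; exists (Leaf (Sub i pi)); rewrite /= SubK.
rewrite all_cat => /andP[/IHl[l' <-] /IHr[r' <-]].
by exists (Node g l' r').
Qed.

End TreeRelabel.

Lemma mrelabelE (k : fieldType) (G I X : choiceType) (f : I -> X) (t : tree G I) :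
  mrelabel (k := k) f << t >> = << lmap f t >>.
Proof.
transitivity (tsubst (fun i => << Leaf (f i) >> : {malg k[tree G X]}) t).
  exact: bindU.
by elim: t => //= g l -> r ->; exact: graftU.
Qed.

(** The distinct leaves themselves serve as the labelling set. This is how a tree of a free algebra
    becomes an operadic monomial. *)
Lemma lift_leaves (G X : choiceType) (t : tree G X) : uniq (leaves t) ->
  exists t' : tree G (seq_sub (leaves t)), lmap val t' = t /\ mlinear t'.
Proof.
move=> ut; have [|t' E] := @lift_tree G X _ (seq_sub (leaves t)) t.
  by apply/allP.
exists t'; split=> //; move: ut; rewrite -{1}E leaves_lmap => /map_uniq ut.
apply: uniq_perm => //; first exact: enum_uniq.
move=> i; rewrite mem_enum; have : val i \in leaves (lmap val t').
  by rewrite E; apply: ssvalP.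
by rewrite leaves_lmap => /mapP[j jt /val_inj ->].
Qed.

(** * Evaluation of trees in algebras with bilinear operations *)

Section Evaluation.
Context (k : fieldType) (G : choiceType) (V : lmodType k) (op : G -> V -> V -> V).

Definition bilinear_op :=
  (forall g b, linear (op g ^~ b)) /\ (forall g a, linear (op g a)).

Fixpoint teval (X : Type) (f : X -> V) (t : tree G X) : V :=
  match t with
  | Leaf i => f i
  | Node g l r => op g (teval f l) (teval f r)
  end.

Definition aeval (X : choiceType) (f : X -> V) : {malg k[tree G X]} -> V :=
  linext (teval f).

Lemma aeval_linear (X : choiceType) (f : X -> V) : linear (aeval f).
Proof. exact: linext_linear. Qed.

Lemma aevalU (X : choiceType) (f : X -> V) t : aeval f << t >> = teval f t.
Proof. exact: linextU. Qed.

Lemma eq_teval (X : Type) (f f' : X -> V) : f =1 f' -> teval f =1 teval f'.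
Proof. by move=> E; elim=> [i|g l IHl r IHr] /=; rewrite ?E ?IHl ?IHr. Qed.

Lemma eq_aeval (X : choiceType) (f f' : X -> V) : f =1 f' -> aeval f =1 aeval f'.
Proof.
move=> E a; rewrite /aeval !linextE; apply: eq_bigr => t _.
by rewrite (eq_teval E).
Qed.

Lemma eq_in_teval (X : eqType) (f f' : X -> V) t :
  {in leaves t, f =1 f'} -> teval f t = teval f' t.
Proof.
elim: t => [i|g l IHl r IHr] /= h; first by rewrite h ?mem_head.
by rewrite IHl ?IHr // => i it; apply: h; rewrite mem_cat it ?orbT.
Qed.

Hypothesis opB : bilinear_op.

Lemma aeval_graft (X : choiceType) (f : X -> V) g a b :
  aeval f (graft g a b) = op g (aeval f a) (aeval f b).
Proof.
have [opl opr] := opB.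
move: a; apply: linear_malgP => [c x y|c x y|s].
- by rewrite graft_linl aeval_linear.
- by rewrite aeval_linear opl.
move: b; apply: linear_malgP => [c x y|c x y|t].
- by rewrite graft_linr aeval_linear.
- by rewrite aeval_linear opr.
by rewrite (graftU k g s t) (aevalU f (Node g s t)) (aevalU f s) (aevalU f t).
Qed.

Lemma aeval_tsubst (I : Type) (X : choiceType) (nu : I -> {malg k[tree G X]})
    (f : X -> V) t :
  aeval f (tsubst nu t) = teval (fun i => aeval f (nu i)) t.
Proof. by elim: t => //= g l <- r <-; rewrite aeval_graft. Qed.

Lemma aeval_bind (I X : choiceType) (nu : I -> {malg k[tree G X]}) (f : X -> V) a :
  aeval f (bind nu a) = aeval (fun i => aeval f (nu i)) a.
Proof.
move: a; apply: linear_malgP => [c x y|c x y|t].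
- by rewrite bind_lin aeval_linear.
- by rewrite aeval_linear.
by rewrite bindU aevalU aeval_tsubst.
Qed.

Lemma aeval_mrelabel (I X : choiceType) (h : I -> X) (f : X -> V) a :
  aeval f (mrelabel h a) = aeval (f \o h) a.
Proof. by rewrite aeval_bind; apply: eq_aeval => i; rewrite aevalU. Qed.

Lemma teval_slot (X : eqType) (f f1 f2 : X -> V) (c : k) i t :
  f i = c *: f1 i + f2 i -> (forall j, j != i -> f j = f1 j /\ f j = f2 j) ->
  uniq (leaves t) -> i \in leaves t ->
  teval f t = c *: teval f1 t + teval f2 t.
Proof.
have [opl opr] := opB.
move=> fi fj; elim: t => [j|g l IHl r IHr] /=; first by rewrite inE => _ /eqP <-.
rewrite cat_uniq mem_cat => /and3P[ul dlr ur].
have off s : i \notin leaves s -> teval f s = teval f1 s /\ teval f s = teval f2 s.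
  move=> ns; split; apply: eq_in_teval => j js;
  by case: (fj j) => //; apply: contraNneq ns => <-.
case il: (i \in leaves l) => /= ir.
  have [|<- <-] := off r; first by apply: (hasPn _ _ il) => //; rewrite has_sym.
  by rewrite IHl // opl.
have [|<- <-] := off l; first by rewrite il.
by rewrite IHr // opr.
Qed.

(** These elements are the kernel of the action of the free operad on [V]. For inner composition,
    multilinearity matters: the vanishing branch occurs in every tree of [mu], and a bilinear
    operation with a zero argument is zero. *)
Lemma eval_ideal (P := free_operad k G) :
  @op_ideal k P (fun I x => forall f : I -> V, aeval f (free_val x) = 0).
Proof.
split=> [I|I J h x bh Zx f|J K mu nu Zmu f|J K mu nu j Znu f].
- split=> [f|a x y Zx Zy f]; first exact: linear_map0 (@aeval_linear _ f).
  by rewrite free_val_linear aeval_linear Zx Zy scaler0 addr0.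
- by rewrite val_relabel // aeval_mrelabel.
- by rewrite aeval_bind.
- rewrite /= aeval_bind; have : uniq (enum J) by exact: enum_uniq.
  have := free_valP mu; move: (free_val mu) => a /allP ma _.
  rewrite /aeval linextE big_seq big1 // => t /ma mt.
  have jt : j \in leaves t by rewrite (perm_mem mt) mem_enum.
  suff -> : teval (fun j0 => linext (teval f)
      (mrelabel (existT (fun x : J => K x) j0) (nu j0))) t = 0 by rewrite scaler0.
  elim: t jt {mt} => [i|g l IHl r IHr] /=.
    by rewrite inE => /eqP <-; rewrite -/(aeval f _) aeval_mrelabel Znu.
  have [opl opr] := opB.
  rewrite mem_cat => /orP[/IHl ->|/IHr ->].
    exact: (linear_map0 (opl g _)).
  exact: (linear_map0 (opr g _)).
Qed.

End Evaluation.

(** A multilinear expression is linear in each argument separately, by [teval_slot], so basis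
    elements suffice to test it. *)
Lemma aeval_basis (k : fieldType) (G T : choiceType) (I : finType)
    (op : G -> {malg k[T]} -> {malg k[T]} -> {malg k[T]}) (x : free_operad k G I) :
  bilinear_op op -> (forall f : I -> T, aeval op (fun i => << f i >>) (free_val x) = 0) ->
  forall f : I -> {malg k[T]}, aeval op f (free_val x) = 0.
Proof.
move=> opB H f.
(* The list [s] holds the arguments that may still be arbitrary; each induction step expands one of
   them in the basis. *)
suff: forall (s : seq I) f, (forall i, i \notin s -> exists t, f i = << t >>) ->
    aeval op f (free_val x) = 0.
  by move/(_ (enum I) f); apply=> i; rewrite mem_enum.
elim=> [|i s IHs] {}f fU.
  have /(_ _)/cid-/all_tag[h E] := fun i => fU i isT.
  by rewrite (eq_aeval op E).
pose f' v j := if j == i then v else f j.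
have -> : f = f' (f i).
  by apply: functional_extensionality_dep => j; rewrite /f'; case: eqP => // ->.
move: (f i); apply: malg_ind => [|t].
  apply: submod_eq0 => c u v; rewrite /aeval !linextE scaler_sumr -big_split.
  apply: eq_big_seq => t tx /=; have /allP/(_ t tx) mt := free_valP x.
  rewrite scalerA [c * _]mulrC -scalerA -scalerDr; congr (_ *: _).
  apply: (teval_slot opB (i := i)).
  - by rewrite /f' eqxx.
  - by move=> j /negPf ij; rewrite /f' ij.
  - by rewrite (perm_uniq mt) enum_uniq.
  - by rewrite (perm_mem mt) mem_enum.
apply: IHs => j js; rewrite /f'; case: eqP => [_|ij]; first by exists t.
by apply: fU; rewrite inE negb_or js andbT; apply/eqP.
Qed.

Lemma teval_morph (k : fieldType) (G : choiceType) (V W : lmodType k)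
    (op : G -> V -> V -> V) (op' : G -> W -> W -> W) (h : V -> W)
    (X : Type) (f : X -> V) t :
  (forall g a b, h (op g a b) = op' g (h a) (h b)) ->
  h (teval op f t) = teval op' (h \o f) t.
Proof. by move=> H; elim: t => //= g l <- r <-. Qed.

Lemma aeval_morph (k : fieldType) (G : choiceType) (V W : lmodType k)
    (op : G -> V -> V -> V) (op' : G -> W -> W -> W) (h : V -> W)
    (X : choiceType) (f : X -> V) a :
  linear h -> (forall g a b, h (op g a b) = op' g (h a) (h b)) ->
  h (aeval op f a) = aeval op' (h \o f) a.
Proof.
move=> lh H; move: a; apply: linear_malgP => [c x y|c x y|t].
- by rewrite aeval_linear lh.
- by rewrite aeval_linear.
by rewrite !aevalU (teval_morph f t H).
Qed.

Lemma aeval_graftE (k : fieldType) (G X Y : choiceType)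
    (f : X -> {malg k[tree G Y]}) a :
  aeval (@graft k G Y) f a = bind f a.
Proof. by rewrite /aeval /bind !linextE; apply: eq_bigr => t _; congr (_ *: _); elim: t => //= g l -> r ->. Qed.

(** * The T-ideal and the operadic ideal *)

Section TIdeal.
Context (k : fieldType) (G : choiceType) (n : nat).
Context (R : free_operad k G 'I_n -> Prop).

Local Notation A X := {malg k[tree G X]}.
Local Notation F := (free_operad k G).

Section Space.
Context (X : choiceType).

(** Relations are instantiated at trees, in which letters may repeat, and multiplied by trees on
    either side; the quotient by their span plays the role of the free algebra on [X]. *)
Inductive tgen : A X -> Prop :=
| tgen_rel r (f : 'I_n -> tree G X) :
    R r -> tgen (bind (fun i => << f i >>) (free_val r))
| tgen_l g a t : tgen a -> tgen (graft g a << t >>)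
| tgen_r g t a : tgen a -> tgen (graft g << t >> a).

Definition tquot : lmodType k := quot tgen.

(* Locked, since unification otherwise unfolds quotients. *)
Fact tpi_key : unit. Proof. by []. Qed.
Definition tpi (a : A X) : tquot := locked_with tpi_key (quot_pi tgen a).

Lemma tpiE a : tpi a = quot_pi tgen a.
Proof. by rewrite /tpi unlock. Qed.

Lemma tpi_linear : linear tpi.
Proof. by move=> c a b; rewrite !tpiE quot_pi_linear. Qed.

Lemma tpi_eq a b : tpi a = tpi b <-> span tgen (a - b).
Proof. by rewrite !tpiE quot_pi_eq. Qed.

Lemma tpi_eq0 a : span tgen a -> tpi a = 0.
Proof. by move=> sa; rewrite -(linear_map0 tpi_linear); apply/tpi_eq; rewrite subr0. Qed.

Lemma span_graftl g a b : span tgen a -> span tgen (graft g a b).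
Proof.
move: a; apply: span_sub.
  by apply: submod_preim (span_submod _); apply: graft_linl.
move=> a ga; move: b; apply: malg_ind => [|t].
  by apply: submod_preim (span_submod _); apply: graft_linr.
by apply: sub_span; constructor.
Qed.

Lemma span_graftr g a b : span tgen b -> span tgen (graft g a b).
Proof.
move: b; apply: span_sub.
  by apply: submod_preim (span_submod _); apply: graft_linr.
move=> b gb; move: a; apply: malg_ind => [|t].
  by apply: submod_preim (span_submod _); apply: graft_linl.
by apply: sub_span; constructor.
Qed.

Definition tmul (g : G) (p q : tquot) : tquot :=
  locked_with tpi_key (tpi (graft g (repr p) (repr q))).

Lemma tpi_graft g a b : tpi (graft g a b) = tmul g (tpi a) (tpi b).
Proof.
rewrite [RHS]unlock; apply/tpi_eq; rewrite !tpiE -(subrK (graft g (repr (quot_pi tgen a)) b) (graft g a b)) -addrA.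
have sN x : span tgen x -> span tgen (- x).
  by rewrite -scaleN1r; apply: submodZ (span_submod _) _ _.
apply: (submodD (span_submod _)).
  rewrite -(@lin_sub _ _ _ (graft g ^~ b)); last exact: graft_linl.
  by apply: span_graftl; rewrite -opprB; apply: sN; apply: repr_quot_pi.
rewrite -(@lin_sub _ _ _ (graft g _)); last exact: graft_linr.
by apply: span_graftr; rewrite -opprB; apply: sN; apply: repr_quot_pi.
Qed.

Lemma tpi_ex q : exists a, q = tpi a.
Proof. by exists (repr q); rewrite tpiE quot_piK. Qed.

Lemma tmul_bilinear : bilinear_op tmul.
Proof.
split=> g p c x y; have [p' ->] := tpi_ex p; have [x' ->] := tpi_ex x;
  have [y' ->] := tpi_ex y.
  rewrite -[X in tmul g X _](tpi_linear c x' y') -(tpi_graft g _ p') graft_linl.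
  by rewrite tpi_linear (tpi_graft g x') (tpi_graft g y').
rewrite -[X in tmul g _ X](tpi_linear c x' y') -(tpi_graft g p') graft_linr.
by rewrite tpi_linear (tpi_graft g p' x') (tpi_graft g p' y').
Qed.

Definition tcls (t : tree G X) : tquot := locked_with tpi_key (tpi << t >>).

Lemma tclsE t : tcls t = tpi << t >>.
Proof. by rewrite [LHS]unlock. Qed.

Lemma tcls_node g s t : tcls (Node g s t) = tmul g (tcls s) (tcls t).
Proof. by rewrite !tclsE -tpi_graft graftU. Qed.

Lemma tpi_bind (I : choiceType) (f : I -> A X) a :
  tpi (bind f a) = aeval tmul (tpi \o f) a.
Proof.
rewrite -aeval_graftE; apply: aeval_morph; first exact: tpi_linear.
exact: tpi_graft.
Qed.

Lemma tpi_rel r (f : 'I_n -> tree G X) : R r ->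
  aeval tmul (fun i => tcls (f i)) (free_val r) = 0.
Proof.
move=> Rr; rewrite (eq_aeval _ (fun i => tclsE (f i))).
rewrite -[LHS](tpi_bind (fun i => << f i >>)); apply: tpi_eq0.
by apply: sub_span; constructor.
Qed.

End Space.

(** A copy of an element of the operadic ideal, its inputs being named injectively by the letters of
    [s]. *)
Definition ideal_on (X : choiceType) (s : seq X) (a : A X) : Prop :=
  exists (K : finType) (h : K -> X) (y : F K),
    [/\ injective h, forall i, i \in s <-> exists j, h j = i,
        ideal_gen R y & a = mrelabel h (free_val y)].

Lemma mlinear_corolla g :
  @mlinear G bool (Node g (Leaf true) (Leaf false)).
Proof. by apply: uniq_perm => [||[]]; rewrite ?enum_uniq ?mem_enum. Qed.

Lemma ocomp_corolla_val g (K : bool -> finType) (nu : forall b, F (K b)) :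
  free_val (ocomp (monomial k (Node g (Leaf true) (Leaf false)) : F bool) nu) =
  graft g (mrelabel (existT (fun b => K b : Type) true) (free_val (nu true)))
          (mrelabel (existT (fun b => K b : Type) false) (free_val (nu false))).
Proof.
rewrite [LHS]/= val_monomial ?mlinear_corolla //.
by rewrite bindU.
Qed.

(** As the two factors have disjoint letters, their product is an operadic composite of a two-leaf
    tree with them, and the ideal absorbs composition in either input. *)
Lemma ideal_on_ocomp (X : choiceType) g (K : bool -> finType) (h : forall b, K b -> X)
    (y : forall b, F (K b)) b0 s :
  (forall b, injective (h b)) ->
  (forall i j, h true i <> h false j) ->
  (forall i, i \in s <-> exists b j, h b j = i) ->
  ideal_gen R (y b0) ->
  ideal_on s (graft g (mrelabel (h true) (free_val (y true)))
                      (mrelabel (h false) (free_val (y false)))).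
Proof.
move=> hI hd hs Iy.
exists {b : bool & K b}, (fun u => h (tag u) (tagged u)),
  (ocomp (monomial k (Node g (Leaf true) (Leaf false)) : F bool) y); split.
- move=> [[] i] [[] j] //= E; first by rewrite (hI _ _ _ E).
  + by case: (hd _ _ E).
  + by case: (hd _ _ (esym E)).
  + by rewrite (hI _ _ _ E).
- move=> i; rewrite hs; split=> [[b [j <-]]|[[b j] <-]]; last by exists b, j.
  by exists (existT (fun b => K b : Type) b j).
- by have [_ _ _ cr] := ideal_gen_ideal R; apply: (cr _ _ _ _ b0).
- by rewrite ocomp_corolla_val /mrelabel bind_graft -!/(mrelabel _ _) !mrelabel_comp.
Qed.

(** A relation is multilinear, so all trees in an instance of it carry the same letters with the
    same multiplicities, and multiplying by a tree adds fixed letters. When no letter repeats, the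
    instance is a genuine operadic composite of the relation. *)
Lemma tgen_homogeneous (X : choiceType) (a : A X) : tgen a ->
  exists s, supported (fun t => perm_eq (leaves t) s) a /\
            (uniq s -> ideal_on s a).
Proof.
elim=> [r f Rr|g {}a t _ [s [sa Ja]]|g t {}a _ [s [sa Ja]]].
- exists (flatten [seq leaves (f i) | i <- enum 'I_n]); split=> [|us].
    apply: (supported_linext (free_valP r)) => t mt.
    apply: (@sub_supported k G X _ _ _ _ (supported_tsubst (s := fun i => leaves (f i)) _ t)) => [u|i].
      by move=> /perm_trans; apply; apply: perm_flatten; apply: perm_map.
    exact: supportedU.
  have uf i : uniq (leaves (f i)).
    elim: (enum 'I_n) (mem_enum 'I_n i) us => //= j e IHe.
    rewrite inE cat_uniq => /orP[/eqP <- /and3P[]//|ie /and3P[_ _]]; exact: IHe.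
  pose t' i := projT1 (cid (lift_leaves (uf i))).
  have Ht' i : lmap val (t' i) = f i /\ mlinear (t' i) := projT2 (cid (lift_leaves (uf i))).
  pose K i : finType := seq_sub (leaves (f i)).
  exists {i : 'I_n & K i}, (fun u : {i : 'I_n & K i} => val (tagged u)),
    (ocomp r (fun i => monomial k (t' i))); split.
  + move=> [i x] [j y] /= E.
    (* A letter determines the substituted tree that contains it, since the concatenation of all the
       leaves has no repetition. *)
    have ij : i = j.
      have := ssvalP x; have := ssvalP y; rewrite -E.
      have : uniq (enum 'I_n) by exact: enum_uniq.
      elim: (enum 'I_n) (mem_enum 'I_n i) (mem_enum 'I_n j) us => //= l e IHe.
      rewrite !inE cat_uniq => ie je /and3P[ul nl ue] /andP[le ue'] yj xi.
      have off m : m \in e -> ssval x \in leaves (f m) -> ssval x \in leaves (f l) -> False.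
        move=> me xm xl; move/negP: nl; apply; apply/hasP; exists (ssval x) => //.
        by apply/flatten_mapP; exists m.
      case/orP: ie => [/eqP il|ie]; case/orP: je => [/eqP jl|je].
      * by rewrite il jl.
      * by case: (off j je yj); rewrite -il.
      * by case: (off i ie xi); rewrite -jl.
      * exact: IHe.
    by case: j / ij y E => y E; rewrite (val_inj E).
  + move=> i; split=> [/flatten_mapP[j _ ij]|[[j x] <-]].
      by exists (existT (fun i => K i : Type) j (SeqSub ij)).
    by apply/flatten_mapP; exists j; rewrite ?mem_enum ?ssvalP.
  + by have [_ _ cl _] := ideal_gen_ideal R; apply: cl; apply: ideal_gen_sub.
  + rewrite /= mrelabel_bind; apply: eq_bind => i.
    have [E mt] := Ht' i; rewrite -[in LHS]E.
    by rewrite val_monomial // mrelabel_comp mrelabelE.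
- exists (s ++ leaves t); split=> [|].
    apply: (supported_linext sa) => u us; rewrite linextU; apply: supportedU.
    by rewrite /= perm_cat2r.
  rewrite cat_uniq => /and3P[us /hasPn nst ut].
  have [K [h [y [hI hs Iy ->]]]] := Ja us.
  have [t' [E mt']] := lift_leaves ut.
  pose K' b : finType := if b then K else seq_sub (leaves t).
  pose h' b : K' b -> X := if b is true then h else val.
  pose y' b : F (K' b) := if b is true then y else monomial k t'.
  have := @ideal_on_ocomp X g K' h' y' true (s ++ leaves t).
  rewrite {1}/h' {1}/h' {1}/h' /y' /=.
  rewrite /= val_monomial // mrelabelE E; apply=> //.
  + by case=> //; exact: val_inj.
  + move=> i j E'; by move/negP: (nst (val j) (ssvalP j)); apply; apply/hs; exists i.
  + move=> i; rewrite mem_cat; split=> [/orP[/hs[j <-]|it]|[[] [j <-]]].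
    * by exists true, j.
    * by exists false, (SeqSub it).
    * by apply/orP; left; apply/hs; exists j.
    * by apply/orP; right; apply: ssvalP.
- exists (leaves t ++ s); split=> [|].
    rewrite /graft linextU.
    apply: (supported_linext sa) => u us; apply: supportedU.
    by rewrite /= perm_cat2l.
  rewrite cat_uniq => /and3P[ut /hasPn nst us].
  have [K [h [y [hI hs Iy ->]]]] := Ja us.
  have [t' [E mt']] := lift_leaves ut.
  pose K' b : finType := if b then (seq_sub (leaves t) : finType) else K.
  pose h' b : K' b -> X := if b is true then val else h.
  pose y' b : F (K' b) := if b is true then monomial k t' else y.
  have := @ideal_on_ocomp X g K' h' y' false (leaves t ++ s).
  rewrite {1}/h' {1}/h' {1}/h' /y' /=.
  rewrite /= val_monomial // mrelabelE E; apply=> //.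
  + by case=> //; exact: val_inj.
  + move=> i j E'; have : h j \in s by apply/hs; exists j.
    by move/nst; rewrite -E' => /negP; apply; apply: ssvalP.
  + move=> i; rewrite mem_cat; split=> [/orP[it|/hs[j <-]]|[[] [j <-]]].
    * by exists true, (SeqSub it).
    * by exists false, j.
    * by apply/orP; left; apply: ssvalP.
    * by apply/orP; right; apply/hs; exists j.
Qed.

(* Elements of the T-ideal decompose into multihomogeneous ones, so that its *)
(* multilinear part is the operadic ideal. *)
Theorem tideal_ideal (I : finType) (x : F I) :
  span (@tgen I) (free_val x) -> ideal_gen R x.
Proof.
(* The projection onto multilinear trees. By homogeneity it fixes or kills each generator of the
   T-ideal, so it maps the T-ideal into the operadic ideal, and it fixes [free_val x]. *)
pose proj : A I -> A I := linext (fun t => if mlinear t then << t >> else 0).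
have lp : linear proj by exact: linext_linear.
have projE (y : F I) : proj (free_val y) = free_val y.
  rewrite [RHS]malg_sumE /proj linextE.
  by apply: eq_big_seq => t ty; have /allP/(_ _ ty) -> := free_valP y.
have sI : submod_pred (@ideal_gen k F n R I) by have [sI _ _ _] := ideal_gen_ideal R.
suff H a : span (@tgen I) a -> exists y : F I, free_val y = proj a /\ ideal_gen R y.
  case/H=> y [yx Iy]; suff -> : x = y by [].
  by apply: free_val_inj; rewrite yx projE.
move: a; apply: span_sub.
  split=> [|c a b [y [ya Iy]] [z [zb Iz]]].
    by exists 0; rewrite (linear_map0 lp); split=> //; apply: ideal_gen0.
  exists (c *: y + z); rewrite free_val_linear lp ya zb; split=> //.
  exact: sI.2.
move=> a /tgen_homogeneous[s [/allP sa Ja]].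
have [sI'|nsI] := boolP (perm_eq s (enum I)); last first.
  exists 0; split; last exact: ideal_gen0.
  rewrite /proj linextE big_seq big1 // => t /sa ts.
  case: ifP => [mt|_]; last by rewrite scaler0.
  by case/negP: nsI; rewrite -(permPl ts).
have us : uniq s by rewrite (perm_uniq sI') enum_uniq.
have [K [h [y [hI hs Iy ->]]]] := Ja us.
have bh : bijective h.
  have ex i : exists j, h j == i.
    have /hs[j <-] : i \in s by rewrite (perm_mem sI') mem_enum.
    by exists j.
  exists (fun i => xchoose (ex i)) => i; last exact: (eqP (xchooseP (ex i))).
  by apply: hI; exact: (eqP (xchooseP (ex (h i)))).
exists (relabel h y); split; last first.
  by have [_ rI _ _] := ideal_gen_ideal R; apply: rI.
by rewrite -[mrelabel h y](val_relabel y bh) projE.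
Qed.

End TIdeal.

Lemma mlinear_lmap (G : choiceType) (I J : finType) (f : I -> J) (t : tree G I) :
  bijective f -> mlinear t -> mlinear (lmap f t).
Proof.
move=> bf mt; rewrite /mlinear leaves_lmap.
apply: (perm_trans (perm_map f mt)); apply: uniq_perm => [||j].
- by rewrite map_inj_uniq ?enum_uniq //; apply: bij_inj.
- exact: enum_uniq.
by case: bf => g fK gK; rewrite mem_enum -[j]gK map_f // mem_enum.
Qed.

Lemma relabel_monomial (k : fieldType) (G : choiceType) (I J : finType)
    (f : I -> J) (t : tree G I) : bijective f -> mlinear t ->
  relabel f (monomial k t : free_operad k G I) = monomial k (lmap f t).
Proof.
move=> bf mt; apply: free_val_inj.
by rewrite val_relabel // !val_monomial ?mlinear_lmap // mrelabelE.
Qed.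

Lemma perm_bij (T : finType) (s : {perm T}) : bijective s.
Proof. exact: (Bijective (permK s) (permKV s)). Qed.

(** The default [a] of [nth] is never reached, since [i] is below 3. *)
Definition tri (X : Type) (a b c : X) (i : 'I_3) : X := nth a [:: a; b; c] i.

Lemma triE (X : Type) (f : 'I_3 -> X) : tri (f 0) (f 1) (f 2) =1 f.
Proof.
by move=> [[|[|[|i]]] // lti]; rewrite /tri /=; congr f; apply: val_inj.
Qed.

(** * Rewrite laws *)

Section Quadratic.
Context (G : Type).

Definition quadratic (p q : pred G) (X : Type) (t : tree G X) : bool :=
  match t with
  | Node g (Node h (Leaf _) (Leaf _)) (Leaf _)
  | Node g (Leaf _) (Node h (Leaf _) (Leaf _)) => p g && q h
  | _ => false
  end.

Lemma quadraticP (p q : pred G) (X : Type) (t : tree G X) : quadratic p q t ->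
  exists g h a b c, p g /\ q h /\
    (t = Node g (Node h (Leaf a) (Leaf b)) (Leaf c) \/
     t = Node g (Leaf a) (Node h (Leaf b) (Leaf c))).
Proof.
case: t => [//|g [a|h [a|//] [b|//]] [c|h' l r]] //=.
  by case: l => // b; case: r => // c /andP[pg qh]; exists g, h', a, b, c; do 2!split=> //; right.
by case/andP=> pg qh; exists g, h, a, b, c; do 2!split=> //; left.
Qed.

End Quadratic.

Definition is_inl (A B : Type) (x : A + B) := if x is inl _ then true else false.
Definition is_inr (A B : Type) (x : A + B) := if x is inr _ then true else false.

Section QuadSpan.
Context (k : fieldType) (G1 G2 : choiceType).
Local Notation F := (free_operad k (G1 + G2)%type).

Lemma mlinear_base (G : choiceType) (g h : G) :
  @mlinear G 'I_3 (Node g (Node h (Leaf 0) (Leaf 1)) (Leaf 2)) /\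
  @mlinear G 'I_3 (Node g (Leaf 0) (Node h (Leaf 1) (Leaf 2))).
Proof.
by split; apply: uniq_perm; rewrite ?enum_uniq // => -[[|[|[|i]]] // lti];
  rewrite mem_enum.
Qed.

Lemma span_quadratic (A B : Type) (a : A -> G1 + G2) (b : B -> G1 + G2)
    (p q : pred (G1 + G2)) (u : F 'I_3) :
  (forall x, p (a x)) -> (forall x, q (b x)) ->
  span (@quad_gen k G1 G2 A B a b) u -> supported (quadratic p q (X := _)) (free_val u).
Proof.
move=> pa qb; move: u; apply: span_sub.
  have [s0 sD] := supported_closed k (quadratic p q (X := 'I_3)).
  by split=> [|c x y]; [exact: s0|exact: sD].
move=> w [s [g [h E]]].
have [m1 m2] := mlinear_base (a g) (b h); have bs := perm_bij s.
by case: E => ->; rewrite val_monomial;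
  [apply: supportedU; rewrite /= pa qb|exact: (mlinear_lmap bs m1)
  |apply: supportedU; rewrite /= pa qb|exact: (mlinear_lmap bs m2)].
Qed.

Lemma mlinear_tri (a b c : 'I_3) : perm_eq [:: a; b; c] (enum 'I_3) ->
  exists s : 'S_3, [/\ s 0 = a, s 1 = b & s 2 = c].
Proof.
move=> /perm_uniq; rewrite enum_uniq => uabc.
have inj : injective (tri a b c).
  move=> i j /eqP; rewrite /tri.
  by rewrite (nth_uniq a _ _ uabc) ?ltn_ord // => /eqP/val_inj.
by exists (perm inj); rewrite !permE.
Qed.

(** With [span_quadratic], this replaces membership in a Sigma_3-submodule by a decidable condition
    on the trees that occur. The permutation in [quad_gen] is read off the leaves. *)
Lemma quadratic_span (A B : Type) (a : A -> G1 + G2) (b : B -> G1 + G2)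
    (p q : pred (G1 + G2)) (u : F 'I_3) :
  (forall g, p g -> exists x, a x = g) -> (forall g, q g -> exists x, b x = g) ->
  supported (quadratic p q (X := _)) (free_val u) ->
  span (@quad_gen k G1 G2 A B a b) u.
Proof.
move=> pa qb /allP su.
have -> : u = \sum_(t <- msupp (free_val u)) (free_val u)@_t *: monomial k t.
  apply: free_val_inj; rewrite (linear_map_sum (@free_val_linear k _ 'I_3)).
  rewrite [LHS]malg_sumE; apply: eq_big_seq => t tx.
  rewrite (linear_mapZ (@free_val_linear k _ 'I_3)) val_monomial //.
  by have /allP := free_valP u; apply.
apply: (submod_sum (span_submod _)) => t tu; apply: (submodZ (span_submod _)).
have /allP/(_ t tu) := free_valP u.
have [g [h [x [y [z [/pa[g' <-] [/qb[h' <-]]]]]]]] := quadraticP (su t tu).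
by case=> -> /mlinear_tri[s [<- <- <-]]; apply: sub_span; exists s, g', h'; [left|right].
Qed.

End QuadSpan.

Section Rewriting.
Context (k : fieldType) (G1 G2 : choiceType).
Local Notation F := (free_operad k (G1 + G2)%type).
Local Notation base1 g h :=
  (monomial k (Node (inl g) (Node (inr h) (Leaf 0) (Leaf 1)) (Leaf 2)) : F 'I_3).
Local Notation base2 g h :=
  (monomial k (Node (inl g) (Leaf 0) (Node (inr h) (Leaf 1) (Leaf 2))) : F 'I_3).

Lemma span_valP (V : lmodType k) (W : V -> Prop) (w : span_type W) : span W (span_val w).
Proof. by have /span_memP := valP w. Qed.

Lemma span_val_ex (V : lmodType k) (W : V -> Prop) x : span W x ->
  exists w : span_type W, span_val w = x.
Proof. by move=> /span_memP Wx; exists (SpanType Wx). Qed.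

Lemma span_val_linear (V : lmodType k) (W : V -> Prop) : linear (@span_val k V W).
Proof. by []. Qed.

Lemma span_val_inj (V : lmodType k) (W : V -> Prop) : injective (@span_val k V W).
Proof. exact: val_inj. Qed.

Lemma F12P (u : F 'I_3) : span (quad_gen inl inr) u <->
  supported (quadratic (@is_inl _ _) (@is_inr _ _) (X := _)) (free_val u).
Proof.
split; first exact: span_quadratic.
by apply: quadratic_span => -[] // x _; exists x.
Qed.

Lemma F21P (u : F 'I_3) : span (quad_gen inr inl) u <->
  supported (quadratic (@is_inr _ _) (@is_inl _ _) (X := _)) (free_val u).
Proof.
split; first exact: span_quadratic.
by apply: quadratic_span => -[] // x _; exists x.
Qed.

Lemma supported_quadratic_relabel (p q : pred (G1 + G2)) (s : 'S_3) (u : F 'I_3) :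
  supported (quadratic p q (X := _)) (free_val u) ->
  supported (quadratic p q (X := _)) (free_val (relabel s u)).
Proof.
move=> su; rewrite (val_relabel u (perm_bij s)); apply: (supported_linext su) => t.
case/quadraticP=> g [h [x [y [z [pg [qh E]]]]]].
by rewrite -(bindU _ t) -/(mrelabel _ _) mrelabelE; apply: supportedU;
  case: E => ->; rewrite /= pg qh.
Qed.

Context (D : rewrite_law k G1 G2).

Lemma rewritesZD c u v u' v' :
  rewrites D u v -> rewrites D u' v' -> rewrites D (c *: u + u') (c *: v + v').
Proof.
case=> w <- <- [w' <- <-]; exists (c *: w + w'); first exact: span_val_linear.
by rewrite linearP; apply: span_val_linear.
Qed.

Lemma rewrites0 : rewrites D 0 0.
Proof.
have v0 W : @span_val k (F 'I_3) W 0 = 0 by exact: linear_map0 (@span_val_linear _ W).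
by exists 0; rewrite ?linear0 v0.
Qed.

Lemma rewrites_relabel (s : 'S_3) u v :
  rewrites D u v -> rewrites D (relabel s u) (relabel s v).
Proof.
case=> w <- <-; have [w' E] : exists w' : F12 k G1 G2, span_val w' = relabel s (span_val w).
  apply: span_val_ex; apply/F12P/supported_quadratic_relabel/F12P.
  exact: span_valP.
by exists w' => //; apply: law_equivariant.
Qed.

Lemma rewrites_inj u v v' : rewrites D u v -> rewrites D u v' -> v = v'.
Proof. by case=> w <- <- [w' /span_val_inj -> <-]. Qed.

Lemma rewrites_ex u :
  supported (quadratic (@is_inl _ _) (@is_inr _ _) (X := _)) (free_val u) ->
  exists v, rewrites D u v.
Proof. by move=> /F12P/span_val_ex[w <-]; exists (span_val (D w)), w. Qed.

(** The trees with leaves in increasing order generate [F12] as a Sigma_3-module, so linearity and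
    equivariance reduce a statement about the law to its rules. *)
Lemma rewrites_ind (Q : F 'I_3 -> F 'I_3 -> Prop) :
  Q 0 0 ->
  (forall c u v u' v', Q u v -> Q u' v' -> Q (c *: u + u') (c *: v + v')) ->
  (forall (s : 'S_3) u v, Q u v -> Q (relabel s u) (relabel s v)) ->
  (forall g h v, rewrites D (base1 g h) v -> Q (base1 g h) v) ->
  (forall g h v, rewrites D (base2 g h) v -> Q (base2 g h) v) ->
  forall u v, rewrites D u v -> Q u v.
Proof.
move=> Q0 QD Qs Q1 Q2 u v; case=> w <- <-.
have: span (quad_gen inl inr) (span_val w) := span_valP w.
suff H u' : span (quad_gen inl inr) u' -> exists2 v', rewrites D u' v' & Q u' v'.
  by case/H=> v' [w' /span_val_inj -> <-].
move: u'; apply: span_sub => [|w0 [s [g [h E]]]].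
  split=> [|c x y [x' Dx Qx] [y' Dy Qy]]; first by exists 0 => //; apply: rewrites0.
  by exists (c *: x' + y'); [apply: rewritesZD|apply: QD].
have [m1 m2] := @mlinear_base (G1 + G2)%type (inl g) (inr h); have bs := perm_bij s.
have [|v1 D1] := @rewrites_ex (base1 g h).
  by rewrite val_monomial //; apply: supportedU.
have [|v2 D2] := @rewrites_ex (base2 g h).
  by rewrite val_monomial //; apply: supportedU.
case: E => ->.
  have := relabel_monomial k bs m1 => /= <-.
  by exists (relabel s v1); [apply: rewrites_relabel|apply: Qs; apply: Q1].
have := relabel_monomial k bs m2 => /= <-.
by exists (relabel s v2); [apply: rewrites_relabel|apply: Qs; apply: Q2].
Qed.

End Rewriting.

Section LawExistence.
Context (k : fieldType) (G1 G2 : choiceType).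
Local Notation F := (free_operad k (G1 + G2)%type).
Context (u0 v0 : G1 -> G2 -> F 'I_3).
Hypothesis u0P : forall g h,
  supported (quadratic (@is_inr _ _) (@is_inl _ _) (X := _)) (free_val (u0 g h)).
Hypothesis v0P : forall g h,
  supported (quadratic (@is_inr _ _) (@is_inl _ _) (X := _)) (free_val (v0 g h)).

(** The values on the ordered trees can be prescribed freely, because [F12] is a free Sigma_3-module
    on them. Allowing arbitrary letters makes the rule natural in the letters ([rule_tree_lmap]),
    which is where equivariance comes from. Trees outside [F12] get the junk value 0. *)
Definition rule_tree (X : choiceType) (t : tree (G1 + G2) X) : {malg k[tree (G1 + G2) X]} :=
  match t with
  | Node (inl g) (Node (inr h) (Leaf a) (Leaf b)) (Leaf c) =>
      mrelabel (tri a b c) (free_val (u0 g h))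
  | Node (inl g) (Leaf a) (Node (inr h) (Leaf b) (Leaf c)) =>
      mrelabel (tri a b c) (free_val (v0 g h))
  | _ => 0
  end.

Definition rule_lin (X : choiceType) := linext (@rule_tree X).

Lemma rule_tree_lmap (X Y : choiceType) (f : X -> Y) t :
  rule_tree (lmap f t) = mrelabel f (rule_tree t).
Proof.
have m0 : mrelabel f 0 = 0 :> {malg k[tree (G1 + G2) Y]}.
  exact: (linear_map0 (@mrelabel_lin _ _ _ _ f)).
have E a b c u : mrelabel (tri (f a) (f b) (f c)) u = mrelabel f (mrelabel (tri a b c) u) :> {malg k[tree (G1 + G2) Y]}.
  rewrite mrelabel_comp; apply: eq_bind => i.
  by rewrite -(triE (f \o tri a b c) i).
case: t => [//|[g|//] [a|[?|h] [a|? ? ?] [b|? ? ?]] [c|[?|h'] [c|? ? ?] [d|? ? ?]]] //=.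
Qed.

Lemma rule_lin_relabel (X Y : choiceType) (f : X -> Y) a :
  rule_lin (mrelabel f a) = mrelabel f (rule_lin a).
Proof.
have lr Z : linear (@rule_lin Z) by exact: linext_linear.
move: a; apply: linear_malgP => [c x y|c x y|t].
- by rewrite mrelabel_lin lr.
- by rewrite lr mrelabel_lin.
by rewrite mrelabelE /rule_lin !linextU rule_tree_lmap.
Qed.

Lemma rule_lin_ex (w : F12 k G1 G2) : exists w' : F21 k G1 G2,
  free_val (span_val w') = rule_lin (free_val (span_val w)).
Proof.
have lr Z : linear (@rule_lin Z) by exact: linext_linear.
suff [y Fy <-] : exists2 y : F 'I_3, span (quad_gen inr inl) y &
    free_val y = rule_lin (free_val (span_val w)).
  by have [w' <-] := span_val_ex Fy; exists w'.
have [s0 sD] := @span_submod k (F 'I_3) (quad_gen inr inl).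
move: (span_val w) (span_valP w); apply: span_sub => [|u [s [g [h E]]]].
  split=> [|c x y [x' Fx Ex] [y' Fy Ey]].
    by exists 0 => //; rewrite (linear_map0 (lr _)).
  by exists (c *: x' + y'); [exact: sD|rewrite !free_val_linear lr Ex Ey].
have [m1 m2] := @mlinear_base (G1 + G2)%type (inl g) (inr h); have bs := perm_bij s.
have F21r u' : span (quad_gen inr inl) u' ->
    span (@quad_gen k G1 G2 _ _ inr inl) (relabel s u').
  by move=> /F21P su; apply/F21P; apply: supported_quadratic_relabel.
case: E => ->.
  exists (relabel s (u0 g h)); first by apply: F21r; apply/F21P.
  rewrite (val_relabel _ bs) (val_monomial k (mlinear_lmap bs m1)) /rule_lin linextU /=.
  by apply: eq_bind => i; rewrite -(triE s i).
exists (relabel s (v0 g h)); first by apply: F21r; apply/F21P.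
rewrite (val_relabel _ bs) (val_monomial k (mlinear_lmap bs m2)) /rule_lin linextU /=.
by apply: eq_bind => i; rewrite -(triE s i).
Qed.

Definition rule_map (w : F12 k G1 G2) : F21 k G1 G2 := projT1 (cid (rule_lin_ex w)).

Lemma rule_mapE w : free_val (span_val (rule_map w)) = rule_lin (free_val (span_val w)).
Proof. exact: projT2 (cid (rule_lin_ex w)). Qed.

Fact rule_map_linear : linear rule_map.
Proof.
move=> c x y; apply: span_val_inj; apply: free_val_inj.
rewrite rule_mapE !span_val_linear !free_val_linear !rule_mapE.
exact: linext_linear.
Qed.

HB.instance Definition _ :=
  GRing.isLinear.Build k (F12 k G1 G2) (F21 k G1 G2) *:%R rule_map rule_map_linear.

Fact rule_map_equivariant (s : 'S_3) (u v : F12 k G1 G2) :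
  span_val v = relabel s (span_val u) ->
  span_val (rule_map v) = relabel s (span_val (rule_map u)).
Proof.
move=> E; have bs := perm_bij s; apply: free_val_inj.
by rewrite (val_relabel _ bs) !rule_mapE E (val_relabel _ bs) rule_lin_relabel.
Qed.

Definition rule_law : rewrite_law k G1 G2 := RewriteLaw rule_map_equivariant.

Lemma rule_law1 g h : rewrites rule_law
  (monomial k (Node (inl g) (Node (inr h) (Leaf 0) (Leaf 1)) (Leaf 2))) (u0 g h).
Proof.
have [m1 _] := @mlinear_base (G1 + G2)%type (inl g) (inr h).
have [|w E] := @span_val_ex k (F 'I_3) (quad_gen inl inr)
  (monomial k (Node (inl g) (Node (inr h) (Leaf 0) (Leaf 1)) (Leaf 2))).
  by apply/F12P; rewrite val_monomial //; apply: supportedU.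
exists w => //; apply: free_val_inj; rewrite rule_mapE E val_monomial //.
rewrite /rule_lin linextU /= -[RHS]mrelabel_id; apply: eq_bind => i.
by rewrite (triE id).
Qed.

Lemma rule_law2 g h : rewrites rule_law
  (monomial k (Node (inl g) (Leaf 0) (Node (inr h) (Leaf 1) (Leaf 2)))) (v0 g h).
Proof.
have [_ m2] := @mlinear_base (G1 + G2)%type (inl g) (inr h).
have [|w E] := @span_val_ex k (F 'I_3) (quad_gen inl inr)
  (monomial k (Node (inl g) (Leaf 0) (Node (inr h) (Leaf 1) (Leaf 2)))).
  by apply/F12P; rewrite val_monomial //; apply: supportedU.
exists w => //; apply: free_val_inj; rewrite rule_mapE E val_monomial //.
rewrite /rule_lin linextU /= -[RHS]mrelabel_id; apply: eq_bind => i.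
by rewrite (triE id).
Qed.

End LawExistence.

Lemma scale_interchange (k : fieldType) (V : lmodType k) (c p q : k) (x y z w : V) :
  p *: (c *: x + y) + q *: (c *: z + w) = c *: (p *: x + q *: z) + (p *: y + q *: w).
Proof. by rewrite !scalerDr !scalerA (mulrC c p) (mulrC c q) addrACA. Qed.

Lemma supportedZD (k : fieldType) (G X : choiceType) (p : pred (tree G X)) (c d : k)
    (a b : {malg k[tree G X]}) :
  supported p a -> supported p b -> supported p (c *: a + d *: b).
Proof.
move=> sa sb; suff : c *: a + d *: b \in @supported k G X p by [].
by rewrite rpredD ?rpredZ.
Qed.

Lemma supported_graft (k : fieldType) (G X : choiceType) (p q r : pred (tree G X)) g
    (a b : {malg k[tree G X]}) :
  supported p a -> supported q b -> (forall s t, p s -> q t -> r (Node g s t)) ->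
  supported r (graft g a b).
Proof.
move=> sa sb H; apply: (supported_linext sa) => s ps.
by apply: (supported_linext sb) => t qt; apply: supportedU; apply: H.
Qed.

(** * Changes of generators *)

Section Mix.
Context (k : fieldType) (G : choiceType) (al be : G -> k).
Local Notation A X := {malg k[tree G X]}.
Local Notation F := (free_operad k G).

(** The element [al g + be g] tau of k[Sigma_2], tau being the transposition, applied to the
    generator [g]. *)
Definition mixop (X : choiceType) (g : G) (a b : A X) : A X :=
  al g *: graft g a b + be g *: graft g b a.

Lemma mixop_bilinear (X : choiceType) : bilinear_op (@mixop X).
Proof.
have sw := @scale_interchange k (A X).
split=> g b c x y; rewrite /mixop.
  by rewrite (graft_linl g b c x y) (graft_linr g b c x y); apply: sw.
by rewrite (graft_linl g b c x y) (graft_linr g b c x y); apply: sw.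
Qed.

Definition mix (X : choiceType) : A X -> A X := aeval (@mixop X) (fun i => << Leaf i >>).

Lemma mix_linear (X : choiceType) : linear (@mix X).
Proof. exact: aeval_linear. Qed.

Lemma mix_graft (X : choiceType) g (a b : A X) :
  mix (graft g a b) = mixop g (mix a) (mix b).
Proof. exact: (aeval_graft (@mixop_bilinear X)). Qed.

Lemma mix_leaf (X : choiceType) (i : X) : mix << Leaf i >> = << Leaf i >>.
Proof. exact: aevalU. Qed.

Lemma bind_mix (I X : choiceType) (f : I -> A X) a :
  bind f (mix a) = aeval (@mixop X) f a.
Proof.
rewrite /mix (@aeval_morph k G _ _ _ (@mixop X) (bind f)).
- by apply: eq_aeval => i; rewrite /= bindU.
- exact: bind_lin.
by move=> g x y; rewrite /mixop bind_lin (linear_mapZ (bind_lin f)) !bind_graft.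
Qed.

Lemma mix_bind (I X : choiceType) (f : I -> A X) a :
  mix (bind f a) = bind (fun i => mix (f i)) (mix a).
Proof. by rewrite bind_mix /mix (aeval_bind (@mixop_bilinear X)). Qed.

Lemma mix_relabel (I X : choiceType) (f : I -> X) a :
  mix (mrelabel f a) = mrelabel f (mix a).
Proof. by rewrite [LHS]mix_bind; apply: eq_bind => i; rewrite mix_leaf. Qed.

Lemma supported_mix (I : finType) (a : A I) :
  supported (@mlinear G I) a -> supported (@mlinear G I) (mix a).
Proof.
move=> sa; apply: (supported_linext sa) => t mt.
suff H : supported (fun u => perm_eq (leaves u) (leaves t)) (teval (@mixop I) (fun i => << Leaf i >>) t).
  by apply: sub_supported H => u /perm_trans; apply.
elim: {mt} t => [i|g l IHl r IHr]; first exact: supportedU.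
rewrite [teval _ _ _]/= /mixop; apply: supportedZD.
  by apply: (supported_graft IHl IHr) => u v ul vr; rewrite /= perm_cat.
by apply: (supported_graft IHr IHl) => v u vr ul; rewrite /= perm_catC perm_cat.
Qed.

Definition free_mix (I : finType) (x : F I) : F I :=
  FreeElt (supported_mix (free_valP x)).

Lemma free_mix_hom : operad_hom free_mix.
Proof.
split=> [I c x y|I J f x bf||J K mu nu]; apply: free_val_inj => /=.
- exact: mix_linear.
- by rewrite !val_relabel //= mix_relabel.
- by rewrite !val_unit mix_leaf.
- by rewrite mix_bind; apply: eq_bind => j; rewrite mix_relabel.
Qed.

End Mix.
Arguments free_mix {k G} al be {I} x.

Lemma scale_unmix (k : fieldType) (V : lmodType k) (p q p' q' : k) (x y : V) :
  p * p' + q * q' = 1 -> p * q' + q * p' = 0 ->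
  p *: (p' *: x + q' *: y) + q *: (p' *: y + q' *: x) = x.
Proof.
move=> E1 E2; rewrite !scalerDr !scalerA [X in _ + X]addrC addrACA -!scalerDl E1 E2.
by rewrite scale1r scale0r addr0.
Qed.

(** The hypotheses say that the two elements of k[Sigma_2] attached to each generator are inverse to
    each other. *)
Lemma mixK (k : fieldType) (G : choiceType) (al be al' be' : G -> k) :
  (forall g, al g * al' g + be g * be' g = 1) ->
  (forall g, al g * be' g + be g * al' g = 0) ->
  forall X : choiceType, cancel (@mix k G al be X) (@mix k G al' be' X).
Proof.
move=> E1 E2 X a; have l1 := @mix_linear k G al be X; have l2 := @mix_linear k G al' be' X.
move: a; apply: linear_malgP => [c x y|//|]; first by rewrite l1 l2.
elim=> [i|g l IHl r IHr]; first by rewrite !mix_leaf.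
rewrite -graftU mix_graft l2 (linear_mapZ l2) !mix_graft IHl IHr /mixop.
exact: scale_unmix.
Qed.

Lemma free_mixK (k : fieldType) (G : choiceType) (al be al' be' : G -> k) :
  (forall g, al g * al' g + be g * be' g = 1) ->
  (forall g, al g * be' g + be g * al' g = 0) ->
  forall I : finType, cancel (@free_mix k G al be I) (@free_mix k G al' be' I).
Proof. by move=> E1 E2 I x; apply: free_val_inj; rewrite /= mixK. Qed.

Lemma quot_iso (k : fieldType) (P Q : operad k) (m n : nat)
    (R : P 'I_m -> Prop) (S : Q 'I_n -> Prop)
    (phi : forall I, P I -> Q I) (psi : forall I, Q I -> P I) :
  operad_hom phi -> operad_hom psi ->
  (forall I, cancel (phi I) (psi I)) -> (forall I, cancel (psi I) (phi I)) ->
  (forall r, R r -> ideal_gen S (phi _ r)) ->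
  (forall s, S s -> ideal_gen R (psi _ s)) ->
  operad_iso (quot_operad R) (quot_operad S).
Proof.
move=> hphi hpsi phiK psiK RS SR.
exists (fun I => @quot_map k P Q m n R S phi I); split; first exact: quot_map_hom.
move=> I; exists (@quot_map k Q P n m S R psi I) => q.
  by have [x ->] := qpi_ex q; rewrite !quot_map_pi // phiK.
by have [x ->] := qpi_ex q; rewrite !quot_map_pi // psiK.
Qed.

Section Transport.
Context (k : fieldType) (al be al' be' : unit + unit -> k).
Hypothesis E1 : forall g, al g * al' g + be g * be' g = 1.
Hypothesis E2 : forall g, al g * be' g + be g * al' g = 0.

Local Notation F := (free_operad k (unit + unit)%type).
Local Notation phi := (@free_mix k (unit + unit)%type al be _).
Local Notation psi := (@free_mix k (unit + unit)%type al' be' _).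
Local Notation m1 := (monomial k (Node (inl tt) (Node (inr tt) (Leaf 0) (Leaf 1)) (Leaf 2)) : F 'I_3).
Local Notation m2 := (monomial k (Node (inl tt) (Leaf 0) (Node (inr tt) (Leaf 1) (Leaf 2))) : F 'I_3).

Let E1' g : al' g * al g + be' g * be g = 1.
Proof. by rewrite mulrC [X in _ + X]mulrC. Qed.
Let E2' g : al' g * be g + be' g * al g = 0.
Proof. by rewrite mulrC addrC [X in X + _]mulrC. Qed.

Lemma supported_quadratic_mix (p q : pred (unit + unit)) (a b : unit + unit -> k)
    (I : choiceType) (x : {malg k[tree (unit + unit) I]}) :
  supported (quadratic p q (X := _)) x -> supported (quadratic p q (X := _)) (mix a b x).
Proof.
move=> sx; apply: (supported_linext sx) => t.
case/quadraticP=> g [h [i [j [l [pg [qh E]]]]]].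
pose leaf (t : tree (unit + unit) I) := if t is Leaf _ then true else false.
pose cor (t : tree (unit + unit) I) := if t is Node h (Leaf _) (Leaf _) then q h else false.
have sleaf i0 : supported (k := k) leaf << Leaf i0 : tree (unit + unit) I >> by apply: supportedU.
have scor i0 j0 : supported cor (mixop (k := k) a b h << Leaf i0 >> << Leaf j0 >>).
  by apply: supportedZD; apply: (supported_graft (sleaf _) (sleaf _)) => -[] // ? [].
have quadl s u : leaf s -> cor u -> quadratic p q (Node g s u).
  by case: s => // ? _; case: u => // ? [] // ? [] //= ?; rewrite pg.
have quadr s u : cor s -> leaf u -> quadratic p q (Node g s u).
  by case: u => // ?; case: s => // ? [] // ? [] //= ?; rewrite pg => ->.
by case: E => ->; apply: supportedZD;
  first [exact: (supported_graft (scor _ _) (sleaf _))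
        |exact: (supported_graft (sleaf _) (scor _ _))].
Qed.

Context (R1 : free_operad k unit 'I_3 -> Prop) (R2 : free_operad k unit 'I_3 -> Prop).
Context (D D' : rewrite_law k unit unit).
Hypothesis R1phi : forall r, R1 r -> ideal_gen (combined_rel R1 R2 D) (phi (free_map inl r)).
Hypothesis R1psi : forall r, R1 r -> ideal_gen (combined_rel R1 R2 D') (psi (free_map inl r)).
Hypothesis R2phi : forall r, R2 r -> ideal_gen (combined_rel R1 R2 D) (phi (free_map inr r)).
Hypothesis R2psi : forall r, R2 r -> ideal_gen (combined_rel R1 R2 D') (psi (free_map inr r)).

Lemma rewrites_transport :
  (forall v, rewrites D' m1 v -> rewrites D (phi m1) (phi v)) ->
  (forall v, rewrites D' m2 v -> rewrites D (phi m2) (phi v)) ->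
  forall u v, rewrites D' u v -> rewrites D (phi u) (phi v).
Proof.
move=> H1 H2; have [pl pr _ _] := free_mix_hom al be.
pose Q (u v : F 'I_3) := rewrites D (phi u) (phi v).
apply: (@rewrites_ind _ _ _ D' Q).
- by rewrite /Q (linear_map0 (pl _)); apply: rewrites0.
- by move=> c u v u' v' Du Du'; rewrite /Q !pl; apply: rewritesZD.
- move=> s u v Du; have bs := perm_bij s.
  by rewrite /Q (pr _ _ _ u bs) (pr _ _ _ v bs); apply: rewrites_relabel.
- by case=> -[] v; apply: H1.
- by case=> -[] v; apply: H2.
Qed.

(** Checking the rules of [D'] is enough for both directions: a law is single-valued, so the value
    of [D] on the image of a rule of [D'] is the image of the value of [D']. *)
Lemma combined_transport :
  (forall v, rewrites D' m1 v -> rewrites D (phi m1) (phi v)) ->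
  (forall v, rewrites D' m2 v -> rewrites D (phi m2) (phi v)) ->
  operad_iso (combined R1 R2 D') (combined R1 R2 D) /\
  operad_iso (combined R1 R2 D) (combined R1 R2 D').
Proof.
move=> H1 H2; have H := rewrites_transport H1 H2.
have hphi := free_mix_hom al be; have hpsi := free_mix_hom al' be'.
have phiK := @free_mixK k _ al be al' be' E1 E2.
have psiK := @free_mixK k _ al' be' al be E1' E2'.
have Rphi r : combined_rel R1 R2 D' r -> ideal_gen (combined_rel R1 R2 D) (phi r).
  case=> [{}r Rr|w|{}r Rr]; [exact: R1phi| |exact: R2phi].
  have [pl _ _ _] := hphi; rewrite (lin_sub _ _ (pl _)).
  have [w' <- <-] : rewrites D (phi (span_val w)) (phi (span_val (D' w))).
    by apply: H; exists w.
  by apply: ideal_gen_sub; constructor.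
have Rpsi r : combined_rel R1 R2 D r -> ideal_gen (combined_rel R1 R2 D') (psi r).
  case=> [{}r Rr|w|{}r Rr]; [exact: R1psi| |exact: R2psi].
  have [pl _ _ _] := hpsi; rewrite (lin_sub _ _ (pl _)).
  (* [psi] preserves the shape of quadratic trees, so [D'] has a value [v] here; sending it back by
     [phi] identifies [v] with the image of [D w] under [psi]. *)
  have [|v Dv] := @rewrites_ex k unit unit D' (psi (span_val w)).
    by apply: supported_quadratic_mix; apply/F12P; apply: span_valP.
  have := H _ _ Dv; rewrite psiK => Dw.
  have Dw' : rewrites D (span_val w) (span_val (D w)) by exists w.
  have Dwv : span_val (D w) = phi v by exact: rewrites_inj Dw' Dw.
  have psiD : psi (span_val (D w)) = v by rewrite Dwv; exact: phiK.
  move: (psi (span_val w)) (psi (span_val (D w))) Dv psiD => u _ [w' <- <-] ->.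
  by apply: ideal_gen_sub; constructor.
split; first exact: (quot_iso hphi hpsi).
exact: (quot_iso hpsi hphi).
Qed.

End Transport.

(** * The model: magmatic trees with words as leaves *)

Section Bilinear.
Context (k : fieldType) (X Y : choiceType) (V : lmodType k) (f : X -> Y -> V).

Definition linext2 (a : {malg k[X]}) (b : {malg k[Y]}) : V :=
  linext (fun s => linext (f s) b) a.

Lemma linext2_linl b : linear (linext2 ^~ b).
Proof. by move=> c x y; apply: linext_linear. Qed.

Lemma linext2_linr a : linear (linext2 a).
Proof. by move=> c x y; apply: linext_fun => t; apply: linext_linear. Qed.

Lemma linext2U s t : linext2 << s >> << t >> = f s t.
Proof. by rewrite /linext2 !linextU. Qed.

End Bilinear.

(* Normal forms are magmatic trees whose leaves are words, the word [(i, s)]  *)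
(* standing for the nonempty sequence [i :: s]. *)
Section WordTrees.
Context (X : Type).

Local Notation word := (X * seq X)%type.
Local Notation wtree := (tree unit (X * seq X)).

Definition wletters (w : word) : seq X := w.1 :: w.2.
Definition wcat (v w : word) : word := (v.1, v.2 ++ wletters w).

Lemma wcatA u v w : wcat (wcat u v) w = wcat u (wcat v w).
Proof. by rewrite /wcat /= -catA. Qed.

Fixpoint comb (G : Type) (g : G) (i : X) (s : seq X) : tree G X :=
  if s is j :: s' then Node g (Leaf i) (comb g j s') else Leaf i.

Lemma leaves_comb (G : Type) (g : G) i s : leaves (comb g i s) = i :: s.
Proof. by elim: s i => //= j s IHs i; rewrite IHs. Qed.

Fixpoint emb (t : wtree) : tree (unit + unit) X :=
  match t with
  | Leaf w => comb (inl tt) w.1 w.2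
  | Node _ l r => Node (inr tt) (emb l) (emb r)
  end.

Lemma leaves_emb t : leaves (emb t) = flatten (map wletters (leaves t)).
Proof.
elim: t => [w|g l IHl r IHr] /=; first by rewrite leaves_comb cats0.
by rewrite IHl IHr map_cat flatten_cat.
Qed.

(* [sg] selects multiplication from the left, [sl] the leftmost leaf. *)
Fixpoint attach (sg sl : bool) (v : word) (t : wtree) : wtree :=
  match t with
  | Leaf w => Leaf (if sg then wcat v w else wcat w v)
  | Node g l r => if sl then Node g (attach sg sl v l) r else Node g l (attach sg sl v r)
  end.

(* The slot [None] stands for the trivial law. *)
Definition act (sg : bool) (sl : option bool) (v : word) (t : wtree) : option wtree :=
  match t, sl with
  | Leaf w, _ => Some (Leaf (if sg then wcat v w else wcat w v))
  | Node _ _ _, Some sl => Some (attach sg sl v t)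
  | Node _ _ _, None => None
  end.

(** The factor on the acting side must be a word; a magmatic product in its place gives zero,
    encoded by [None]. *)
Definition wmul (sg : bool) (sl : option bool) (s t : wtree) : option wtree :=
  match (if sg then s else t), (if sg then t else s) with
  | Leaf v, u => act sg sl v u
  | Node _ _ _, _ => None
  end.

Lemma attachA sg sl v w t :
  attach sg sl v (attach sg sl w t) = attach sg sl (if sg then wcat v w else wcat w v) t.
Proof.
elim: t => [u|g l IHl r IHr] /=; first by case: sg; rewrite wcatA.
by case: sl IHl IHr => IHl IHr /=; rewrite ?IHl ?IHr.
Qed.

(** Two successive actions reach the same extreme leaf, so they amount to the action of the product
    word ([attachA]). Apart from this and from products of words, both sides are [None]. *)
Lemma wmulA sg sl s t u :
  obind (wmul sg sl ^~ u) (wmul sg sl s t) = obind (wmul sg sl s) (wmul sg sl t u).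
Proof.
case: sg s t u => -[v|g1 l1 r1] [w|g2 l2 r2] [y|g3 l3 r3]; rewrite /wmul /act /=;
  case: sl => [[]|] //=; rewrite ?wcatA ?attachA //=.
Qed.

End WordTrees.

Arguments emb {X} t.
Arguments wletters {X} w : simpl never.

Notation wtree X := (tree unit (X * seq X)).

Lemma leaves_attach (X : eqType) sg sl (v : X * seq X) (t : wtree X) :
  perm_eq (leaves (emb (attach sg sl v t))) (wletters v ++ leaves (emb t)).
Proof.
elim: t => [w|g l IHl r IHr].
  rewrite /= !leaves_comb -[w.1 :: w.2]/(wletters w); case: sg => //.
  by rewrite -[X in perm_eq X _]/(wletters w ++ wletters v) perm_catC.
move: (wletters v) IHl IHr => W; case: sl => IHl IHr /=; first by rewrite catA perm_cat2r.
by rewrite perm_sym perm_catCA perm_sym perm_cat2l.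
Qed.

Lemma leaves_wmul (X : eqType) sg sl (s t u : wtree X) : wmul sg sl s t = Some u ->
  perm_eq (leaves (emb u)) (leaves (emb s) ++ leaves (emb t)).
Proof.
have H (v : X * seq X) (s' : wtree X) : act sg sl v s' = Some u ->
    perm_eq (leaves (emb u)) (wletters v ++ leaves (emb s')).
  case: s' => [w|g l r]; rewrite /act; last case: sl => // sl' [<-].
    by case=> <-; exact: (leaves_attach sg true v (Leaf w)).
  exact: leaves_attach.
rewrite /wmul; case: sg H => H.
  by case: s => // v /H; rewrite [emb (Leaf v)]/= leaves_comb.
case: t => // v /H /perm_trans; apply; rewrite [emb (Leaf v)]/= leaves_comb.
by rewrite perm_catC.
Qed.

Section Model.
Context (k : fieldType) (sg : bool) (sl : option bool) (X : choiceType).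
Local Notation B := {malg k[wtree X]}.

(** The structure constants that the free algebra of the combined operad has if normal forms are a
    basis: [∘] is free and [•] is [wmul]. *)
Definition model_base (g : unit + unit) (s t : wtree X) : B :=
  match g with
  | inl _ => if wmul sg sl s t is Some u then << u >> else 0
  | inr _ => << Node tt s t >>
  end.

Definition model_op (g : unit + unit) : B -> B -> B := linext2 (model_base g).

Lemma model_bilinear : bilinear_op model_op.
Proof. by split=> g a; [apply: linext2_linl|apply: linext2_linr]. Qed.

Lemma model_assoc g a b c :
  model_op (inl g) (model_op (inl g) a b) c = model_op (inl g) a (model_op (inl g) b c).
Proof.
have [ml mr] := model_bilinear.
move: a; apply: linear_malgP => [z x y|z x y|s]; rewrite ?(ml _ _ z) //.
move: b; apply: linear_malgP => [z x y|z x y|t]; rewrite ?(ml _ _ z, mr _ _ z) ?(ml _ _ z) //.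
move: c; apply: linear_malgP => [z x y|z x y|u]; rewrite ?(mr _ _ z) ?(mr _ _ z) //.
have := wmulA sg sl s t u; rewrite /model_op !linext2U /=.
have l0 a : linext2 (model_base (inl g)) 0 a = 0 by exact: (linear_map0 (ml (inl g) a)).
have r0 a : linext2 (model_base (inl g)) a 0 = 0 by exact: (linear_map0 (mr (inl g) a)).
case: (wmul sg sl s t) => [st|]; case: (wmul sg sl t u) => [tu|] /=;
  move=> E; rewrite ?l0 ?r0 ?linext2U //=; first by rewrite E.
  by rewrite E.
by rewrite -E.
Qed.

Definition model_gen (i : X) : B := << Leaf (i, [::]) >>.

(** Normal forms evaluate to distinct basis elements of the model; hence their independence. *)
Lemma teval_emb t : teval model_op model_gen (emb t) = << t >>.
Proof.
elim: t => [[i s]|[] l IHl r IHr] /=; last by rewrite IHl IHr /model_op linext2U.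
elim: s i => [//|j s IHs] i.
rewrite -[LHS]/(model_op (inl tt) (model_gen i) (teval model_op model_gen (comb (inl tt) j s))).
rewrite IHs.
rewrite [LHS]linext2U.
by rewrite /model_base /wmul; case: (sg).
Qed.

Lemma supported_model (t : tree (unit + unit) X) :
  supported (fun u => perm_eq (leaves (emb u)) (leaves t)) (teval model_op model_gen t).
Proof.
elim: t => [i|g l IHl r IHr]; first exact: supportedU.
apply: (supported_linext IHl) => u ul; apply: (supported_linext IHr) => v vr.
case: g => -[] /=; last by apply: supportedU; rewrite /= perm_cat.
case E: (wmul sg sl u v) => [w|]; last by apply/supportedP => w; rewrite mcoeff0 eqxx.
apply: supportedU; apply: (perm_trans (leaves_wmul E)).
exact: perm_cat.
Qed.

End Model.

(** * Algebras over the combined operad *)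

Section CombinedAlgebras.
Context (k : fieldType) (D : AssMag_law k).
Local Notation F := (free_operad k (unit + unit)%type).
Local Notation rel := (combined_rel (@Ass_rel k) (@Mag_rel k) D).
Local Notation m1 :=
  (monomial k (Node (inl tt) (Node (inr tt) (Leaf 0) (Leaf 1)) (Leaf 2)) : F 'I_3).
Local Notation m2 :=
  (monomial k (Node (inl tt) (Leaf 0) (Node (inr tt) (Leaf 1) (Leaf 2))) : F 'I_3).

Lemma free_map_monomial (G H : choiceType) (h : G -> H) (I : finType) (t : tree G I) :
  mlinear t -> free_map h (monomial k t) = monomial k (tree_map h t).
Proof.
move=> mt; have mt' : mlinear (tree_map h t) by rewrite /mlinear leaves_map.
apply: free_val_inj; rewrite /= (val_monomial k mt) (val_monomial k mt').
exact: linextU.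
Qed.

Lemma free_map_Ass_rel : exists2 r, Ass_rel r & free_map inl r =
  monomial k (Node (inl tt) (Node (inl tt) (Leaf 0) (Leaf 1)) (Leaf 2)) -
  monomial k (Node (inl tt) (Leaf 0) (Node (inl tt) (Leaf 1) (Leaf 2))) :> F 'I_3.
Proof.
have [ma mb] := @mlinear_base unit tt tt.
eexists; first by [].
have [fl _ _ _] := @free_map_hom k unit (unit + unit)%type inl.
rewrite (lin_sub _ _ (fl 'I_3)); congr (_ - _).
  exact: free_map_monomial ma.
exact: free_map_monomial mb.
Qed.

Lemma aeval_base (G : choiceType) (V : lmodType k) (op : G -> V -> V -> V)
    (f : 'I_3 -> V) (g h : G) :
  aeval op f (free_val (monomial k (Node g (Node h (Leaf 0) (Leaf 1)) (Leaf 2)))) =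
    op g (op h (f 0) (f 1)) (f 2) /\
  aeval op f (free_val (monomial k (Node g (Leaf 0) (Node h (Leaf 1) (Leaf 2))))) =
    op g (f 0) (op h (f 1) (f 2)).
Proof.
have [ma mb] := @mlinear_base G g h.
split.
  rewrite (val_monomial k ma).
  exact: aevalU.
rewrite (val_monomial k mb).
exact: aevalU.
Qed.

Lemma aeval_sub0 (G : choiceType) (V : lmodType k) (op : G -> V -> V -> V)
    (I : finType) (f : I -> V) (u v : free_operad k G I) :
  aeval op f (free_val (u - v)) = 0 <->
  aeval op f (free_val u) = aeval op f (free_val v).
Proof.
rewrite (lin_sub _ _ (@free_val_linear k G I)) (lin_sub _ _ (aeval_linear op f)).
by split=> [/eqP|->]; rewrite ?subrr // subr_eq0 => /eqP.
Qed.

(** An algebra is recognised on the associativity relation and on the two rules with ordered leaves;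
    since all assignments [f] are allowed, the relabelled rules follow. *)
Lemma combined_eval (V : lmodType k) (op : unit + unit -> V -> V -> V) :
  bilinear_op op ->
  (forall a b c, op (inl tt) (op (inl tt) a b) c = op (inl tt) a (op (inl tt) b c)) ->
  (forall v f, rewrites D m1 v -> aeval op f (free_val (m1 - v)) = 0) ->
  (forall v f, rewrites D m2 v -> aeval op f (free_val (m2 - v)) = 0) ->
  forall (I : finType) (x : F I), ideal_gen rel x ->
  forall f, aeval op f (free_val x) = 0.
Proof.
move=> opB opA H1 H2 I x Ix; apply: (Ix (fun I x => forall f, aeval op f (free_val x) = 0)).
  exact: eval_ideal.
have al f := @aeval_linear k (unit + unit)%type V op 'I_3 f.
move=> _ [r ->|w|r []] f.
  have [r' -> ->] := free_map_Ass_rel; apply/aeval_sub0.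
  have [E1 E2] := aeval_base op f (inl tt) (inl tt).
  by rewrite [LHS]E1 [RHS]E2 opA.
pose Q (u v : F 'I_3) := forall f, aeval op f (free_val (u - v)) = 0.
suff : Q (span_val w) (span_val (D w)) by apply.
have : rewrites D (span_val w) (span_val (D w)) by exists w.
apply: (@rewrites_ind k unit unit D Q) => [f'|c u v u' v' Qu Qu' f'|s u v Qu f'|[] [] v Dv f'|[] [] v Dv f'].
- by rewrite subrr; exact: (linear_map0 (al f')).
- apply/aeval_sub0; rewrite !free_val_linear !(al f').
  by rewrite (aeval_sub0 op f' u v).1 // (aeval_sub0 op f' u' v').1.
- have bs := perm_bij s; apply/aeval_sub0.
  rewrite (val_relabel u bs) (val_relabel v bs) !(aeval_mrelabel opB).
  exact/aeval_sub0.
- exact: H1.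
- exact: H2.
Qed.

Section Quotient.
Context (X : choiceType).
Local Notation cls := (@tcls k (unit + unit)%type 3 rel X).
Local Notation mul := (@tmul k (unit + unit)%type 3 rel X).

Lemma cls_assoc a b c : cls (Node (inl tt) (Node (inl tt) a b) c) =
  cls (Node (inl tt) a (Node (inl tt) b c)).
Proof.
have [r Rr E] := free_map_Ass_rel.
have := @tpi_rel k (unit + unit)%type 3 rel X _ (tri a b c) (combined_rel1 _ D Rr).
rewrite E => /aeval_sub0 E'.
have [E1 E2] := aeval_base mul (fun i => cls (tri a b c i)) (inl tt) (inl tt).
rewrite !tcls_node.
exact: etrans (esym E1) (etrans E' E2).
Qed.

Lemma cls_rewrites u v (f : 'I_3 -> tree (unit + unit) X) : rewrites D u v ->
  aeval mul (fun i => cls (f i)) (free_val u) = aeval mul (fun i => cls (f i)) (free_val v).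
Proof.
case=> w <- <-; have := @tpi_rel k _ 3 rel X _ f (combined_relD (@Ass_rel k) (@Mag_rel k) D w).
by move/aeval_sub0.
Qed.

Lemma cls_rule1 v a b c : rewrites D m1 v ->
  cls (Node (inl tt) (Node (inr tt) a b) c) =
  aeval mul (fun i => cls (tri a b c i)) (free_val v).
Proof.
move/(cls_rewrites (tri a b c)) <-.
have [E _] := aeval_base mul (fun i => cls (tri a b c i)) (inl tt) (inr tt).
rewrite !tcls_node.
exact: esym E.
Qed.

Lemma cls_rule2 v a b c : rewrites D m2 v ->
  cls (Node (inl tt) a (Node (inr tt) b c)) =
  aeval mul (fun i => cls (tri a b c i)) (free_val v).
Proof.
move/(cls_rewrites (tri a b c)) <-.
have [_ E] := aeval_base mul (fun i => cls (tri a b c i)) (inl tt) (inr tt).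
rewrite !tcls_node.
exact: esym E.
Qed.

(** A word embeds as a right comb, and associativity moves the brackets of the product of two such
    combs to the right. *)
Lemma cls_comb_cat v w : cls (Node (inl tt) (emb (Leaf v)) (emb (Leaf w))) =
  cls (emb (Leaf (wcat v w))).
Proof.
case: v => i s; elim: s i => [//|j s IHs] i.
rewrite -[emb (Leaf (i, j :: s))]/(Node (inl tt) (Leaf i) (emb (Leaf (j, s)))).
by rewrite cls_assoc tcls_node IHs -tcls_node.
Qed.

End Quotient.
End CombinedAlgebras.

(** * Monomial laws and their normal forms *)

Section MonomialLaws.
Context (k : fieldType).
Local Notation F := (free_operad k (unit + unit)%type).
Local Notation x := (Leaf (0 : 'I_3)).
Local Notation y := (Leaf (1 : 'I_3)).
Local Notation z := (Leaf (2 : 'I_3)).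

(* In the next five definitions [None] stands for the trivial law. *)
Definition law_rhs1 (lab : option truncated_label) : option (tree (unit + unit) 'I_3) :=
  match lab with
  | Some Label_c => Some (x ∘ (y • z))%T
  | Some Label_f => Some ((x • z) ∘ y)%T
  | _ => None
  end.

Definition law_rhs2 (lab : option truncated_label) : option (tree (unit + unit) 'I_3) :=
  match lab with
  | Some Label_b => Some ((x • y) ∘ z)%T
  | Some Label_e => Some (y ∘ (x • z))%T
  | _ => None
  end.

Definition law_side (lab : option truncated_label) : bool :=
  match lab with None | Some Label_b | Some Label_e => true | _ => false end.

Definition law_slot (lab : option truncated_label) : option bool :=
  match lab with
  | None => None
  | Some Label_b | Some Label_f => Some true
  | Some Label_c | Some Label_e => Some false
  end.

Definition omonomial (t : option (tree (unit + unit) 'I_3)) : F 'I_3 :=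
  if t is Some t then monomial k t else 0.

Definition monomial_law (lab : option truncated_label) (D : AssMag_law k) : Prop :=
  rules D (omonomial (law_rhs1 lab)) (omonomial (law_rhs2 lab)).

Lemma truncated_monomial r D : truncated r D <-> monomial_law (Some r) D.
Proof. by case: r. Qed.

Lemma perm_enum3 (s : seq 'I_3) : perm_eq (map val s) [:: 0; 1; 2]%N ->
  perm_eq s (enum 'I_3).
Proof.
have -> : [:: 0; 1; 2]%N = map val (enum 'I_3) by rewrite val_enum_ord.
exact: (perm_map_inj val_inj).
Qed.

Lemma mlinear_leaves3 (G : choiceType) (t : tree G 'I_3) :
  perm_eq (map val (leaves t)) [:: 0; 1; 2]%N -> mlinear t.
Proof. exact: perm_enum3. Qed.

Lemma mlinear_rhs lab t : law_rhs1 lab = Some t \/ law_rhs2 lab = Some t -> mlinear t.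
Proof.
by case: lab => [[]|] /= [] // [<-]; apply: mlinear_leaves3.
Qed.

Lemma aeval_omonomial (V : lmodType k) (op : unit + unit -> V -> V -> V) (f : 'I_3 -> V) o :
  (forall t, o = Some t -> mlinear t) ->
  aeval op f (free_val (omonomial o)) = oapp (teval op f) 0 o.
Proof.
case: o => [t|] H; last exact: (linear_map0 (aeval_linear op f)).
by rewrite /omonomial val_monomial ?H // [LHS]aevalU.
Qed.

Context (lab : option truncated_label) (D : AssMag_law k).
Hypothesis Dlab : monomial_law lab D.
Local Notation sg := (law_side lab).
Local Notation sl := (law_slot lab).
Local Notation rel := (combined_rel (@Ass_rel k) (@Mag_rel k) D).

Lemma aeval_rhs (V : lmodType k) (op : unit + unit -> V -> V -> V) (f : 'I_3 -> V) :
  aeval op f (free_val (omonomial (law_rhs1 lab))) = oapp (teval op f) 0 (law_rhs1 lab) /\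
  aeval op f (free_val (omonomial (law_rhs2 lab))) = oapp (teval op f) 0 (law_rhs2 lab).
Proof.
by split; apply: aeval_omonomial => t E; apply: (@mlinear_rhs lab); [left|right].
Qed.

(** To attach a word at an extreme leaf of a magmatic product is to attach it to the factor on that
    side, which is what the rule prescribes. If the acting factor is not a word, both sides
    vanish. *)
Lemma model_rules (X : choiceType) (f : 'I_3 -> wtree X) (op := @model_op k sg sl X) :
  op (inl tt) (op (inr tt) << f 0 >> << f 1 >>) << f 2 >> =
    oapp (teval op (fun i => << f i >>)) 0 (law_rhs1 lab) /\
  op (inl tt) << f 0 >> (op (inr tt) << f 1 >> << f 2 >>) =
    oapp (teval op (fun i => << f i >>)) 0 (law_rhs2 lab).
Proof.
have [ml mr] := @model_bilinear k sg sl X.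
have l0 g a : op g 0 a = 0 by exact: (linear_map0 (ml g a)).
have r0 g a : op g a 0 = 0 by exact: (linear_map0 (mr g a)).
have E1 g s t : op g << s >> << t >> = model_base k sg sl g s t by exact: linext2U.
have E2 s t : op (inr tt) << s >> << t >> = << Node tt s t >> by exact: linext2U.
have Ex i : teval op (fun i => << f i >>) (Leaf i) = << f i >> by [].
move: (op) l0 r0 E1 E2; case: (lab) => [[]|] o l0 r0 E1 E2; split; rewrite /= !E2 !E1 /= /wmul /=;
  case: (f 0) => [?|[] ? ?]; case: (f 1) => [?|[] ? ?]; case: (f 2) => [?|[] ? ?];
  by rewrite /= ?E2 ?l0 ?r0.
Qed.

Lemma model_eval (X : choiceType) (I : finType) (u : F I) :
  ideal_gen rel u -> forall f : I -> {malg k[wtree X]},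
  aeval (@model_op k sg sl X) f (free_val u) = 0.
Proof.
have opB := @model_bilinear k sg sl X; have [D1 D2] := Dlab.
move: I u; apply: combined_eval => [//|a b c|v f Dv|v f Dv]; first exact: model_assoc.
  move: f; apply: aeval_basis => // f; apply/aeval_sub0.
  have [E _] := aeval_base (@model_op k sg sl X) (fun i => << f i >>) (inl tt) (inr tt).
  have [E' _] := aeval_rhs (@model_op k sg sl X) (fun i => << f i >>).
  have [Ef _] := model_rules f.
  by rewrite (rewrites_inj Dv D1); exact: etrans E (etrans Ef (esym E')).
move: f; apply: aeval_basis => // f; apply/aeval_sub0.
have [_ E] := aeval_base (@model_op k sg sl X) (fun i => << f i >>) (inl tt) (inr tt).
have [_ E'] := aeval_rhs (@model_op k sg sl X) (fun i => << f i >>).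
have [_ Ef] := model_rules f.
by rewrite (rewrites_inj Dv D2); exact: etrans E (etrans Ef (esym E')).
Qed.

Section Quotient.
Context (X : choiceType).
Local Notation cls := (@tcls k (unit + unit)%type 3 rel X).
Local Notation mul := (@tmul k (unit + unit)%type 3 rel X).

Lemma cls_law1 a b c : cls (Node (inl tt) (Node (inr tt) a b) c) =
  oapp (teval mul (fun i => cls (tri a b c i))) 0 (law_rhs1 lab).
Proof.
have [D1 _] := Dlab; rewrite (cls_rule1 a b c D1).
by have [E _] := aeval_rhs mul (fun i => cls (tri a b c i)).
Qed.

Lemma cls_law2 a b c : cls (Node (inl tt) a (Node (inr tt) b c)) =
  oapp (teval mul (fun i => cls (tri a b c i))) 0 (law_rhs2 lab).
Proof.
have [_ D2] := Dlab; rewrite (cls_rule2 a b c D2).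
by have [_ E] := aeval_rhs mul (fun i => cls (tri a b c i)).
Qed.

End Quotient.
End MonomialLaws.

(** * Normal forms span *)

Section LawAlgebra.
Context (k : fieldType) (lab : option truncated_label) (X : choiceType).
Context (V : lmodType k) (mul : unit + unit -> V -> V -> V).
Context (cls : tree (unit + unit) X -> V).
Local Notation sg := (law_side lab).
Local Notation sl := (law_slot lab).

Hypothesis mulB : bilinear_op mul.
Hypothesis clsN : forall g s t, cls (Node g s t) = mul g (cls s) (cls t).
Hypothesis cls_cat : forall v w, cls (Node (inl tt) (emb (Leaf v)) (emb (Leaf w))) =
  cls (emb (Leaf (wcat v w))).
Hypothesis law1 : forall a b c, cls (Node (inl tt) (Node (inr tt) a b) c) =
  oapp (teval mul (fun i => cls (tri a b c i))) 0 (law_rhs1 lab).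
Hypothesis law2 : forall a b c, cls (Node (inl tt) a (Node (inr tt) b c)) =
  oapp (teval mul (fun i => cls (tri a b c i))) 0 (law_rhs2 lab).

(** Each use of the rule passes the word to the factor on one side of [∘]; at the extreme leaf on
    that side it is concatenated. *)
Lemma cls_attach b v t : sl = Some b ->
  (if sg then cls (Node (inl tt) (emb (Leaf v)) (emb t))
   else cls (Node (inl tt) (emb t) (emb (Leaf v)))) = cls (emb (attach sg b v t)).
Proof.
move=> slb; elim: t => [w|[] l IHl r IHr].
  by rewrite -[attach _ _ _ _]/(Leaf (if sg then wcat v w else wcat w v));
    case: (sg); apply: cls_cat.
have Enode : emb (Node tt l r) = Node (inr tt) (emb l) (emb r) by [].
have L1 := law1 (emb l) (emb r) (emb (Leaf v)).
have L2 := law2 (emb (Leaf v)) (emb l) (emb r).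
rewrite -!Enode in L1 L2.
move: slb IHl IHr L1 L2; case: (lab) => [[]|] //= -[<-] IHl IHr L1 L2.
- by rewrite L2 /tri /= -!clsN clsN IHl -clsN.
- by rewrite L1 /tri /= -!clsN clsN IHr -clsN.
- by rewrite L2 /tri /= -!clsN clsN IHr -clsN.
- by rewrite L1 /tri /= -!clsN clsN IHl -clsN.
Qed.

Lemma cls_wmul s t : cls (Node (inl tt) (emb s) (emb t)) =
  oapp (fun u => cls (emb u)) 0 (wmul sg sl s t).
Proof.
have L1 l r := law1 (emb l) (emb r) (emb t).
have L2 l r := law2 (emb s) (emb l) (emb r).
have A b v u := @cls_attach b v u.
move: L1 L2 A; rewrite /wmul /act; case: (lab) => [[]|] /= L1 L2 A;
  case: s L2 => [v|[] l r] L2; case: t L1 => [w|[] l' r'] L1 //=;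
  by [apply: cls_cat|apply: L1|apply: L2|apply: (A _ v (Node tt l' r') erefl)|apply: (A _ w (Node tt l r) erefl)].
Qed.

Definition collect (a : {malg k[wtree X]}) : V := linext (fun s => cls (emb s)) a.

Lemma collect_linear : linear collect.
Proof. exact: linext_linear. Qed.

Lemma collectU s : collect << s >> = cls (emb s).
Proof. exact: linextU. Qed.

(** The rules force the products of normal forms ([cls_wmul]), so [collect] is a morphism of
    algebras from the model. As it is compatible with the letters, it sends the normal form of a
    tree to the class of the tree. *)
Lemma collect_op g a b : collect (@model_op k sg sl X g a b) = mul g (collect a) (collect b).
Proof.
have [ml mr] := mulB; have [bl br] := @model_bilinear k sg sl X.
move: a; apply: linear_malgP => [c x y|c x y|s].
- by rewrite bl collect_linear.
- by rewrite collect_linear ml.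
move: b; apply: linear_malgP => [c x y|c x y|t].
- by rewrite br collect_linear.
- by rewrite collect_linear mr.
rewrite [X in collect X]linext2U !collectU -clsN.
case: g => -[]; last exact: collectU.
rewrite cls_wmul /model_base; case: wmul => [u|]; first exact: collectU.
exact: (linear_map0 collect_linear).
Qed.

Lemma collect_teval t : collect (teval (@model_op k sg sl X) (@model_gen k X) t) = cls t.
Proof. by elim: t => [i|g l IHl r IHr] /=; [exact: collectU|rewrite collect_op IHl IHr clsN]. Qed.

End LawAlgebra.

Section NormalForms.
Context (k : fieldType) (lab : option truncated_label) (D : AssMag_law k).
Hypothesis Dlab : monomial_law lab D.
Local Notation F := (free_operad k (unit + unit)%type).
Local Notation sg := (law_side lab).
Local Notation sl := (law_slot lab).
Local Notation rel := (combined_rel (@Ass_rel k) (@Mag_rel k) D).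
Local Notation nf := (aeval (@model_op k sg sl _) (@model_gen k _)).

Lemma mlinear_emb (I : finType) (t : wtree I) :
  perm_eq (leaves (emb t)) (enum I) -> mlinear (emb t).
Proof. by []. Qed.

Definition nf_elt (I : finType) (x : F I) : {malg k[wtree I]} := nf (free_val x).

Lemma supported_nf (I : finType) (x : F I) :
  supported (fun u => perm_eq (leaves (emb u)) (enum I)) (nf_elt x).
Proof.
apply: (supported_linext (free_valP x)) => t mt.
apply: sub_supported (supported_model k sg sl t) => u ut.
exact: perm_trans ut mt.
Qed.

Lemma tpi_nf (X : choiceType) (a : {malg k[tree (unit + unit) X]}) :
  tpi rel a = linext (fun u => tpi rel << emb u >>) (nf a).
Proof.
have [mB lN] : bilinear_op (@tmul k _ 3 rel X) /\ linear (@tpi k _ 3 rel X).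
  by split; [apply: tmul_bilinear|apply: tpi_linear].
pose cls := @tcls k (unit + unit)%type 3 rel X.
have E : (fun u : wtree X => tpi rel << emb u >>) = fun u => cls (emb u).
  by apply: functional_extensionality_dep => u; rewrite /cls tclsE.
rewrite E; move: a; apply: linear_malgP => [//|c x y|t].
  by rewrite aeval_linear linext_linear.
rewrite aevalU -tclsE; symmetry; apply: (@collect_teval k lab X _ (@tmul k _ 3 rel X)).
- exact: mB.
- exact: tcls_node.
- exact: cls_comb_cat.
- exact: cls_law1.
- exact: cls_law2.
Qed.

Lemma nf_elt_linear (I : finType) : linear (@nf_elt I).
Proof. by move=> c x y; rewrite /nf_elt free_val_linear aeval_linear. Qed.

Lemma nf_elt_ideal (I : finType) (x y : F I) : qpi rel x = qpi rel y -> nf_elt x = nf_elt y.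
Proof.
move/qpi_eq => /(model_eval Dlab)/(_ (@model_gen k I)) E.
apply/eqP; rewrite -subr_eq0 -(lin_sub _ _ (@nf_elt_linear I)); apply/eqP; exact: E.
Qed.

Lemma nf_elt_emb (I : finType) (t : wtree I) :
  mlinear (emb t) -> nf_elt (monomial k (emb t)) = << t >>.
Proof. by move=> mt; rewrite /nf_elt val_monomial // aevalU teval_emb. Qed.

(** In the free algebra on [I] this is [tpi_nf]; since both sides are multilinear, [tideal_ideal]
    transfers it to the operad. *)
Lemma qpi_nf (I : finType) (x : F I) :
  qpi rel x = \sum_(u <- msupp (nf_elt x)) (nf_elt x)@_u *: qpi rel (monomial k (emb u)).
Proof.
have lq := @qpi_linear k F 3 rel I; have lf := @free_val_linear k (unit + unit)%type I.
have -> : \sum_(u <- msupp (nf_elt x)) (nf_elt x)@_u *: qpi rel (monomial k (emb u)) =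
    qpi rel (\sum_(u <- msupp (nf_elt x)) (nf_elt x)@_u *: (monomial k (emb u) : F I)).
  by rewrite (linear_map_sum lq); apply: eq_bigr => u _; rewrite (linear_mapZ lq).
apply/qpi_eq; apply: tideal_ideal; rewrite (lin_sub _ _ lf); apply/tpi_eq; rewrite tpi_nf -/(nf_elt x) linextE.
rewrite (linear_map_sum lf) (linear_map_sum (@tpi_linear k _ 3 rel I)).
apply: eq_big_seq => u ux; rewrite (linear_mapZ lf) (linear_mapZ (@tpi_linear k _ 3 rel I)).
rewrite val_monomial //; apply: mlinear_emb.
by have /allP := supported_nf x; apply.
Qed.

End NormalForms.

(** * Words, their letters, and combs in the associative operad *)

Definition wmap (X Y : Type) (f : X -> Y) (w : X * seq X) : Y * seq Y := (f w.1, map f w.2).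

Lemma wletters_map (X Y : Type) (f : X -> Y) w : wletters (wmap f w) = map f (wletters w).
Proof. by []. Qed.

Lemma wmap_inj (X Y : Type) (f : X -> Y) : injective f -> injective (wmap f).
Proof. by move=> fI [i s] [j t] [/fI -> /(inj_map fI) ->]. Qed.

Lemma lmap_comb (G X Y : Type) (f : X -> Y) (g : G) w :
  lmap f (comb g w.1 w.2) = comb g (wmap f w).1 (wmap f w).2.
Proof. by case: w => i s /=; elim: s i => //= j s IHs i; rewrite IHs. Qed.

Lemma lift_word (X : Type) (p : pred X) (w : X * seq X) : all p (wletters w) ->
  exists w' : {i | p i} * seq {i | p i}, wmap val w' = w.
Proof.
case: w => i s /andP[/= pi ps]; have {}ps : all p s by [].
suff [s' <-] : exists s' : seq {i | p i}, map val s' = s by exists (exist _ i pi, s').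
move: pi => _; elim: s ps => [|j s IHs] /=; first by exists [::].
by case/andP=> pj /IHs[s' <-]; exists (exist _ j pj :: s').
Qed.

(** The first equation is a way of saying that [t] and [u] have the same shape and nodes; the leaves
    can then be compared in order. *)
Lemma same_shape (G X Z : Type) (Y : eqType) (a : X -> Z) (b : Y -> Z) (s : X -> Y)
    (t : tree G X) (u : tree G Y) :
  lmap a t = lmap b u -> map s (leaves t) = leaves u -> lmap s t = u.
Proof.
elim: t u => [i|g l IHl r IHr] [j|h l' r'] //=; first by move=> _ [->].
move=> [-> El Er]; have sz : size (map s (leaves l)) = size (leaves l').
  by rewrite size_map -(size_map a) -leaves_lmap El leaves_lmap size_map.
rewrite map_cat => /eqP; rewrite eqseq_cat // => /andP[/eqP hl /eqP hr].
by rewrite (IHl l') // (IHr r').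
Qed.

Section WordUniq.
Context (X : eqType).

Lemma uniq_words (ws : seq (X * seq X)) : uniq (flatten (map wletters ws)) -> uniq ws.
Proof.
elim: ws => [//|w ws IHws].
rewrite -[flatten _]/(wletters w ++ flatten (map wletters ws)) cat_uniq => /and3P[_ /hasPn nw /IHws uws].
rewrite cons_uniq uws andbT; apply/negP => wws.
have w1 : w.1 \in flatten (map wletters ws).
  by apply/flatten_mapP; exists w; rewrite // inE eqxx.
by have := nw _ w1; rewrite inE eqxx.
Qed.

Lemma word_inj (ws : seq (X * seq X)) v w i : uniq (flatten (map wletters ws)) ->
  v \in ws -> w \in ws -> i \in wletters v -> i \in wletters w -> v = w.
Proof.
elim: ws => [//|u ws IHws].
rewrite -[flatten _]/(wletters u ++ flatten (map wletters ws)) cat_uniq => /and3P[_ /hasPn nu /IHws H].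
have off t : t \in ws -> i \in wletters t -> i \in wletters u -> False.
  move=> tws it; apply/negP; apply: nu.
  by apply/flatten_mapP; exists t.
rewrite !inE => /orP[/eqP->|vws] /orP[/eqP->|wws] iv iw //; last exact: H.
  by case: (off w).
by case: (off v).
Qed.

Lemma uniq_word (ws : seq (X * seq X)) v : uniq (flatten (map wletters ws)) ->
  v \in ws -> uniq (wletters v).
Proof.
elim: ws => [//|u ws IHws].
rewrite -[flatten _]/(wletters u ++ flatten (map wletters ws)) cat_uniq inE.
by case/and3P=> uu _ /IHws H /orP[/eqP->|].
Qed.

End WordUniq.

Section AssNormalForm.
Context (k : fieldType).
Local Notation rel := (@Ass_rel k).

(** The comb carries the leaves of [t] in the same order. The rebracketing is done in the free
    associative algebra on [K] and transferred by [tideal_ideal]. *)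
Lemma qpi_Ass_comb (K : finType) (t : tree unit K) : mlinear t ->
  exists2 w : K * seq K, perm_eq (wletters w) (enum K) &
    qpi rel (monomial k t) = qpi rel (monomial k (comb tt w.1 w.2)).
Proof.
move=> mt; pose cls := @tcls k unit 3 rel K.
have mulE : forall g s u, cls (Node g s u) = tmul g (cls s) (cls u) by exact: tcls_node.
have assoc a b c : cls (Node tt (Node tt a b) c) = cls (Node tt a (Node tt b c)).
  have /aeval_sub0 E := @tpi_rel k unit 3 rel K _ (tri a b c) erefl.
  have [E1 E2] := aeval_base (@tmul k unit 3 rel K) (fun i => cls (tri a b c i)) tt tt.
  by rewrite !mulE; exact: etrans (esym E1) (etrans E E2).
have cat v w : cls (Node tt (comb tt v.1 v.2) (comb tt w.1 w.2)) =
    cls (comb tt (wcat v w).1 (wcat v w).2).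
  case: v => i s; elim: s i => [//|j s IHs] i.
  rewrite -[comb tt (i, j :: s).1 _]/(Node tt (Leaf i) (comb tt (j, s).1 (j, s).2)).
  by rewrite assoc mulE IHs -mulE.
have [w [Ew Ec]] : exists w, wletters w = leaves t /\ cls t = cls (comb tt w.1 w.2).
  elim: {mt} t => [i|[] l [v [Ev El]] r [w [Ew Er]]]; first by exists (i, [::]).
  exists (wcat v w); split; first by rewrite -[leaves _]/(leaves l ++ leaves r) -Ev -Ew.
  by rewrite -(cat v w) !mulE El Er.
exists w; first by rewrite Ew.
have mc : mlinear (comb tt w.1 w.2).
  by rewrite /mlinear leaves_comb -[_ :: _]/(wletters w) Ew.
apply/qpi_eq; apply: tideal_ideal; rewrite (lin_sub _ _ (@free_val_linear k unit K)).
by apply/tpi_eq; rewrite (val_monomial k mt) (val_monomial k mc) -!tclsE.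
Qed.

End AssNormalForm.

Lemma map_nth_index (T : eqType) (a b : seq T) : uniq a -> size a = size b ->
  map (fun x => nth x b (index x a)) a = b.
Proof.
case: b => [|y b] ua sab; first by case: a ua sab.
apply: (@eq_from_nth _ y) => [|i]; rewrite size_map // => ia.
rewrite (nth_map y) // index_uniq //; apply: set_nth_default.
by rewrite -sab.
Qed.

(** * A basis of the composite *)

Section CompositeBasis.
Context (k : fieldType) (I : finType).
Local Notation Q2 := (quot_operad (@Mag_rel k)).
Local Notation Q1 := (quot_operad (@Ass_rel k)).
Local Notation crel := (@comp_rel k Q2 Q1 I).
Local Notation PQ := (composite Q2 Q1 I).

Section Data.
Context (l : nat) (f : I -> 'I_l) (m : tree unit 'I_l).
Context (w : forall s : 'I_l, {i : I | f i == s} * seq {i : I | f i == s}).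

Definition basis_elt : PQ :=
  quot_pi crel (@cg k Q2 Q1 I l f (qpi (@Mag_rel k) (monomial k m))
                   (fun s => qpi (@Ass_rel k) (monomial k (comb tt (w s).1 (w s).2)))).

Definition skeleton : wtree I := lmap (fun s => wmap val (w s)) m.

Definition data_ok : Prop :=
  mlinear m /\ forall s, perm_eq (wletters (w s)) (enum {: {i : I | f i == s}}).

End Data.

(** A relation and not a function, because the numbering of the blocks by ['I_l] is a choice; by
    [represents_inj] the class in the composite does not depend on it. *)
Variant represents (t : wtree I) : PQ -> Prop :=
| Represents l (f : I -> 'I_l) m w :
    data_ok m w -> t = skeleton m w -> represents t (basis_elt (f := f) m w).

Lemma represents_inj t q q' : represents t q -> represents t q' -> q = q'.
Proof.
case=> l f m w [mm pw] ->; case=> l' f' m' w' [mm' pw'] E.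
have ll' : l = l'.
  have := congr1 (fun t => size (leaves t)) E.
  by rewrite !leaves_lmap !size_map (perm_size mm) (perm_size mm') !size_enum_ord.
case: l' / ll' f' m' w' mm' pw' E => f' m' w' mm' pw' E.
have szm : size (leaves m) = size (leaves m') by rewrite (perm_size mm) (perm_size mm').
have [um um'] : uniq (leaves m) /\ uniq (leaves m').
  by rewrite (perm_uniq mm) (perm_uniq mm') enum_uniq.
have inm x : x \in leaves m by rewrite (perm_mem mm) mem_enum.
(* The renumbering of the blocks that matches the leaves of the two magmatic trees in order. *)
pose s0 x := nth x (leaves m') (index x (leaves m)).
have ltm x : (index x (leaves m) < size (leaves m'))%N by rewrite -szm index_mem inm.
have s0I : injective s0.
  move=> x y /eqP; rewrite /s0 (set_nth_default x y) // nth_uniq // => /eqP ixy.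
  by rewrite -(nth_index x (inm x)) ixy nth_index.
pose s := perm s0I.
have sm : map s (leaves m) = leaves m'.
  by rewrite -[RHS](map_nth_index um szm); apply: eq_map => x; rewrite permE.
have Em' : lmap s m = m' := same_shape E sm.
have aw x : wmap val (w x) = wmap val (w' (s x)).
  have : map (fun x => wmap val (w x)) (leaves m) = map (fun x => wmap val (w' (s x))) (leaves m).
    by rewrite -leaves_lmap -[LHS]/(leaves (skeleton m w)) E leaves_lmap -sm -map_comp.
  by move/eq_in_map; apply.
(* The letter [i] occurs in the word of its block for [f], which equals the word of block [s (f i)]
   for [f']; so the words determine the partition of [I]. *)
have Ef i : f' i = s (f i).
  pose j : {i0 : I | f i0 == f i} := exist _ i (eqxx _).
  have : i \in wletters (wmap val (w' (s (f i)))).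
    rewrite -aw wletters_map; apply/mapP; exists j => //.
    by rewrite (perm_mem (pw _)) mem_enum.
  by rewrite wletters_map => /mapP[[i' /= /eqP fi'] _ ii']; rewrite {1}ii'.
have Ef2 : f' = fun i => s (f i) by apply: functional_extensionality_dep => i; rewrite Ef.
move: f' Ef2 w' pw' aw E {Ef} => _ -> w' pw' aw E; rewrite -Em'.
have bs := perm_bij s; rewrite /basis_elt.
have := @relabel_monomial k unit _ _ s m bs mm => <-.
have [_ qr _ _] := @qpi_hom k (free_operad k unit) 3 (@Mag_rel k).
have [_ qr1 _ _] := @qpi_hom k (free_operad k unit) 3 (@Ass_rel k).
rewrite (qr _ _ _ _ bs); symmetry; apply/quot_pi_eq; apply: sub_span.
pose nu' x := qpi (@Ass_rel k) (monomial k (comb tt (w' x).1 (w' x).2)).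
suff Enu : (fun x => @relabel k Q1 _ _ (@fiber_perm I l f s x) (nu' (s x))) =
    (fun x => qpi (@Ass_rel k) (monomial k (comb tt (w x).1 (w x).2))).
  have := @comp_equiv k Q2 Q1 I l f s (qpi (@Mag_rel k) (monomial k m)) nu'.
  by congr (crel (_ - _)); congr (@cg k Q2 Q1 I l f _ _).
apply: functional_extensionality_dep => x.
have bx : bijective (@fiber_perm I l f s x) by exact: fiber_perm_bij.
have mc : mlinear (comb tt (w' (s x)).1 (w' (s x)).2).
  by rewrite /mlinear leaves_comb; apply: pw'.
have Ew : wmap (@fiber_perm I l f s x) (w' (s x)) = w x.
  by apply: (wmap_inj val_inj); rewrite aw /wmap /= -map_comp.
apply: etrans (esym (qr1 _ _ _ _ bx)) _; apply: congr1.
by apply: etrans (relabel_monomial k bx mc) _; rewrite lmap_comb Ew.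
Qed.

(** The words of [t] are the blocks, and [f] sends a letter to the word containing it, unique
    because no letter repeats. *)
Lemma represents_ex (t : wtree I) :
  perm_eq (leaves (emb t)) (enum I) -> exists q, represents t q.
Proof.
rewrite leaves_emb => pt.
have ut : uniq (flatten (map wletters (leaves t))) by rewrite (perm_uniq pt) enum_uniq.
have [m0 [Em0 mm0]] := lift_leaves (uniq_words ut).
pose K : finType := seq_sub (leaves t); pose l := #|K|.
have ex i : exists x : K, i \in wletters (val x).
  have : i \in flatten (map wletters (leaves t)) by rewrite (perm_mem pt) mem_enum.
  by case/flatten_mapP=> v vt iv; exists (SeqSub vt).
pose f i : 'I_l := enum_rank (xchoose (ex i)).
have fP i (s : 'I_l) : (f i == s) = (i \in wletters (val (enum_val s : K))).
  apply/eqP/idP => [<-|iv]; first by rewrite /f enum_rankK; apply: (xchooseP (ex i)).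
  apply: enum_val_inj; rewrite /f enum_rankK; apply: val_inj.
  apply: (word_inj ut) iv; [exact: valP|exact: valP|exact: (xchooseP (ex i))].
have lw (s : 'I_l) : exists w : {i : I | f i == s} * seq {i : I | f i == s},
    wmap val w = val (enum_val s : K).
  by apply: lift_word; apply/allP => i; rewrite fP.
pose w s := projT1 (cid (lw s)); have Ew s : wmap val (w s) = _ := projT2 (cid (lw s)).
pose m : tree unit 'I_l := lmap enum_rank m0.
exists (basis_elt (f := f) m w); constructor.
  split=> [|s].
    by apply: mlinear_lmap => //; exists enum_val; [exact: enum_rankK|exact: enum_valK].
  have uw : uniq (wletters (w s)).
    have : uniq (wletters (val (enum_val s : K))) := uniq_word ut (valP _).
    by rewrite -Ew wletters_map => /map_uniq.
  apply: uniq_perm => //; first exact: enum_uniq.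
  move=> i; rewrite mem_enum; have : val i \in wletters (val (enum_val s : K)).
    by rewrite -fP; exact: (valP i).
  by rewrite -Ew wletters_map => /mapP[j jw /val_inj ->].
rewrite /skeleton /m lmap_comp -[LHS]Em0; apply: eq_lmap => x.
by rewrite [RHS]/= Ew enum_rankK.
Qed.

Lemma leaves_skeleton l (f : I -> 'I_l) m w : data_ok (f := f) m w ->
  mlinear (emb (skeleton m w)).
Proof.
case=> mm pw; rewrite /mlinear leaves_emb leaves_lmap -map_comp.
apply: (perm_trans (perm_flatten (perm_map _ mm))).
have E : [seq (wletters \o (fun s => wmap val (w s))) s | s <- enum 'I_l] =
         [seq map val (wletters (w s)) | s <- enum 'I_l] by apply: eq_map.
rewrite {}E; apply: uniq_perm; last first.
- move=> i; rewrite mem_enum; apply/flatten_mapP; exists (f i); first by rewrite mem_enum.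
  apply/mapP; exists (exist _ i (eqxx _) : {i0 : I | f i0 == f i}) => //.
  by rewrite (perm_mem (pw _)) mem_enum.
- exact: enum_uniq.
have := enum_uniq 'I_l; elim: (enum 'I_l) => [//|s e IHe]; rewrite cons_uniq => /andP[se /IHe ue].
rewrite -[flatten _]/(map val (wletters (w s)) ++
  flatten [seq map val (wletters (w s')) | s' <- e]).
rewrite cat_uniq ue andbT map_inj_uniq; last exact: val_inj.
rewrite (perm_uniq (pw s)) enum_uniq andTb.
apply/hasPn => i /flatten_mapP[s' s'e] /mapP[[i' /= /eqP fi'] _ Ei'].
apply/negP => iw; have /mapP[[i'' /= /eqP fi''] _ Ei] : i \in map val (wletters (w s)) by [].
by move/negP: se; apply; rewrite -fi'' -Ei Ei' fi'.
Qed.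

End CompositeBasis.

Lemma quot_pi_ex (k : fieldType) (V : lmodType k) (W : V -> Prop) (q : quot W) :
  exists x, q = quot_pi W x.
Proof. by exists (repr q); rewrite quot_piK. Qed.

Section CompositeSpan.
Context (k : fieldType) (I : finType).
Local Notation Q2 := (quot_operad (@Mag_rel k)).
Local Notation Q1 := (quot_operad (@Ass_rel k)).
Local Notation crel := (@comp_rel k Q2 Q1 I).
Local Notation PQ := (composite Q2 Q1 I).

Lemma cg_linearl l (f : I -> 'I_l) nu :
  linear (fun mu => quot_pi crel (@cg k Q2 Q1 I l f mu nu)).
Proof.
move=> c x y; apply: etrans _ (quot_pi_linear crel c (cg x nu) (cg y nu)).
apply/quot_pi_eq; apply: sub_span; exact: (@comp_linearl k Q2 Q1 I l f c x y nu).
Qed.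

Lemma cg_linearr l (f : I -> 'I_l) mu (nu : forall s, Q1 {i : I | f i == s}) s :
  linear (fun x => quot_pi crel (@cg k Q2 Q1 I l f mu (dfwith nu (x : Q1 {i : I | f i == s})))).
Proof.
move=> c x y.
apply: etrans _ (quot_pi_linear crel c (cg mu (dfwith nu x)) (cg mu (dfwith nu y))).
apply/quot_pi_eq; apply: sub_span; exact: (@comp_linearr k Q2 Q1 I l f c mu nu s x y).
Qed.

Lemma submod_preim2 (U V W : lmodType k) (f : U -> V) (g : V -> W) (Z : W -> Prop) :
  linear f -> linear g -> submod_pred Z -> submod_pred (fun x => Z (g (f x))).
Proof. by move=> lf lg sZ; apply: (submod_preim lf (Z := fun y => Z (g y))); apply: submod_preim sZ. Qed.

(** Linearity in the root and in each branch reduces to monomials, and associativity reduces the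
    branches to combs. *)
Lemma composite_ind (Z : PQ -> Prop) : submod_pred Z ->
  (forall t q, represents t q -> Z q) -> forall q, Z q.
Proof.
move=> sZ ZB q; have [x ->] := quot_pi_ex q; move: x; apply: malg_ind.
  by apply: submod_preim sZ; apply: quot_pi_linear.
case=> l f mu nu; rewrite -[mkmalgU _ _]/(@cg k Q2 Q1 I l f mu nu).
have [x ->] := qpi_ex mu; move: x nu => x.
suff H nu : Z (quot_pi crel (@cg k Q2 Q1 I l f (qpi (@Mag_rel k) x) nu)) by [].
move: x; apply: free_ind => [|m mm].
  exact: (submod_preim2 (@qpi_linear k _ 3 (@Mag_rel k) _) (cg_linearl nu) sZ).
(* The list [e] holds the branches not yet reduced to combs. *)
suff: forall (e : seq 'I_l) nu, (forall s, s \notin e ->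
    exists2 w : {i | f i == s} * seq {i | f i == s}, perm_eq (wletters w) (enum {: {i | f i == s}}) &
      nu s = qpi (@Ass_rel k) (monomial k (comb tt w.1 w.2))) ->
    Z (quot_pi crel (@cg k Q2 Q1 I l f (qpi (@Mag_rel k) (monomial k m)) nu)).
  by move/(_ (enum 'I_l) nu); apply=> s; rewrite mem_enum.
elim=> [|s e IHe] {}nu nuP.
  pose w s := s2val (cid2 (nuP s isT)).
  have -> : nu = fun s => qpi (@Ass_rel k) (monomial k (comb tt (w s).1 (w s).2)).
    apply: functional_extensionality_dep => s; exact: (s2valP' (cid2 (nuP s isT))).
  apply: (ZB (skeleton m w)); constructor=> //; split=> // s.
  exact: (s2valP (cid2 (nuP s isT))).
have Enu : nu = dfwith nu (nu s).
  by apply: functional_extensionality_dep => t; case: dfwithP.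
rewrite Enu; have [y ->] := qpi_ex (nu s); move: y; apply: free_ind => [|u mu'].
  exact: (submod_preim2 (@qpi_linear k _ 3 (@Ass_rel k) _)
    (@cg_linearr l f (qpi (@Mag_rel k) (monomial k m)) nu s) sZ).
have [w pw Ew] := qpi_Ass_comb k mu'; apply: IHe => t te.
case: dfwithP te => [|t' st] te; first by exists w.
by apply: nuP; rewrite inE negb_or eq_sym st te.
Qed.

End CompositeSpan.

(** * The map from the composite, and its bijectivity for monomial laws *)

Section Bijectivity.
Context (k : fieldType) (D : AssMag_law k) (I : finType).
Local Notation Q2 := (quot_operad (@Mag_rel k)).
Local Notation Q1 := (quot_operad (@Ass_rel k)).
Local Notation PQ := (composite Q2 Q1 I).
Local Notation F := (free_operad k (unit + unit)%type).
Local Notation rel := (combined_rel (@Ass_rel k) (@Mag_rel k) D).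

Definition xi_map : PQ -> combined (@Ass_rel k) (@Mag_rel k) D I :=
  compose_map (@incl2 k unit unit _ _ D) (@incl1 k unit unit _ _ D).

Lemma xi_map_pi x : xi_map (quot_pi _ x) =
  linext (compose_gen (@incl2 k unit unit _ _ D) (@incl1 k unit unit _ _ D)) x.
Proof. by apply: compose_map_pi; [exact: incl2_hom|exact: incl1_hom]. Qed.

Lemma xi_map_linear : linear xi_map.
Proof.
move=> c p q; have [x ->] := quot_pi_ex p; have [y ->] := quot_pi_ex q.
by rewrite -quot_pi_linear !xi_map_pi linext_linear.
Qed.

Lemma tree_map_comb (X : Type) (i : X) s : tree_map inl (comb tt i s) = comb (inl tt : unit + unit) i s.
Proof. by elim: s i => //= j s IHs i; rewrite IHs. Qed.

Lemma incl1_pi (J : finType) (x : free_operad k unit J) :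
  @incl1 k unit unit _ (@Mag_rel k) D J (qpi (@Ass_rel k) x) = qpi rel (free_map inl x).
Proof.
apply: quot_map_pi; first exact: free_map_hom.
by move=> r Rr; apply: ideal_gen_sub; apply: combined_rel1.
Qed.

Lemma incl2_pi (J : finType) (x : free_operad k unit J) :
  @incl2 k unit unit (@Ass_rel k) _ D J (qpi (@Mag_rel k) x) = qpi rel (free_map inr x).
Proof.
apply: quot_map_pi; first exact: free_map_hom.
by move=> r Rr; apply: ideal_gen_sub; apply: combined_rel2.
Qed.

Lemma tsubst_emb (J : Type) (X : choiceType) (w : J -> X * seq X) (m : tree unit J) :
  tsubst (fun s => << comb (inl tt) (w s).1 (w s).2 >>) (tree_map inr m) =
  << emb (lmap w m) >> :> {malg k[tree (unit + unit) X]}.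
Proof. by elim: m => //= -[] l -> r ->; exact: graftU. Qed.

Lemma free_skeleton l (f : I -> 'I_l) m w : data_ok (f := f) m w ->
  relabel (fun u : {s : 'I_l & {i : I | f i == s}} => val (tagged u))
    (ocomp (monomial k (tree_map inr m) : F 'I_l)
       (fun s => monomial k (comb (inl tt) (w s).1 (w s).2) : F {i : I | f i == s})) =
  monomial k (emb (skeleton m w)).
Proof.
move=> ok; have mt := leaves_skeleton ok; have [mm pw] := ok.
have mm' : mlinear (tree_map inr m : tree (unit + unit) 'I_l) by rewrite /mlinear leaves_map.
have mc s : mlinear (comb (inl tt) (w s).1 (w s).2 : tree (unit + unit) _).
  by rewrite /mlinear leaves_comb; apply: pw.
apply: free_val_inj; rewrite (val_relabel _ (fiber_bij f)) (val_monomial k mt) /=.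
rewrite (val_monomial k mm') mrelabel_bind bindU -tsubst_emb.
apply: eq_tsubst => s; rewrite (val_monomial k (mc s)) mrelabel_comp mrelabelE.
by rewrite lmap_comb.
Qed.

(** This description is the same for every [D], which later allows independence to pass from one law
    to another. *)
Lemma xi_basis t q : represents t q -> xi_map q = qpi rel (monomial k (emb t)).
Proof.
case=> l f m w ok ->; rewrite -(free_skeleton ok); have [mm pw] := ok.
rewrite xi_map_pi [LHS]linextU /compose_gen /=.
have mc s : mlinear (comb tt (w s).1 (w s).2) by rewrite /mlinear leaves_comb; apply: pw.
have E2 : @incl2 k unit unit (@Ass_rel k) _ D 'I_l (qpi (@Mag_rel k) (monomial k m)) =
    qpi rel (monomial k (tree_map inr m)).
  apply: etrans (incl2_pi _) _; apply: congr1; exact: free_map_monomial.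
have E1 : (fun s => @incl1 k unit unit _ (@Mag_rel k) D {i | f i == s}
      (qpi (@Ass_rel k) (monomial k (comb tt (w s).1 (w s).2)))) =
    (fun s => qpi rel (monomial k (comb (inl tt) (w s).1 (w s).2))).
  apply: functional_extensionality_dep => s.
  apply: etrans (incl1_pi _) _; apply: congr1.
  by apply: etrans (free_map_monomial k inl (mc s)) _; rewrite tree_map_comb.
have [_ qr _ qc] := @qpi_hom k F 3 rel.
apply: etrans _ (esym (qr _ _ _ _ (fiber_bij f))); apply: congr1.
by apply: etrans _ (esym (qc _ _ _ _)); rewrite -E1 -E2.
Qed.

End Bijectivity.

Section MonomialDistributive.
Context (k : fieldType) (lab : option truncated_label) (D : AssMag_law k).
Hypothesis Dlab : monomial_law lab D.
Local Notation rel := (combined_rel (@Ass_rel k) (@Mag_rel k) D).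
Local Notation Q2 := (quot_operad (@Mag_rel k)).
Local Notation Q1 := (quot_operad (@Ass_rel k)).

Section Inverse.
Context (I : finType).
Local Notation PQ := (composite Q2 Q1 I).

(** The value 0 is junk, taken when [t] represents no element. *)
Definition basis_of (t : wtree I) : PQ :=
  if pselect (exists q, represents t q) is left ex then projT1 (cid ex) else 0.

Lemma basis_ofP t q : represents t q -> basis_of t = q.
Proof.
move=> tq; rewrite /basis_of; case: pselect => [ex|[]]; last by exists q.
exact: represents_inj (projT2 (cid ex)) tq.
Qed.

Definition xi_inv (p : combined (@Ass_rel k) (@Mag_rel k) D I) : PQ :=
  linext basis_of (nf_elt lab (repr (p : quot_space rel I))).

Lemma xi_inv_pi x : xi_inv (qpi rel x) = linext basis_of (nf_elt lab x).
Proof. by congr linext; apply: (nf_elt_ideal Dlab); rewrite qpiK. Qed.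

Lemma xi_inv_linear : linear xi_inv.
Proof.
move=> c p q; have [x ->] := qpi_ex p; have [y ->] := qpi_ex q.
by rewrite -qpi_linear !xi_inv_pi nf_elt_linear linext_linear.
Qed.

Lemma represents_mlinear t q : represents (k := k) (I := I) t q -> mlinear (emb t).
Proof. by case=> l f m w ok ->; apply: leaves_skeleton. Qed.

(** One composite is the identity because a normal form evaluates to itself in the model, the other
    because normal forms span. *)
Lemma xi_map_bij : bijective (@xi_map k D I).
Proof.
have lx := @xi_map_linear k D I; have lg := xi_inv_linear.
exists xi_inv => [|p].
  apply: composite_ind => [|t q tq].
    split=> [|c p q Ep Eq]; first by rewrite (linear_map0 lx) (linear_map0 lg).
    by rewrite lx lg Ep Eq.
  rewrite (xi_basis D tq) xi_inv_pi (nf_elt_emb k lab (represents_mlinear tq)).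
  by rewrite linextU; apply: basis_ofP.
have [x ->] := qpi_ex p; rewrite xi_inv_pi linextE (linear_map_sum lx) (qpi_nf Dlab x).
apply: eq_big_seq => u ux; rewrite (linear_mapZ lx); congr (_ *: _).
have /allP/(_ u ux) pu := supported_nf lab x.
by have [q uq] := represents_ex k pu; rewrite (basis_ofP uq) (xi_basis D uq).
Qed.

End Inverse.

Lemma monomial_distributive : AssMag_distributive D.
Proof. by move=> n _; apply: xi_map_bij. Qed.

End MonomialDistributive.

(** * Independence of normal forms for any law with injective [xi] *)

Section Independence.
Context (k : fieldType).
Local Notation F := (free_operad k (unit + unit)%type).

Lemma zero_law_monomial : monomial_law None (zero_law k unit unit).
Proof.
have [ma mb] := @mlinear_base (unit + unit)%type (inl tt) (inr tt).
have z0 : span_val (0 : F21 k unit unit) = 0.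
  exact: (linear_map0 (@span_val_linear k (F 'I_3) (quad_gen inr inl))).
split.
  have [|w Ew] := @span_val_ex k (F 'I_3) (quad_gen inl inr)
    (monomial k (Node (inl tt) (Node (inr tt) (Leaf 0) (Leaf 1)) (Leaf 2))).
    by apply/F12P; rewrite val_monomial //; apply: supportedU.
  by exists w.
have [|w Ew] := @span_val_ex k (F 'I_3) (quad_gen inl inr)
  (monomial k (Node (inl tt) (Leaf 0) (Node (inr tt) (Leaf 1) (Leaf 2)))).
  by apply/F12P; rewrite val_monomial //; apply: supportedU.
by exists w.
Qed.

Context (D : AssMag_law k) (I : finType).
Local Notation rel := (combined_rel (@Ass_rel k) (@Mag_rel k) D).
Hypothesis xiD : injective (@xi_map k D I).

(* The composite does not depend on the law, so that normal forms are         *)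
(* independent for [D] because they are for the trivial law. *)
Lemma cls_independent (a : {malg k[wtree I]}) :
  supported (fun u => perm_eq (leaves (emb u)) (enum I)) a ->
  linext (fun u => @tcls k _ 3 rel I (emb u)) a = 0 -> a = 0.
Proof.
move=> /allP sa.
pose D0 := zero_law k unit unit; pose rel0 := combined_rel (@Ass_rel k) (@Mag_rel k) D0.
pose x : F I := \sum_(u <- msupp a) a@_u *: (monomial k (emb u) : F I).
have lf := @free_val_linear k (unit + unit)%type I; have lp := @tpi_linear k _ 3 rel I.
have Ex (R : F 'I_3 -> Prop) : qpi R x = \sum_(u <- msupp a) a@_u *: qpi R (monomial k (emb u)).
  rewrite /x (linear_map_sum (@qpi_linear k F 3 R I)).
  by apply: eq_bigr => u _; rewrite (linear_mapZ (@qpi_linear k F 3 R I)).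
have -> : linext (fun u => @tcls k _ 3 rel I (emb u)) a = tpi rel (free_val x).
  rewrite linextE /x (linear_map_sum lf) (linear_map_sum lp).
  apply: eq_big_seq => u /sa pu; rewrite (linear_mapZ lf) (linear_mapZ lp) tclsE.
  by rewrite (val_monomial k (mlinear_emb pu)).
rewrite -(linear_map0 lp) => /tpi_eq; rewrite subr0 => /tideal_ideal Ix.
have qx : qpi rel x = 0.
  by rewrite -(linear_map0 (@qpi_linear k F 3 rel I)); apply/qpi_eq; rewrite subr0.
pose b u := @basis_of k I u.
have Eb (D' : AssMag_law k) u : u \in msupp a -> xi_map D' (b u) =
    qpi (combined_rel (@Ass_rel k) (@Mag_rel k) D') (monomial k (emb u)).
  by move=> /sa/(represents_ex k)[q uq]; rewrite /b (basis_ofP uq) (xi_basis D' uq).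
have sb (D' : AssMag_law k) : xi_map D' (\sum_(u <- msupp a) a@_u *: b u) =
    qpi (combined_rel (@Ass_rel k) (@Mag_rel k) D') x.
  have lx := @xi_map_linear k D' I; rewrite (linear_map_sum lx) Ex.
  by apply: eq_big_seq => u ua; rewrite (linear_mapZ lx) Eb.
(* The combination already vanishes in the composite, by injectivity for [D]; hence so does its
   image for the trivial law, where the model shows independence. *)
have b0 : \sum_(u <- msupp a) a@_u *: b u = 0.
  by apply: xiD; rewrite sb qx (linear_map0 (@xi_map_linear k D I)).
have := sb D0; rewrite b0 (linear_map0 (@xi_map_linear k D0 I)) => /esym q0.
have lq0 := @qpi_linear k F 3 rel0 I.
have := nf_elt_ideal zero_law_monomial (etrans q0 (esym (linear_map0 lq0))).
have ln := @nf_elt_linear k None I.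
rewrite (linear_map0 ln) /x (linear_map_sum ln) => s0.
rewrite [a]malg_sumE -[RHS]s0; apply: eq_big_seq => u /sa pu.
by rewrite (linear_mapZ ln) (nf_elt_emb k None (mlinear_emb pu)).
Qed.

End Independence.

(** * Equations for the coefficients of a distributive law *)

Section TwelveTerms.

(* [(p, q, r, sw)] stands for the term [(p • q) ∘ r], with the arguments of   *)
(* [∘] exchanged if [sw], and the factors of [•] exchanged for right actions; *)
(* [0] is the acting variable. *)
Definition terms : seq (nat * nat * nat * bool) :=
  [:: (0, 1, 2, false); (0, 1, 2, true); (0, 2, 1, false); (0, 2, 1, true);
      (1, 0, 2, false); (1, 0, 2, true); (2, 0, 1, false); (2, 0, 1, true);
      (1, 2, 0, false); (1, 2, 0, true); (2, 1, 0, false); (2, 1, 0, true)]%N.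

Definition term_tree (rev : bool) (X : Type) (a b c : tree (unit + unit) X)
    (tm : nat * nat * nat * bool) : tree (unit + unit) X :=
  let: (p, q, r, sw) := tm in
  let arg i := nth a [:: a; b; c] i in
  let pq := if rev then Node (inl tt) (arg q) (arg p) else Node (inl tt) (arg p) (arg q) in
  if sw then Node (inr tt) (arg r) pq else Node (inr tt) pq (arg r).

Definition base_terms (rev : bool) : seq (tree (unit + unit) 'I_3) :=
  map (if rev then term_tree true (Leaf 2) (Leaf 0) (Leaf 1)
       else term_tree false (Leaf 0) (Leaf 1) (Leaf 2)) terms.

Lemma base_terms_uniq rev : uniq (base_terms rev).
Proof. by case: rev; vm_compute. Qed.

Lemma base_terms_mem rev (t : tree (unit + unit) 'I_3) : mlinear t ->
  quadratic (@is_inr _ _) (@is_inl _ _) t -> t \in base_terms rev.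
Proof.
move=> mt /quadraticP[g [h [a [b [c [gr [hl E]]]]]]].
have {mt E} : uniq (leaves t) /\ (t = Node g (Node h (Leaf a) (Leaf b)) (Leaf c) \/
  t = Node g (Leaf a) (Node h (Leaf b) (Leaf c))) by rewrite (perm_uniq mt) enum_uniq.
case: g gr => // -[] _; case: h hl => // -[] _.
have ord3 (i : 'I_3) : i = 0 \/ i = 1 \/ i = 2.
  by case: i => [[|[|[|i]]] // lti]; [left|right; left|right; right]; apply: val_inj.
case: (ord3 a) => [->|[->|->]]; case: (ord3 b) => [->|[->|->]]; case: (ord3 c) => [->|[->|->]];
 by case=> + [E|E]; rewrite E //= => _; case: rev; vm_compute.
Qed.

End TwelveTerms.

Section Expansion.
Context (k : fieldType) (D : AssMag_law k).
Local Notation F := (free_operad k (unit + unit)%type).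
Local Notation m1 :=
  (monomial k (Node (inl tt) (Node (inr tt) (Leaf 0) (Leaf 1)) (Leaf 2)) : F 'I_3).
Local Notation m2 :=
  (monomial k (Node (inl tt) (Leaf 0) (Node (inr tt) (Leaf 1) (Leaf 2))) : F 'I_3).

Lemma twelve_terms rev (v : F 'I_3) :
  supported (quadratic (@is_inr _ _) (@is_inl _ _) (X := _)) (free_val v) ->
  free_val v = \sum_(t <- base_terms rev) (free_val v)@_t *: << t >>.
Proof.
move=> /allP sv; apply/malgP => u; rewrite raddf_sum /=.
have E t : ((free_val v)@_t *: << t >> : {malg k[tree (unit + unit) 'I_3]})@_u =
    (free_val v)@_t *+ (t == u).
  by rewrite mcoeffZ mcoeffU mulr_natr.
under eq_bigr => t _ do rewrite E.
have [ub|nub] := boolP (u \in base_terms rev).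
  rewrite (bigD1_seq u ub (base_terms_uniq rev)) /= eqxx big1 ?addr0 // => t /negPf ->.
  by rewrite mulr0n.
rewrite big_seq big1 => [|t tb].
  apply: mcoeff_outdom; apply: contra nub => uv; apply: base_terms_mem; last exact: sv.
  by have /allP := free_valP v; apply.
by case: eqP tb nub => [->|_ _ _]; rewrite ?mulr0n // => ->.
Qed.

Definition term_at (i : nat) := nth (0, 0, 0, false)%N terms i.

Lemma base_terms_sum (V : lmodType k) rev (G : tree (unit + unit) 'I_3 -> V) :
  \sum_(t <- base_terms rev) G t =
  \sum_(i <- iota 0 12) G (if rev then term_tree true (Leaf 2) (Leaf 0) (Leaf 1) (term_at i)
    else term_tree false (Leaf 0) (Leaf 1) (Leaf 2) (term_at i)).
Proof.
have -> : base_terms rev = [seq (if rev then term_tree true (Leaf 2) (Leaf 0) (Leaf 1) (term_at i)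
    else term_tree false (Leaf 0) (Leaf 1) (Leaf 2) (term_at i)) | i <- iota 0 12].
  by case: rev.
by rewrite big_map.
Qed.

Lemma rewrites_F21 u v : rewrites D u v ->
  supported (quadratic (@is_inr _ _) (@is_inl _ _) (X := _)) (free_val v).
Proof. by case=> w _ <-; apply/F21P; apply: span_valP. Qed.

(** [c 0] to [c 11] describe x • (y ∘ z), and [c 12] to [c 23] describe (x ∘ y) • z. The latter are
    listed in mirrored form with the acting variable z first, so that both sides will satisfy
    equations of the same shape. *)
Lemma law_coeffs : exists c : nat -> k,
  (exists2 v, rewrites D m2 v & free_val v = \sum_(i <- iota 0 12) c i *:
     << term_tree false (Leaf 0) (Leaf 1) (Leaf 2) (term_at i) >>) /\
  (exists2 v, rewrites D m1 v & free_val v = \sum_(i <- iota 0 12) c (12 + i)%N *: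
     << term_tree true (Leaf 2) (Leaf 0) (Leaf 1) (term_at i) >>).
Proof.
have [ma mb] := @mlinear_base (unit + unit)%type (inl tt) (inr tt).
have [|v1 D1] := @rewrites_ex k unit unit D m1.
  by rewrite val_monomial //; apply: supportedU.
have [|v2 D2] := @rewrites_ex k unit unit D m2.
  by rewrite val_monomial //; apply: supportedU.
have E1 := twelve_terms true (rewrites_F21 D1).
have E2 := twelve_terms false (rewrites_F21 D2).
exists (fun i => if (i < 12)%N
  then (free_val v2)@_(term_tree false (Leaf 0) (Leaf 1) (Leaf 2) (term_at i))
  else (free_val v1)@_(term_tree true (Leaf 2) (Leaf 0) (Leaf 1) (term_at (i - 12)))).
split; [exists v2 => //; rewrite {1}E2|exists v1 => //; rewrite {1}E1]; rewrite base_terms_sum.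
  by apply: eq_big_seq => i; rewrite mem_iota => /andP[_ ->].
by apply: eq_bigr => i _; rewrite ltnNge leq_addr addKn.
Qed.

Context (X : choiceType).
Local Notation rel := (combined_rel (@Ass_rel k) (@Mag_rel k) D).
Local Notation cls := (@tcls k (unit + unit)%type 3 rel X).
Local Notation mul := (@tmul k (unit + unit)%type 3 rel X).

Lemma teval_term (V : lmodType k) (op : unit + unit -> V -> V -> V) (Y Z : Type)
    (f : Y -> V) (g : Z -> V) rev (a b c : tree (unit + unit) Y) (a' b' c' : tree (unit + unit) Z) tm :
  teval op f a = teval op g a' -> teval op f b = teval op g b' ->
  teval op f c = teval op g c' ->
  teval op f (term_tree rev a b c tm) = teval op g (term_tree rev a' b' c' tm).
Proof.
case: tm => [[[p q] r] sw] Ea Eb Ec.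
have E i : teval op f (nth a [:: a; b; c] i) = teval op g (nth a' [:: a'; b'; c'] i).
  by case: i => [|[|[|i]]] //=; rewrite !nth_nil.
by case: rev; case: sw; rewrite /= !E.
Qed.

Lemma cls_teval (t : tree (unit + unit) X) : cls t = teval mul (fun i => cls (Leaf i)) t.
Proof. by elim: t => [//|g l IHl r IHr]; rewrite tcls_node IHl IHr. Qed.

Lemma cls_expand : exists c : nat -> k,
  [/\ exists2 v, rewrites D m2 v & free_val v = \sum_(i <- iota 0 12) c i *:
     << term_tree false (Leaf 0) (Leaf 1) (Leaf 2) (term_at i) >>,
  exists2 v, rewrites D m1 v & free_val v = \sum_(i <- iota 0 12) c (12 + i)%N *:
     << term_tree true (Leaf 2) (Leaf 0) (Leaf 1) (term_at i) >>,
  forall a b d, cls (Node (inl tt) a (Node (inr tt) b d)) =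
    \sum_(i <- iota 0 12) c i *: cls (term_tree false a b d (term_at i)) &
  forall a b d, cls (Node (inl tt) (Node (inr tt) b d) a) =
    \sum_(i <- iota 0 12) c (12 + i)%N *: cls (term_tree true a b d (term_at i))].
Proof.
have [c [[v2 D2 E2] [v1 D1 E1]]] := law_coeffs.
exists c; split; [by exists v2|by exists v1| |] => a b d.
  rewrite (cls_rule2 a b d D2) E2 (linear_map_sum (aeval_linear mul _)).
  apply: eq_bigr => i _; rewrite (linear_mapZ (aeval_linear mul _)); congr (_ *: _).
  rewrite [LHS]aevalU cls_teval.
  by apply: teval_term; rewrite /= -cls_teval.
rewrite (cls_rule1 b d a D1) E1 (linear_map_sum (aeval_linear mul _)).
apply: eq_bigr => i _; rewrite (linear_mapZ (aeval_linear mul _)); congr (_ *: _).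
rewrite [LHS]aevalU cls_teval.
by apply: teval_term; rewrite /= -cls_teval.
Qed.

End Expansion.

(** * Symbolic expansion of products into normal forms *)

Section Formal.
Context (X : choiceType).
Local Notation form := (seq (seq nat * wtree X)).

(* A list of pairs [(m, t)] is a sum of normal forms [t] with coefficients    *)
(* monomials [m] in the structure constants. *)
Fixpoint mulF (n : nat) (pl : bool) (s t : wtree X) : form :=
  if n is n'.+1 then
    let expand rev off a b d :=
      flatten [seq let: (p, q, r, sw) := term_at i in
        let arg j := nth a [:: a; b; d] j in
        [seq (off + i :: pr.1, if sw then Node tt (arg r) pr.2 else Node tt pr.2 (arg r))%N
          | pr <- if rev then mulF n' pl (arg q) (arg p) else mulF n' pl (arg p) (arg q)]
        | i <- iota 0 12] in
    match s, t with
    | Leaf v, Leaf w => [:: ([::], Leaf (wcat v w))]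
    | Leaf _, Node _ l r => expand false 0 s l r
    | Node _ l r, Leaf _ => expand true 12 t l r
    | Node _ l r, Node _ l' r' =>
        if pl then expand false 0 s l' r' else expand true 12 t l r
    end
  else [::].

Definition mulFl n pl u (L : form) : form :=
  flatten [seq [seq (p.1 ++ q.1, q.2) | q <- mulF n pl u p.2] | p <- L].

Definition mulFr n pl (L : form) u : form :=
  flatten [seq [seq (p.1 ++ q.1, q.2) | q <- mulF n pl p.2 u] | p <- L].

Definition wsize (t : wtree X) : nat := size (leaves t).

Lemma wsize_gt0 t : (0 < wsize t)%N.
Proof. by rewrite lt0n leaves_neq0. Qed.

Context (k : fieldType) (c : nat -> k).

Definition monom (m : seq nat) : k := foldr (fun i a => c i * a) 1 m.

Lemma monom_cat m m' : monom (m ++ m') = monom m * monom m'.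
Proof. by elim: m => [|i m IHm] /=; rewrite ?mul1r // IHm mulrA. Qed.

Context (V : lmodType k) (mul : unit + unit -> V -> V -> V).
Context (cls : tree (unit + unit) X -> V).
Hypothesis mulB : bilinear_op mul.
Hypothesis clsN : forall g s t, cls (Node g s t) = mul g (cls s) (cls t).
Hypothesis cls_cat : forall v w, cls (Node (inl tt) (emb (Leaf v)) (emb (Leaf w))) =
  cls (emb (Leaf (wcat v w))).
Hypothesis expandl : forall a b d, cls (Node (inl tt) a (Node (inr tt) b d)) =
  \sum_(i <- iota 0 12) c i *: cls (term_tree false a b d (term_at i)).
Hypothesis expandr : forall a b d, cls (Node (inl tt) (Node (inr tt) b d) a) =
  \sum_(i <- iota 0 12) c (12 + i)%N *: cls (term_tree true a b d (term_at i)).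

Definition interp (L : form) : V := \sum_(p <- L) monom p.1 *: cls (emb p.2).

Lemma interp_flatten (T : eqType) (s : seq T) (G : T -> form) :
  interp (flatten [seq G i | i <- s]) = \sum_(i <- s) interp (G i).
Proof. by rewrite /interp big_flatten big_map. Qed.

(** An expansion leaves a product of two of the three trees, and the third contains at least one
    word; hence the fuel may drop by one. *)
Lemma term_sizes i (a b d : wtree X) n : (wsize a + (wsize b + wsize d) <= n.+1)%N ->
  let: (p, q, _, _) := term_at i in
  (i < 12)%N ->
  (wsize (nth a [:: a; b; d] p) + wsize (nth a [:: a; b; d] q) <= n)%N.
Proof.
move: (wsize_gt0 a) (wsize_gt0 b) (wsize_gt0 d) => a0 b0 d0 H.
by do 12! [case: i => [|i] /=; first lia]; case: (term_at _) => [[[]]].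
Qed.

Lemma mulF_expand n pl rev off (a b d : wtree X) :
  (forall s t, (wsize s + wsize t <= n)%N ->
    cls (Node (inl tt) (emb s) (emb t)) = interp (mulF n pl s t)) ->
  (wsize a + (wsize b + wsize d) <= n.+1)%N ->
  \sum_(i <- iota 0 12) c (off + i)%N *: cls (term_tree rev (emb a) (emb b) (emb d) (term_at i)) =
  interp (flatten [seq let: (p, q, r, sw) := term_at i in
        let arg j := nth a [:: a; b; d] j in
        [seq (off + i :: pr.1, if sw then Node tt (arg r) pr.2 else Node tt pr.2 (arg r))%N
          | pr <- if rev then mulF n pl (arg q) (arg p) else mulF n pl (arg p) (arg q)]
        | i <- iota 0 12]).
Proof.
move=> IH sz; rewrite interp_flatten; apply: eq_big_seq => i; rewrite mem_iota => /andP[_ i12].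
have := term_sizes i sz; case: (term_at i) => [[[p q] r] sw] /(_ i12) szi.
have En j : nth (emb a) [:: emb a; emb b; emb d] j = emb (nth a [:: a; b; d] j).
  by case: j => [|[|[|j]]] //=; rewrite !nth_nil.
have [ml mr] := mulB.
have Em (L : form) u : mul (inr tt) (interp L) (cls (emb u)) =
    \sum_(pr <- L) monom pr.1 *: cls (emb (Node tt pr.2 u)).
  rewrite /interp (linear_map_sum (ml (inr tt) _)); apply: eq_bigr => pr _.
  by rewrite (linear_mapZ (ml (inr tt) _)) -clsN.
have Em' (L : form) u : mul (inr tt) (cls (emb u)) (interp L) =
    \sum_(pr <- L) monom pr.1 *: cls (emb (Node tt u pr.2)).
  rewrite /interp (linear_map_sum (mr (inr tt) _)); apply: eq_bigr => pr _.
  by rewrite (linear_mapZ (mr (inr tt) _)) -clsN.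
rewrite /term_tree !En; set P := nth a _ p; set Q := nth a _ q; set R := nth a _ r.
have szQP : (wsize Q + wsize P <= n)%N by rewrite addnC.
rewrite [RHS]/interp big_map.
have -> : cls (if sw then Node (inr tt) (emb R)
      (if rev then Node (inl tt) (emb Q) (emb P) else Node (inl tt) (emb P) (emb Q))
    else Node (inr tt)
      (if rev then Node (inl tt) (emb Q) (emb P) else Node (inl tt) (emb P) (emb Q)) (emb R)) =
  (if sw then mul (inr tt) (cls (emb R)) (interp (if rev then mulF n pl Q P else mulF n pl P Q))
   else mul (inr tt) (interp (if rev then mulF n pl Q P else mulF n pl P Q)) (cls (emb R))).
  by case: sw; case: rev; rewrite clsN IH.
case: sw; rewrite ?Em ?Em' scaler_sumr; apply: eq_bigr => pr _; by rewrite scalerA.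
Qed.

(** When both factors are magmatic products, either rule applies: [pl] selects the one that
    decomposes the right factor, its negation the one that decomposes the left factor. Both choices
    are sound, and comparing them gives the overlap equations. *)
Lemma mulF_sound n pl s t : (wsize s + wsize t <= n)%N ->
  cls (Node (inl tt) (emb s) (emb t)) = interp (mulF n pl s t).
Proof.
elim: n s t => [|n IHn] s t sz; first by have := wsize_gt0 s; rewrite lt0n; move: sz; rewrite leqn0 addn_eq0 => /andP[->].
have wN (l r : wtree X) g : wsize (Node g l r) = (wsize l + wsize r)%N by rewrite /wsize size_cat.
case: s sz => [v|[] l r]; case: t => [w|[] l' r'] sz.
- by rewrite cls_cat /interp /= big_seq1 scale1r.
- rewrite wN in sz; apply: etrans (expandl _ _ _) _.
  exact: (mulF_expand false 0 IHn sz).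
- rewrite wN addnC in sz; apply: etrans (expandr _ _ _) _.
  exact: (mulF_expand true 12 IHn sz).
- case: pl IHn => IHn.
    rewrite [X in (_ + X)%N]wN in sz; apply: etrans (expandl _ _ _) _.
    exact: (mulF_expand false 0 IHn sz).
  rewrite addnC [X in (_ + X)%N]wN in sz; apply: etrans (expandr _ _ _) _.
  exact: (mulF_expand true 12 IHn sz).
Qed.

Lemma mulFl_sound n pl u (L : form) : all (fun p => wsize u + wsize p.2 <= n)%N L ->
  mul (inl tt) (cls (emb u)) (interp L) = interp (mulFl n pl u L).
Proof.
have [ml mr] := mulB; move=> /allP sL; rewrite /mulFl interp_flatten.
rewrite {1}/interp (linear_map_sum (mr (inl tt) _)).
apply: eq_big_seq => p /sL sp; rewrite (linear_mapZ (mr (inl tt) _)) -clsN (mulF_sound pl sp).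
rewrite /interp big_map scaler_sumr; apply: eq_bigr => q _.
by rewrite monom_cat scalerA.
Qed.

Lemma mulFr_sound n pl (L : form) u : all (fun p => wsize p.2 + wsize u <= n)%N L ->
  mul (inl tt) (interp L) (cls (emb u)) = interp (mulFr n pl L u).
Proof.
have [ml mr] := mulB; move=> /allP sL; rewrite /mulFr interp_flatten.
rewrite {1}/interp (linear_map_sum (ml (inl tt) _)).
apply: eq_big_seq => p /sL sp; rewrite (linear_mapZ (ml (inl tt) _)) -clsN (mulF_sound pl sp).
rewrite /interp big_map scaler_sumr; apply: eq_bigr => q _.
by rewrite monom_cat scalerA.
Qed.

Definition coef (t : wtree X) (L : form) : seq (seq nat) := [seq p.1 | p <- L & p.2 == t].
Definition poly_sum (l : seq (seq nat)) : k := foldr (fun m a => monom m + a) 0 l.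

Lemma poly_sumE t L : poly_sum (coef t L) = \sum_(p <- L) monom p.1 *+ (p.2 == t).
Proof.
rewrite /coef; elim: L => [|p L IHL] /=; first by rewrite big_nil.
by rewrite big_cons -IHL; case: eqP => _ //=; rewrite mulr0n add0r.
Qed.

Lemma interp_linext L : interp L =
  linext (fun u => cls (emb u)) (\sum_(p <- L) monom p.1 *: << p.2 >>).
Proof.
rewrite (linear_map_sum (linext_linear _)); apply: eq_bigr => p _.
by rewrite (linear_mapZ (linext_linear _)) linextU.
Qed.

(** Independence turns an equality of classes into equalities of scalars, one for each normal
    form. *)
Lemma form_coef (P : pred (wtree X)) L L' :
  (forall a, supported P a -> linext (fun u => cls (emb u)) a = 0 -> a = 0) ->
  all (fun p => P p.2) (L ++ L') -> interp L = interp L' ->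
  forall t, poly_sum (coef t L) = poly_sum (coef t L').
Proof.
move=> indep; rewrite all_cat => /andP[/allP PL /allP PL'] E t.
have sP M : (forall p, p \in M -> P p.2) ->
    \sum_(p <- M) monom p.1 *: << p.2 >> \in @supported k unit _ P.
  move=> PM; rewrite big_seq; apply: rpred_sum => p pM; apply: rpredZ.
  by apply: supportedU; apply: PM.
have := E; rewrite !interp_linext => /eqP; rewrite -subr_eq0.
rewrite -(lin_sub _ _ (linext_linear _)) => /eqP /indep.
have -> // : supported P (\sum_(p <- L) monom p.1 *: << p.2 >> -
   \sum_(p <- L') monom p.1 *: << p.2 >>).
  suff : \sum_(p <- L) monom p.1 *: << p.2 >> - \sum_(p <- L') monom p.1 *: << p.2 >>
     \in @supported k unit _ P by [].
  by rewrite rpredB ?sP.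
move=> /(_ isT)/eqP; rewrite subr_eq0 => /eqP/(congr1 (mcoeff t)).
rewrite !raddf_sum /= !poly_sumE => Et.
have Em M : \sum_(p <- M) monom p.1 *+ (p.2 == t) = \sum_(p <- M) (monom p.1 *: << p.2 >>)@_t.
  by apply: eq_bigr => p _; rewrite mcoeffZ mcoeffU mulr_natr.
by rewrite !Em.
Qed.

End Formal.

(** * Products in arity four with two expansions *)

Section Letters.
Local Notation letter i := (@Ordinal 4 i isT).

Definition word4 (s : seq 'I_4) : wtree 'I_4 :=
  Leaf (head (letter 0) s, behead s).

(** A form of multilinearity suited to evaluation by [vm_compute]. *)
Lemma perm_enum4 (u : wtree 'I_4) :
  uniq (leaves (emb u)) && (size (leaves (emb u)) == 4%N) ->
  perm_eq (leaves (emb u)) (enum 'I_4).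
Proof.
case/andP=> uu /eqP su; apply: uniq_perm; rewrite ?enum_uniq // => i.
rewrite mem_enum; have /card_uniqP cu := uu.
by have := @subset_leqif_card 'I_4 (mem (leaves (emb u))) predT (subset_predT _) => -[_];
  rewrite card_ord cu su eqxx => /esym/subsetP/(_ i isT).
Qed.

End Letters.

Notation letter i := (@Ordinal 4 i isT).

(** With letters u, v, y, z in this order, this is u • (v • (y ∘ z)), to be compared with (u • v) •
    (y ∘ z). The fuel 6 is enough, as at most four words are involved. *)
Definition assoc_left_nested := mulFl 6 true (word4 [:: letter 0])
  (mulF 6 true (word4 [:: letter 1]) (Node tt (word4 [:: letter 2]) (word4 [:: letter 3]))).
Definition assoc_left_flat := mulF 6 true (word4 [:: letter 0; letter 1])
  (Node tt (word4 [:: letter 2]) (word4 [:: letter 3])).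
Definition assoc_right_nested := mulFr 6 true
  (mulF 6 true (Node tt (word4 [:: letter 2]) (word4 [:: letter 3])) (word4 [:: letter 1]))
  (word4 [:: letter 0]).
Definition assoc_right_flat := mulF 6 true
  (Node tt (word4 [:: letter 2]) (word4 [:: letter 3])) (word4 [:: letter 1; letter 0]).
Definition overlap (pl : bool) := mulF 6 pl
  (Node tt (word4 [:: letter 0]) (word4 [:: letter 1]))
  (Node tt (word4 [:: letter 2]) (word4 [:: letter 3])).

(* The matrix [a1 a3; a2 a4] is idempotent, and A * swap * A = 0. *)
Definition idempotent_eqs (k : fieldType) (a1 a2 a3 a4 : k) : Prop :=
  [/\ a1 * a1 + a2 * a3 = a1, a1 * a2 + a2 * a4 = a2,
      a3 * a1 + a4 * a3 = a3 & a3 * a2 + a4 * a4 = a4] /\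
  [/\ a1 * a3 + a2 * a1 = 0, a1 * a4 + a2 * a2 = 0,
      a3 * a3 + a4 * a1 = 0 & a3 * a4 + a4 * a2 = 0].

Section Equations.
Context (k : fieldType) (c : nat -> k).
Context (V : lmodType k) (mul : unit + unit -> V -> V -> V).
Context (cls : tree (unit + unit) 'I_4 -> V).
Hypothesis mulB : bilinear_op mul.
Hypothesis clsN : forall g s t, cls (Node g s t) = mul g (cls s) (cls t).
Hypothesis clsA : forall a b d, cls (Node (inl tt) (Node (inl tt) a b) d) =
  cls (Node (inl tt) a (Node (inl tt) b d)).
Hypothesis cls_cat : forall v w, cls (Node (inl tt) (emb (Leaf v)) (emb (Leaf w))) =
  cls (emb (Leaf (wcat v w))).
Hypothesis expandl : forall a b d, cls (Node (inl tt) a (Node (inr tt) b d)) =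
  \sum_(i <- iota 0 12) c i *: cls (term_tree false a b d (term_at i)).
Hypothesis expandr : forall a b d, cls (Node (inl tt) (Node (inr tt) b d) a) =
  \sum_(i <- iota 0 12) c (12 + i)%N *: cls (term_tree true a b d (term_at i)).
Hypothesis indep : forall a : {malg k[wtree 'I_4]},
  supported (fun u => perm_eq (leaves (emb u)) (enum 'I_4)) a ->
  linext (fun u => cls (emb u)) a = 0 -> a = 0.

Lemma law_coef (L L' : seq (seq nat * wtree 'I_4)) :
  all (fun p => uniq (leaves (emb p.2)) && (size (leaves (emb p.2)) == 4%N)) (L ++ L') ->
  interp c cls L = interp c cls L' ->
  forall t, poly_sum c (coef t L) = poly_sum c (coef t L').
Proof.
move=> /allP mL E; apply: (@form_coef _ k c V cls _ L L' indep) => //.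
by apply/allP => p /mL; apply: perm_enum4.
Qed.

Lemma assoc_left_coef t :
  poly_sum c (coef t assoc_left_nested) = poly_sum c (coef t assoc_left_flat).
Proof.
move: t; apply: law_coef; first by vm_compute.
apply: etrans (esym (mulFl_sound mulB clsN cls_cat expandl expandr _ _)) _; first by vm_compute.
apply: etrans (congr1 (mul (inl tt) _) (esym (mulF_sound mulB clsN cls_cat expandl expandr true _))) _ => //.
apply: etrans _ (mulF_sound mulB clsN cls_cat expandl expandr true _) => //.
by rewrite -clsN -clsA clsN cls_cat -clsN.
Qed.

Lemma assoc_right_coef t :
  poly_sum c (coef t assoc_right_nested) = poly_sum c (coef t assoc_right_flat).
Proof.
move: t; apply: law_coef; first by vm_compute.
apply: etrans (esym (mulFr_sound mulB clsN cls_cat expandl expandr _ _)) _; first by vm_compute.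
apply: etrans (congr1 (mul (inl tt) ^~ _) (esym (mulF_sound mulB clsN cls_cat expandl expandr true _))) _ => //.
apply: etrans _ (mulF_sound mulB clsN cls_cat expandl expandr true _) => //.
by rewrite -clsN clsA clsN cls_cat -clsN.
Qed.

Lemma overlap_coef t :
  poly_sum c (coef t (overlap true)) = poly_sum c (coef t (overlap false)).
Proof.
move: t; apply: law_coef; first by vm_compute.
apply: etrans (esym (mulF_sound mulB clsN cls_cat expandl expandr true _)) _ => //.
exact: (mulF_sound mulB clsN cls_cat expandl expandr false).
Qed.

(** Computes the monomials contributing to the chosen normal form on both sides, so that [H] becomes
    a polynomial equation in the [c i]. *)
Local Ltac coef_eq H :=
  let T := type of H in
  lazymatch T with
  | poly_sum _ ?l = poly_sum _ ?l' =>
    let v := eval vm_compute in l in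
    let v' := eval vm_compute in l' in
    let E := fresh in let E' := fresh in
    have E : l = v by [vm_compute];
    have E' : l' = v' by [vm_compute];
    rewrite {}E {}E' /poly_sum /monom /= ?addr0 ?mulr1 in H
  end.

Local Notation W s t := (Node tt (word4 s) (word4 t)).
Local Notation l0 := (letter 0).
Local Notation l1 := (letter 1).
Local Notation l2 := (letter 2).
Local Notation l3 := (letter 3).

(** In u • (v • (y ∘ z)) the letter u never comes between y and v, nor between z and v; the words y
    u v and z u v in (u • v) • (y ∘ z) therefore give the first zeros. The words u v y and u v z
    give idempotence. Trees in which u and v act on different factors are absent from (u • v) • (y ∘
    z), which gives the other four equations. *)
Lemma left_equations : [/\ c 4 = 0, c 5 = 0, c 6 = 0 & c 7 = 0] /\
  idempotent_eqs (c 0) (c 1) (c 2) (c 3).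
Proof.
have b1 := assoc_left_coef (W [:: l2; l0; l1] [:: l3]). coef_eq b1.
have b2 := assoc_left_coef (W [:: l3] [:: l2; l0; l1]). coef_eq b2.
have b3 := assoc_left_coef (W [:: l3; l0; l1] [:: l2]). coef_eq b3.
have b4 := assoc_left_coef (W [:: l2] [:: l3; l0; l1]). coef_eq b4.
have e1 := assoc_left_coef (W [:: l0; l1; l2] [:: l3]). coef_eq e1.
have e2 := assoc_left_coef (W [:: l3] [:: l0; l1; l2]). coef_eq e2.
have e3 := assoc_left_coef (W [:: l0; l1; l3] [:: l2]). coef_eq e3.
have e4 := assoc_left_coef (W [:: l2] [:: l0; l1; l3]). coef_eq e4.
have f1 := assoc_left_coef (W [:: l0; l3] [:: l1; l2]). coef_eq f1.
have f2 := assoc_left_coef (W [:: l1; l2] [:: l0; l3]). coef_eq f2.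
have f3 := assoc_left_coef (W [:: l0; l2] [:: l1; l3]). coef_eq f3.
have f4 := assoc_left_coef (W [:: l1; l3] [:: l0; l2]). coef_eq f4.
by do ![split].
Qed.

Lemma right_equations : [/\ c 16 = 0, c 17 = 0, c 18 = 0 & c 19 = 0] /\
  idempotent_eqs (c 12) (c 13) (c 14) (c 15).
Proof.
have b1 := assoc_right_coef (W [:: l1; l0; l2] [:: l3]). coef_eq b1.
have b2 := assoc_right_coef (W [:: l3] [:: l1; l0; l2]). coef_eq b2.
have b3 := assoc_right_coef (W [:: l1; l0; l3] [:: l2]). coef_eq b3.
have b4 := assoc_right_coef (W [:: l2] [:: l1; l0; l3]). coef_eq b4.
have e1 := assoc_right_coef (W [:: l2; l1; l0] [:: l3]). coef_eq e1.
have e2 := assoc_right_coef (W [:: l3] [:: l2; l1; l0]). coef_eq e2.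
have e3 := assoc_right_coef (W [:: l3; l1; l0] [:: l2]). coef_eq e3.
have e4 := assoc_right_coef (W [:: l2] [:: l3; l1; l0]). coef_eq e4.
have f1 := assoc_right_coef (W [:: l3; l0] [:: l2; l1]). coef_eq f1.
have f2 := assoc_right_coef (W [:: l2; l1] [:: l3; l0]). coef_eq f2.
have f3 := assoc_right_coef (W [:: l2; l0] [:: l3; l1]). coef_eq f3.
have f4 := assoc_right_coef (W [:: l3; l1] [:: l2; l0]). coef_eq f4.
by do ![split].
Qed.

(** The product (u ∘ v) • (y ∘ z) is expanded by either rule first. Terms 8 to 11 multiply the
    arguments of one [∘] and keep the other [∘] intact, a tree that the other expansion never
    produces. In the other terms, one child of the root is a single letter from the factor
    decomposed first, so again the two expansions share no tree, and all coefficients vanish. *)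
Lemma overlap_equations :
  [/\ c 8 = 0, c 9 = 0, c 10 = 0 & c 11 = 0] /\
  [/\ c 20 = 0, c 21 = 0, c 22 = 0 & c 23 = 0] /\
  (forall i j, (i < 4)%N -> (j < 4)%N -> c i * c (12 + j)%N = 0).
Proof.
have [[z4 z5 z6 z7] _] := left_equations.
have [[z16 z17 z18 z19] _] := right_equations.
(* Trees are located by position: terms 0 to 7 give twelve entries each, terms 8 to 11 a single one,
   at positions 96 to 99. *)
pose t pl n := (nth ([::], word4 [::]) (overlap pl) n).2.
have c8 := overlap_coef (t true 96%N). coef_eq c8.
have c9 := overlap_coef (t true 97%N). coef_eq c9.
have c10 := overlap_coef (t true 98%N). coef_eq c10.
have c11 := overlap_coef (t true 99%N). coef_eq c11.
have c20 := overlap_coef (t false 96%N). coef_eq c20.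
have c21 := overlap_coef (t false 97%N). coef_eq c21.
have c22 := overlap_coef (t false 98%N). coef_eq c22.
have c23 := overlap_coef (t false 99%N). coef_eq c23.
split; first by split.
split; first by split.
(* The same tree also arises from terms 4 to 7, where the acting variable is the second factor of
   [•]; their coefficients are already known to vanish. *)
have H i j : c i * c (12 + j)%N + c (4 + i)%N * c (4 + j)%N = 0 -> (i < 4)%N -> c i * c (12 + j)%N = 0.
  move=> + i4; suff -> : c (4 + i)%N = 0 by rewrite mul0r addr0.
  by case: i i4 => [|[|[|[|i]]]].
move=> i j i4 j4; apply: H => //.
case: i i4 => [|[|[|[|//]]]] _; case: j j4 => [|[|[|[|//]]]] _;
  lazymatch goal with |- c ?a * c (12 + ?b)%N + _ = 0 =>
    let E := fresh in have E := overlap_coef (t true (12 * a + b)%N); coef_eq E; exact: E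
  end.
Qed.

End Equations.

(** * Existence of the truncated laws, and exchange of arguments *)

Section BasicIso.
Context (k : fieldType).
Local Notation F := (free_operad k (unit + unit)%type).

Lemma operad_iso_trans (P Q R : operad k) :
  operad_iso P Q -> operad_iso Q R -> operad_iso P R.
Proof.
move=> [f [[fl fr fu fc] fb]] [g [[gl gr gu gc] gb]].
exists (fun I => g I \o f I); split=> [|I]; last exact: bij_comp.
split=> [I c x y|I J h x bh||J K mu nu] /=.
- by rewrite fl gl.
- by rewrite fr ?gr.
- by rewrite fu gu.
- by rewrite fc gc.
Qed.

Lemma tri_perm (a b c : 'I_3) : perm_eq [:: a; b; c] (enum 'I_3) ->
  exists s : 'S_3, (s : 'I_3 -> 'I_3) = tri a b c.
Proof.
move/mlinear_tri=> [s [sa sb sc]]; exists s.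
by apply: functional_extensionality_dep => i; rewrite -(triE s i) sa sb sc.
Qed.

Lemma relabel_tri (a b c : 'I_3) (t : tree (unit + unit) 'I_3) :
  perm_eq [:: a; b; c] (enum 'I_3) -> mlinear t ->
  relabel (tri a b c) (monomial k t : F 'I_3) = monomial k (lmap (tri a b c) t).
Proof. by move=> /tri_perm[s <-] mt; apply: relabel_monomial => //; apply: perm_bij. Qed.

Lemma relabel_tri_linear (a b c : 'I_3) : perm_eq [:: a; b; c] (enum 'I_3) ->
  linear (relabel (tri a b c) : F 'I_3 -> F 'I_3).
Proof. by move=> /tri_perm[s <-]; apply: relabel_linear; apply: perm_bij. Qed.

Lemma rewrites_tri (D : AssMag_law k) (a b c : 'I_3) (u v : F 'I_3) :
  perm_eq [:: a; b; c] (enum 'I_3) -> rewrites D u v ->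
  rewrites D (relabel (tri a b c) u) (relabel (tri a b c) v).
Proof. by move=> /tri_perm[s <-]; apply: rewrites_relabel. Qed.

Lemma rewrites2 (D : AssMag_law k) (p q : k) (u v u' v' : F 'I_3) :
  rewrites D u v -> rewrites D u' v' ->
  rewrites D (p *: u + q *: u') (p *: v + q *: v').
Proof.
move=> Duv Duv'; apply: rewritesZD => //.
by rewrite -[q *: u']addr0 -[q *: v']addr0; apply: rewritesZD => //; apply: rewrites0.
Qed.

Lemma law_exists (r : truncated_label) : exists D : AssMag_law k, truncated r D.
Proof.
pose u (_ _ : unit) := omonomial k (law_rhs1 (Some r)).
pose v (_ _ : unit) := omonomial k (law_rhs2 (Some r)).
have s0 : supported (quadratic (@is_inr unit unit) (@is_inl _ _) (X := _)) (free_val (0 : F 'I_3)).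
  by apply/supportedP => t; rewrite mcoeff0 eqxx.
have uP (_ _ : unit) : supported (quadratic (@is_inr _ _) (@is_inl _ _) (X := _)) (free_val (u tt tt)).
  rewrite /u; case: r {u v} => //=; rewrite val_monomial; try exact: supportedU;
    exact: mlinear_leaves3.
have vP (_ _ : unit) : supported (quadratic (@is_inr _ _) (@is_inl _ _) (X := _)) (free_val (v tt tt)).
  rewrite /v; case: r {u v uP} => //=; rewrite val_monomial; try exact: supportedU;
    exact: mlinear_leaves3.
exists (rule_law uP vP); apply/truncated_monomial; split.
  exact: (rule_law1 uP vP tt tt).
exact: (rule_law2 uP vP tt tt).
Qed.

End BasicIso.

Section Swap.
Context (k : fieldType) (sw : unit + unit -> bool).
Local Notation F := (free_operad k (unit + unit)%type).
Local Notation al := (fun g => (~~ sw g)%:R : k).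
Local Notation be := (fun g => (sw g)%:R : k).

Fixpoint tree_swap (X : Type) (t : tree (unit + unit) X) : tree (unit + unit) X :=
  match t with
  | Leaf i => Leaf i
  | Node g l r => if sw g then Node g (tree_swap r) (tree_swap l)
                  else Node g (tree_swap l) (tree_swap r)
  end.

Lemma mlinear_swap (I : finType) (t : tree (unit + unit) I) : mlinear t -> mlinear (tree_swap t).
Proof.
suff H : perm_eq (leaves (tree_swap t)) (leaves t) by apply: perm_trans.
elim: t => //= g l IHl r IHr; case: (sw g) => /=; last exact: perm_cat.
by rewrite perm_catC perm_cat.
Qed.

Lemma mix_swap (X : choiceType) (t : tree (unit + unit) X) : mix al be << t >> = << tree_swap t >>.
Proof.
elim: t => [i|g l IHl r IHr]; first exact: mix_leaf.
rewrite -graftU mix_graft IHl IHr /mixop /=.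
by case: (sw g); rewrite /= !graftU scale0r scale1r ?add0r ?addr0.
Qed.

Lemma free_mix_swap (I : finType) (t : tree (unit + unit) I) : mlinear t ->
  free_mix al be (monomial k t) = monomial k (tree_swap t).
Proof.
move=> mt; apply: free_val_inj; rewrite /= (val_monomial k mt).
by rewrite (val_monomial k (mlinear_swap mt)); apply: mix_swap.
Qed.

Lemma swap_inv1 g : al g * al g + be g * be g = 1.
Proof. by rewrite /=; case: (sw g); rewrite /= mulr0n mulr1n mulr1 mulr0 ?addr0 ?add0r. Qed.

Lemma swap_inv2 g : al g * be g + be g * al g = 0.
Proof. by rewrite /=; case: (sw g); rewrite /= mulr0n mulr1n ?mulr0 ?mul0r addr0. Qed.

Lemma free_mix_swap_sub (I : finType) (t u : tree (unit + unit) I) :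
  mlinear t -> mlinear u ->
  free_mix al be (monomial k t - monomial k u) =
  monomial k (tree_swap t) - monomial k (tree_swap u).
Proof.
move=> mt mu; have [pl _ _ _] := free_mix_hom al be.
by rewrite (lin_sub _ _ (pl _)) (free_mix_swap mt) (free_mix_swap mu).
Qed.

Lemma relabel_tri_sub (a b c : 'I_3) (t u : tree (unit + unit) 'I_3) :
  perm_eq [:: a; b; c] (enum 'I_3) -> mlinear t -> mlinear u ->
  relabel (tri a b c) (monomial k t - monomial k u : F 'I_3) =
  monomial k (lmap (tri a b c) t) - monomial k (lmap (tri a b c) u).
Proof.
move=> p mt mu; rewrite (lin_sub _ _ (relabel_tri_linear p)).
by rewrite (relabel_tri k p mt) (relabel_tri k p mu).
Qed.

(** The opposite of an associative product is associative: exchanging arguments and reversing the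
    letters gives the relation back up to sign. *)
Lemma swap_Ass (D : AssMag_law k) r : Ass_rel r ->
  ideal_gen (combined_rel (@Ass_rel k) (@Mag_rel k) D) (free_mix al be (free_map inl r)).
Proof.
move=> Rr; have [r' Rr' E] := @free_map_Ass_rel k.
have {Rr'}Er' : r = r' by rewrite Rr Rr'.
have Ir : ideal_gen (combined_rel (@Ass_rel k) (@Mag_rel k) D) (free_map inl r).
  by apply: ideal_gen_sub; apply: combined_rel1.
rewrite Er' E in Ir *.
set t := Node _ _ (Leaf 2) in Ir *; set u := Node _ (Leaf 0) _ in Ir *.
have [mt mu] : mlinear t /\ mlinear u := @mlinear_base (unit + unit)%type (inl tt) (inl tt).
have p210 : perm_eq [:: 2; 1; 0 : 'I_3] (enum 'I_3) by exact: perm_enum3.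
have [sI rI _ _] := ideal_gen_ideal (combined_rel (@Ass_rel k) (@Mag_rel k) D).
rewrite (free_mix_swap_sub mt mu).
case Es : (sw (inl tt)).
  have -> : tree_swap t = lmap (tri 2 1 0) u by rewrite /= Es.
  have -> : tree_swap u = lmap (tri 2 1 0) t by rewrite /= Es.
  rewrite -opprB -(relabel_tri_sub p210 mt mu) -scaleN1r; apply: (submodZ (sI 'I_3)).
  by have [s Esp] := tri_perm p210; rewrite -Esp; apply: rI => //; exact: perm_bij.
have -> : tree_swap t = t by rewrite /= Es.
by have -> : tree_swap u = u by rewrite /= Es.
Qed.

Context (D D' : AssMag_law k).
Local Notation m1 := (Node (inl tt) (Node (inr tt) (Leaf 0) (Leaf 1)) (Leaf (2 : 'I_3))).
Local Notation m2 := (Node (inl tt) (Leaf (0 : 'I_3)) (Node (inr tt) (Leaf 1) (Leaf 2))).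

Lemma swap_iso :
  (forall v, rewrites D' (monomial k m1) v ->
     rewrites D (monomial k (tree_swap m1)) (free_mix al be v)) ->
  (forall v, rewrites D' (monomial k m2) v ->
     rewrites D (monomial k (tree_swap m2)) (free_mix al be v)) ->
  AssMag_iso D' D /\ AssMag_iso D D'.
Proof.
move=> H1 H2; have [ma mb] := @mlinear_base (unit + unit)%type (inl tt) (inr tt).
apply: (@combined_transport k al be al be swap_inv1 swap_inv2 (@Ass_rel k) (@Mag_rel k) D D').
- by move=> r Rr; apply: swap_Ass.
- by move=> r Rr; apply: swap_Ass.
- by move=> r [].
- by move=> r [].
- by move=> v /H1; rewrite (free_mix_swap ma).
- by move=> v /H2; rewrite (free_mix_swap mb).
Qed.

End Swap.

(** * Classification *)

Section LabelIso.
Context (k : fieldType).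
Local Notation m1 := (Node (inl tt) (Node (inr tt) (Leaf 0) (Leaf 1)) (Leaf (2 : 'I_3))).
Local Notation m2 := (Node (inl tt) (Leaf (0 : 'I_3)) (Node (inr tt) (Leaf 1) (Leaf 2))).

Lemma rewrites_monomial (D : AssMag_law k) (t : tree (unit + unit) 'I_3) o (a b c : 'I_3) :
  perm_eq (map val [:: a; b; c]) [:: 0; 1; 2]%N ->
  mlinear t -> (forall u, o = Some u -> mlinear u) ->
  rewrites D (monomial k t) (omonomial k o) ->
  rewrites D (monomial k (lmap (tri a b c) t)) (omonomial k (omap (lmap (tri a b c)) o)).
Proof.
move=> /perm_enum3 p mt mo /(rewrites_tri p); rewrite (relabel_tri k p mt).
case: o mo => [u|] mo.
  by have -> : relabel (tri a b c) (omonomial k (Some u)) = _ := relabel_tri k p (mo u erefl).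
by rewrite (linear_map0 (relabel_tri_linear p)).
Qed.

(** The generators whose arguments are exchanged to pass from rule (b) to rule [r]. *)
Definition label_swap (r : truncated_label) (g : unit + unit) : bool :=
  match g, r with
  | inl _, (Label_c | Label_f) | inr _, (Label_c | Label_e) => true
  | _, _ => false
  end.

Lemma truncated_iso_b r (D D' : AssMag_law k) : truncated r D -> truncated Label_b D' ->
  AssMag_iso D' D /\ AssMag_iso D D'.
Proof.
move=> /truncated_monomial[D1 D2] /truncated_monomial[D1' D2'].
have [ma mb] := @mlinear_base (unit + unit)%type (inl tt) (inr tt).
have mr1 u : law_rhs1 (Some r) = Some u -> mlinear u.
  by move=> E; apply: (@mlinear_rhs (Some r)); left.
have mr2 u : law_rhs2 (Some r) = Some u -> mlinear u.
  by move=> E; apply: (@mlinear_rhs (Some r)); right.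
have R1 a b c p := @rewrites_monomial D m1 _ a b c p ma mr1 D1.
have R2 a b c p := @rewrites_monomial D m2 _ a b c p mb mr2 D2.
apply: (@swap_iso k (label_swap r)) => v Dv.
  rewrite (rewrites_inj Dv D1').
  have [pl _ _ _] := free_mix_hom (fun g => (~~ label_swap r g)%:R : k) (fun g => (label_swap r g)%:R).
  have -> : free_mix (fun g => (~~ label_swap r g)%:R : k) (fun g => (label_swap r g)%:R)
    (omonomial k (law_rhs1 (Some Label_b))) = 0 by exact: (linear_map0 (pl 'I_3)).
  (* In each case, the rule of [r] and the permutation of its letters that produce the swapped
     tree. *)
  case: r {pl D1 D2 mr1 mr2} R1 R2 => R1 R2.
  - exact: (R1 0 1 2).
  - exact: (R2 2 1 0).
  - exact: (R1 1 0 2).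
  - exact: (R2 2 0 1).
rewrite (rewrites_inj Dv D2').
have mb2 : @mlinear (unit + unit)%type 'I_3 (Node (inr tt) (Node (inl tt) (Leaf 0) (Leaf 1)) (Leaf 2)).
  exact: mlinear_leaves3.
have -> : free_mix (fun g => (~~ label_swap r g)%:R : k) (fun g => (label_swap r g)%:R)
    (omonomial k (law_rhs2 (Some Label_b))) = _ := free_mix_swap k (label_swap r) mb2.
case: r {D1 D2 mr1 mr2} R1 R2 => R1 R2.
- exact: (R2 0 1 2).
- exact: (R1 2 1 0).
- exact: (R2 0 2 1).
- exact: (R1 1 2 0).
Qed.

Lemma truncated_iso r r' (D D' : AssMag_law k) :
  truncated r D -> truncated r' D' -> AssMag_iso D D'.
Proof.
move=> rD r'D'; have [Db bDb] := law_exists k Label_b.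
have [_ i1] := truncated_iso_b rD bDb; have [i2 _] := truncated_iso_b r'D' bDb.
exact: operad_iso_trans i1 i2.
Qed.

End LabelIso.

Lemma free_val_comb (k : fieldType) (G : choiceType) (I : finType) (p q : k)
    (u v : free_operad k G I) :
  free_val (p *: u + q *: v) = p *: free_val u + q *: free_val v.
Proof.
have lf := @free_val_linear k G I.
by rewrite (linear_mapD lf) (linear_mapZ lf p) (linear_mapZ lf q).
Qed.

(** * Change of the magmatic generator *)

Section ChangeGenerator.
Context (k : fieldType) (p q : k).
Hypothesis pq : p * p - q * q != 0.
Local Notation F := (free_operad k (unit + unit)%type).
Local Notation m1 := (Node (inl tt) (Node (inr tt) (Leaf 0) (Leaf 1)) (Leaf (2 : 'I_3))).
Local Notation m2 := (Node (inl tt) (Leaf (0 : 'I_3)) (Node (inr tt) (Leaf 1) (Leaf 2))).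
Local Notation swap := (tree_swap (@is_inr unit unit)).

(** The weights below leave [•] fixed and replace x ∘ y by p (x ∘ y) + q (y ∘ x). The inverse of p +
    q tau in k[Sigma_2] is (p - q tau) / (p^2 - q^2), whence the primed weights. *)
Definition inr_weight (x y : k) (g : unit + unit) : k := if is_inr g then y else x.
Local Notation al := (inr_weight 1 p).
Local Notation be := (inr_weight 0 q).
Local Notation al' := (inr_weight 1 (p / (p * p - q * q))).
Local Notation be' := (inr_weight 0 (- q / (p * p - q * q))).

Fixpoint inr_nodes (X : Type) (t : tree (unit + unit) X) : nat :=
  if t is Node g l r then (is_inr g + (inr_nodes l + inr_nodes r))%N else 0%N.

Lemma mixop_inl (X : choiceType) x y (a b : {malg k[tree (unit + unit) X]}) :
  mixop (inr_weight 1 x) (inr_weight 0 y) (inl tt) a b = graft (inl tt) a b.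
Proof. by rewrite /mixop /inr_weight scale1r scale0r addr0. Qed.

Lemma mix_no_inr (X : choiceType) x y (t : tree (unit + unit) X) : inr_nodes t = 0%N ->
  mix (inr_weight 1 x) (inr_weight 0 y) << t >> = << t >> /\ swap t = t.
Proof.
elim: t => [i|[[]|[]] l IHl r IHr] //=; first by rewrite mix_leaf.
rewrite add0n => /eqP; rewrite addn_eq0 => /andP[/eqP/IHl[El ->] /eqP/IHr[Er ->]].
by rewrite -graftU mix_graft El Er mixop_inl graftU.
Qed.

Lemma mix_one_inr (X : choiceType) (t : tree (unit + unit) X) : inr_nodes t = 1%N ->
  mix al be << t >> = p *: << t >> + q *: << swap t >>.
Proof.
elim: t => [//|[[]|[]] l IHl r IHr]; rewrite -graftU mix_graft => /= n1.
  have /orP : (inr_nodes l == 1%N) && (inr_nodes r == 0%N) || (inr_nodes l == 0%N) && (inr_nodes r == 1%N).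
    by move: n1; case: (inr_nodes l) => [|[|]]; case: (inr_nodes r) => [|[|]].
  case=> /andP[/eqP nl /eqP nr]; rewrite mixop_inl.
    have [-> ->] := mix_no_inr p q nr; rewrite (IHl nl) graft_linl.
    by rewrite (linear_mapZ (graft_linl _ _)) !graftU.
  have [-> ->] := mix_no_inr p q nl; rewrite (IHr nr) graft_linr.
  by rewrite (linear_mapZ (graft_linr _ _)) !graftU.
have /andP[/eqP nl /eqP nr] : (inr_nodes l == 0%N) && (inr_nodes r == 0%N).
  by rewrite -addn_eq0; apply/eqP; case: n1; rewrite add0n.
have [-> ->] := mix_no_inr p q nl; have [-> ->] := mix_no_inr p q nr.
by rewrite /mixop !graftU.
Qed.

Lemma free_mix_one (t : tree (unit + unit) 'I_3) : mlinear t -> inr_nodes t = 1%N ->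
  free_mix al be (monomial k t) = p *: (monomial k t : F 'I_3) + q *: monomial k (swap t).
Proof.
move=> mt nt; apply: free_val_inj; apply: etrans _ (esym (free_val_comb p q _ _)).
have Et := val_monomial k mt; have Es := val_monomial k (mlinear_swap (@is_inr unit unit) mt).
apply: etrans (congr1 (@mix k _ al be _) Et) (etrans (mix_one_inr nt) _).
exact: esym (f_equal2 (fun u v => p *: u + q *: v) Et Es).
Qed.

Lemma free_mix_inl (I : finType) x y (r : free_operad k unit I) :
  free_mix (inr_weight 1 x) (inr_weight 0 y) (free_map inl r) = free_map inl r.
Proof.
apply: free_val_inj => /=; move: (free_val r); apply: linear_malgP => [c a b|c a b|t].
- by rewrite mmap_gen_linear mix_linear.
- by rewrite mmap_gen_linear.
rewrite /mmap_gen linextU; suff nt : inr_nodes (tree_map inl t) = 0%N.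
  by have [] := mix_no_inr x y nt.
by elim: t => //= g l -> u ->.
Qed.

Context (D D' : AssMag_law k).

Lemma change_iso :
  (forall v, rewrites D' (monomial k m1) v ->
     rewrites D (p *: (monomial k m1 : F 'I_3) + q *: monomial k (swap m1)) (free_mix al be v)) ->
  (forall v, rewrites D' (monomial k m2) v ->
     rewrites D (p *: (monomial k m2 : F 'I_3) + q *: monomial k (swap m2)) (free_mix al be v)) ->
  AssMag_iso D D'.
Proof.
move=> H1 H2; have [ma mb] := @mlinear_base (unit + unit)%type (inl tt) (inr tt).
have E1 g : al g * al' g + be g * be' g = 1.
  by rewrite /inr_weight; case: g => -[] /=; [rewrite mulr1 mulr0 addr0|field].
have E2 g : al g * be' g + be g * al' g = 0.
  by rewrite /inr_weight; case: g => -[] /=; [rewrite mulr1 mulr0 addr0|field].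
suff [] : AssMag_iso D' D /\ AssMag_iso D D' by [].
apply: (@combined_transport k al be al' be' E1 E2 (@Ass_rel k) (@Mag_rel k) D D').
- by move=> r Rr; rewrite free_mix_inl; apply: ideal_gen_sub; apply: combined_rel1.
- by move=> r Rr; rewrite free_mix_inl; apply: ideal_gen_sub; apply: combined_rel1.
- by move=> r [].
- by move=> r [].
- by move=> v /H1; rewrite (free_mix_one ma).
- by move=> v /H2; rewrite (free_mix_one mb).
Qed.

End ChangeGenerator.

(** * Solution of the equations *)

Section Classification.
Context (k : fieldType).
Local Notation F := (free_operad k (unit + unit)%type).
Local Notation m1 := (Node (inl tt) (Node (inr tt) (Leaf 0) (Leaf 1)) (Leaf (2 : 'I_3))).
Local Notation m2 := (Node (inl tt) (Leaf (0 : 'I_3)) (Node (inr tt) (Leaf 1) (Leaf 2))).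
Local Notation x := (Leaf (0 : 'I_3)).
Local Notation y := (Leaf (1 : 'I_3)).
Local Notation z := (Leaf (2 : 'I_3)).

Definition comb4 (V : lmodType k) (a : nat -> k) (w0 w1 w2 w3 : V) : V :=
  a 0%N *: w0 + a 1%N *: w1 + (a 2%N *: w2 + a 3%N *: w3).

Lemma comb4_morph (U V : lmodType k) (f : U -> V) a w0 w1 w2 w3 : linear f ->
  f (comb4 a w0 w1 w2 w3) = comb4 a (f w0) (f w1) (f w2) (f w3).
Proof. by move=> lf; rewrite /comb4 !(linear_mapD lf) !(linear_mapZ lf). Qed.

(** The matrix with rows [(a 0, a 1)] and [(a 2, a 3)] fixes the row vector (p, q) and kills (q, p).
    Exchanging the arguments of the decomposed [∘] swaps [w0, w1] with [w2, w3], so the new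
    generator satisfies a rule with a single term. *)
Lemma comb4_fix (V : lmodType k) (a : nat -> k) (p q : k) (w0 w1 w2 w3 : V) :
  p * a 0%N + q * a 2%N = p -> p * a 1%N + q * a 3%N = q ->
  p * a 2%N + q * a 0%N = 0 -> p * a 3%N + q * a 1%N = 0 ->
  p *: comb4 a w0 w1 w2 w3 + q *: comb4 a w2 w3 w0 w1 = p *: w0 + q *: w1.
Proof.
move=> e1 e2 e3 e4; rewrite /comb4 !scalerDr !scalerA.
rewrite [X in _ + X]addrC addrACA.
rewrite [X in X + _]addrACA [X in _ + X]addrACA -!scalerDl e1 e2 e3 e4.
by rewrite !scale0r !addr0.
Qed.

(** Each row (p, q) of the matrix is a solution: idempotence says that the matrix fixes it, and the
    other equations that it kills (q, p). If p^2 = q^2, then (q, p) is plus or minus (p, q), so the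
    row is both fixed and killed, hence zero. Thus some row is admissible or the matrix vanishes. *)
Lemma idempotent_column (a : nat -> k) :
  idempotent_eqs (a 0%N) (a 1%N) (a 2%N) (a 3%N) ->
  (forall i, (i < 4)%N -> a i = 0) \/
  exists p q, [/\ p * p - q * q != 0, p * a 0%N + q * a 2%N = p,
    p * a 1%N + q * a 3%N = q, p * a 2%N + q * a 0%N = 0 & p * a 3%N + q * a 1%N = 0].
Proof.
case=> -[e1 e2 e3 e4] [f1 f2 f3 f4].
have nz p q : p * a 0%N + q * a 2%N = p -> p * a 1%N + q * a 3%N = q ->
    p * a 2%N + q * a 0%N = 0 -> p * a 3%N + q * a 1%N = 0 -> p * p - q * q = 0 -> p = 0 /\ q = 0.
  move=> g1 g2 g3 g4 /eqP; rewrite subr_eq0 -!expr2 eqf_sqr => /orP[] /eqP E.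
    by rewrite E in g1 g3 *; suff -> : q = 0 by []; rewrite -g1 addrC.
  rewrite E in g1 g3 *; suff -> : q = 0 by rewrite oppr0.
  by apply: oppr_inj; rewrite oppr0 -g1 -[RHS]oppr0 -g3; ring.
have [E01|n01] := eqVneq (a 0%N * a 0%N - a 1%N * a 1%N) 0; last first.
  by right; exists (a 0%N), (a 1%N).
have [E23|n23] := eqVneq (a 2%N * a 2%N - a 3%N * a 3%N) 0; last first.
  by right; exists (a 2%N), (a 3%N).
have [a0 a1] := nz _ _ e1 e2 f1 f2 E01; have [a2 a3] := nz _ _ e3 e4 f3 f4 E23.
by left; case=> [|[|[|[|i]]]].
Qed.

Local Notation mono t := (monomial k t : F 'I_3).
Local Notation rhs2 a := (comb4 a
  (mono (Node (inr tt) (Node (inl tt) x y) z)) (mono (Node (inr tt) z (Node (inl tt) x y)))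
  (mono (Node (inr tt) (Node (inl tt) x z) y)) (mono (Node (inr tt) y (Node (inl tt) x z)))).
Local Notation rhs1 a := (comb4 a
  (mono (Node (inr tt) (Node (inl tt) x z) y)) (mono (Node (inr tt) y (Node (inl tt) x z)))
  (mono (Node (inr tt) (Node (inl tt) y z) x)) (mono (Node (inr tt) x (Node (inl tt) y z)))).

(** Injectivity of [xi] in arity four makes normal forms on four letters independent, which is the
    input of the coefficient equations. *)
Lemma distributive_coeffs (D : AssMag_law k) : AssMag_distributive D ->
  exists a b : nat -> k,
    [/\ rewrites D (mono m2) (rhs2 a), rewrites D (mono m1) (rhs1 b),
        idempotent_eqs (a 0%N) (a 1%N) (a 2%N) (a 3%N),
        idempotent_eqs (b 0%N) (b 1%N) (b 2%N) (b 3%N) &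
        forall i j, (i < 4)%N -> (j < 4)%N -> a i * b j = 0].
Proof.
move=> dD; pose rel := combined_rel (@Ass_rel k) (@Mag_rel k) D.
have xiD : injective (@xi_map k D 'I_4) by apply: bij_inj; apply: (dD 4%N).
have [c [[v2 D2 E2] [v1 D1 E1] expl expr]] := @cls_expand k D 'I_4.
have mB := @tmul_bilinear k _ 3 rel 'I_4.
have cN := @tcls_node k _ 3 rel 'I_4.
have cC := @cls_comb_cat k D 'I_4.
have cA := @cls_assoc k D 'I_4.
have ind := cls_independent xiD.
have [[c4 c5 c6 c7] ia] := left_equations mB cN cA cC expl expr ind.
have [[c16 c17 c18 c19] ib] := right_equations mB cN cA cC expl expr ind.
have [[c8 c9 c10 c11] [[c20 c21 c22 c23] cab]] := overlap_equations mB cN cA cC expl expr ind.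
exists c, (fun i => c (12 + i)%N).
have lf := @free_val_linear k (unit + unit)%type 'I_3.
have Ec (a : nat -> k) t0 t1 t2 t3 : mlinear t0 -> mlinear t1 -> mlinear t2 -> mlinear t3 ->
    free_val (comb4 a (mono t0) (mono t1) (mono t2) (mono t3)) = comb4 a << t0 >> << t1 >> << t2 >> << t3 >>.
  move=> n0 n1 n2 n3; rewrite (comb4_morph a _ _ _ _ lf).
  exact: (f_equal4 (@comb4 {malg k[tree (unit + unit) 'I_3]} a) (val_monomial k n0)
    (val_monomial k n1) (val_monomial k n2) (val_monomial k n3)).
have E12 (V : lmodType k) (a : nat -> k) (w : nat -> V) :
    [/\ a 4%N = 0, a 5%N = 0, a 6%N = 0 & a 7%N = 0] ->
    [/\ a 8%N = 0, a 9%N = 0, a 10%N = 0 & a 11%N = 0] ->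
    \sum_(i <- iota 0 12) a i *: w i = comb4 a (w 0%N) (w 1%N) (w 2%N) (w 3%N).
  move=> [a4 a5 a6 a7] [a8 a9 a10 a11].
  rewrite /= !big_cons big_nil a4 a5 a6 a7 a8 a9 a10 a11 !scale0r !addr0.
  by rewrite /comb4 -!addrA.
split=> //.
- have -> : rhs2 c = v2; last by [].
  apply: free_val_inj; rewrite Ec ?E2; try exact: mlinear_leaves3.
  by rewrite (E12 _ c (fun i => << term_tree false x y z (term_at i) >>)).
- have -> : rhs1 (fun i => c (12 + i)%N) = v1; last by [].
  apply: free_val_inj; rewrite Ec ?E1; try exact: mlinear_leaves3.
  by rewrite (E12 _ (fun i => c (12 + i)%N) (fun i => << term_tree true z x y (term_at i) >>)).
Qed.

End Classification.

Section ClassificationTheorem.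
Context (k : fieldType).
Local Notation F := (free_operad k (unit + unit)%type).
Local Notation m1 := (Node (inl tt) (Node (inr tt) (Leaf 0) (Leaf 1)) (Leaf (2 : 'I_3))).
Local Notation m2 := (Node (inl tt) (Leaf (0 : 'I_3)) (Node (inr tt) (Leaf 1) (Leaf 2))).
Local Notation x := (Leaf (0 : 'I_3)).
Local Notation y := (Leaf (1 : 'I_3)).
Local Notation z := (Leaf (2 : 'I_3)).
Local Notation swap := (tree_swap (@is_inr unit unit)).
Local Notation mono t := (monomial k t : F 'I_3).

Lemma comb4_0 (V : lmodType k) (a : nat -> k) (w0 w1 w2 w3 : V) :
  (forall i, (i < 4)%N -> a i = 0) -> comb4 a w0 w1 w2 w3 = 0.
Proof. by move=> a0; rewrite /comb4 !a0 // !scale0r !addr0. Qed.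

Lemma relabel_comb4 (a b c : 'I_3) (d : nat -> k) (t0 t1 t2 t3 : tree (unit + unit) 'I_3) :
  perm_eq [:: a; b; c] (enum 'I_3) ->
  mlinear t0 -> mlinear t1 -> mlinear t2 -> mlinear t3 ->
  relabel (tri a b c) (comb4 d (mono t0) (mono t1) (mono t2) (mono t3)) =
  comb4 d (mono (lmap (tri a b c) t0)) (mono (lmap (tri a b c) t1))
          (mono (lmap (tri a b c) t2)) (mono (lmap (tri a b c) t3)).
Proof.
move=> p n0 n1 n2 n3; apply: etrans (comb4_morph d _ _ _ _ (relabel_tri_linear p)) _.
exact: (f_equal4 (@comb4 k (F 'I_3) d) (relabel_tri k p n0) (relabel_tri k p n1)
  (relabel_tri k p n2) (relabel_tri k p n3)).
Qed.

Lemma rewrites_column (D : AssMag_law k) (a b c : 'I_3) (d : nat -> k) (p q : k)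
    (t t0 t1 t2 t3 : tree (unit + unit) 'I_3) :
  perm_eq [:: a; b; c] (enum 'I_3) -> mlinear t ->
  mlinear t0 -> mlinear t1 -> mlinear t2 -> mlinear t3 ->
  lmap (tri a b c) t0 = t2 -> lmap (tri a b c) t1 = t3 ->
  lmap (tri a b c) t2 = t0 -> lmap (tri a b c) t3 = t1 ->
  rewrites D (mono t) (comb4 d (mono t0) (mono t1) (mono t2) (mono t3)) ->
  p * d 0%N + q * d 2%N = p -> p * d 1%N + q * d 3%N = q ->
  p * d 2%N + q * d 0%N = 0 -> p * d 3%N + q * d 1%N = 0 ->
  rewrites D (p *: mono t + q *: mono (lmap (tri a b c) t)) (p *: mono t0 + q *: mono t1).
Proof.
move=> abc mt n0 n1 n2 n3 e0 e1 e2 e3 Dt f1 f2 f3 f4.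
have := rewrites2 p q Dt (rewrites_tri abc Dt).
rewrite (relabel_tri k abc mt) (relabel_comb4 d abc n0 n1 n2 n3) e0 e1 e2 e3.
by rewrite comb4_fix.
Qed.

Lemma rewrites_swap0 (D : AssMag_law k) (a b c : 'I_3) (p q : k) (t : tree (unit + unit) 'I_3) :
  perm_eq [:: a; b; c] (enum 'I_3) -> mlinear t -> rewrites D (mono t) 0 ->
  rewrites D (p *: mono t + q *: mono (lmap (tri a b c) t)) 0.
Proof.
move=> abc mt Dt; have := rewrites2 p q Dt (rewrites_tri abc Dt).
by rewrite (relabel_tri k abc mt) (linear_map0 (relabel_tri_linear abc)) !scaler0 addr0.
Qed.

Lemma free_mix0 (al be : unit + unit -> k) : free_mix al be (0 : F 'I_3) = 0.
Proof. by have [pl _ _ _] := free_mix_hom al be; exact: (linear_map0 (pl 'I_3)). Qed.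

(** The vanishing products leave one side of the law at most. A nonzero side x • (y ∘ z) is brought
    to (b), a nonzero side (x ∘ y) • z to (f), by the change of generator found in
    [idempotent_column]. *)
Lemma classification (D : AssMag_law k) : AssMag_distributive D ->
  AssMag_iso D (zero_law k unit unit) \/
  exists (r : truncated_label) (D' : AssMag_law k), truncated r D' /\ AssMag_iso D D'.
Proof.
case/distributive_coeffs=> a [b [D2 D1 ia ib ab]].
have [ma mb] := @mlinear_base (unit + unit)%type (inl tt) (inr tt).
have p102 : perm_eq [:: 1; 0; 2 : 'I_3] (enum 'I_3) by exact: perm_enum3.
have p021 : perm_eq [:: 0; 2; 1 : 'I_3] (enum 'I_3) by exact: perm_enum3.
have s1 : swap m1 = lmap (tri 1 0 2) m1 by [].
have s2 : swap m2 = lmap (tri 0 2 1) m2 by [].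
have [a0|[p [q [pq e0 e1 e2 e3]]]] := idempotent_column ia; last first.
  right; exists Label_b; have [D' bD'] := law_exists k Label_b; exists D'; split=> //.
  (* A nonzero [b j] would make all the [a i] zero, hence p and q as well, against [pq]. *)
  have b0 j : (j < 4)%N -> b j = 0.
    move=> j4; apply/eqP; apply: contraT => nb.
    have a0 i : (i < 4)%N -> a i = 0.
      by move=> i4; apply/eqP; have /eqP := ab i j i4 j4; rewrite mulf_eq0 (negPf nb) orbF.
    move: e0 e1 pq; rewrite !a0 // !mulr0 !addr0 => <- <-.
    by rewrite !mulr0 subrr eqxx.
  rewrite (comb4_0 _ _ _ _ b0) in D1.
  have [D1' D2'] := bD'.
  apply: (change_iso pq) => v Dv; rewrite ?s1 ?s2.
    by rewrite (rewrites_inj Dv D1') free_mix0; exact: rewrites_swap0.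
  rewrite (rewrites_inj Dv D2').
  have mt : @mlinear (unit + unit)%type 'I_3 (Node (inr tt) (Node (inl tt) x y) z).
    exact: mlinear_leaves3.
  have -> := free_mix_one p q mt erefl.
  by apply: (rewrites_column p021 mb _ _ _ _ _ _ _ _ D2) => //; exact: mlinear_leaves3.
rewrite (comb4_0 _ _ _ _ a0) in D2.
have [b0|[p [q [pq e0 e1 e2 e3]]]] := idempotent_column ib; last first.
  right; exists Label_f; have [D' fD'] := law_exists k Label_f; exists D'; split=> //.
  have [D1' D2'] := fD'.
  apply: (change_iso pq) => v Dv; rewrite ?s1 ?s2; last first.
    by rewrite (rewrites_inj Dv D2') free_mix0; exact: rewrites_swap0.
  rewrite (rewrites_inj Dv D1').
  have mt : @mlinear (unit + unit)%type 'I_3 (Node (inr tt) (Node (inl tt) x z) y).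
    exact: mlinear_leaves3.
  have -> := free_mix_one p q mt erefl.
  by apply: (rewrites_column p102 ma _ _ _ _ _ _ _ _ D1) => //; exact: mlinear_leaves3.
left; rewrite (comb4_0 _ _ _ _ b0) in D1.
have [D1' D2'] := zero_law_monomial k.
(* With p = 1 and q = 0 the generator is unchanged, and both laws send the two trees to 0. *)
have pq : 1 * 1 - 0 * 0 != 0 :> k by rewrite mulr1 mulr0 subr0 oner_neq0.
apply: (change_iso pq) => v Dv; rewrite ?s1 ?s2.
  have -> : v = 0 := rewrites_inj Dv D1'.
  by rewrite free_mix0; exact: (rewrites_swap0 1 0 p102 ma D1).
have -> : v = 0 := rewrites_inj Dv D2'.
by rewrite free_mix0; exact: (rewrites_swap0 1 0 p021 mb D2).
Qed.

End ClassificationTheorem.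

(** * Truncated laws are not trivial *)

Section TrivialModel.
Context (k : fieldType) (X : choiceType).
Local Notation B := {malg k[wtree X]}.
Local Notation op := (@model_op k true None X).

Lemma coef_magmatic (a b : B) s t : (op (inr tt) a b)@_(Node tt s t) = a@_s * b@_t.
Proof.
have [ml mr] := @model_bilinear k true None X.
move: a; apply: malg_ind => [|u].
  split=> [|c x y Ex Ey]; first by rewrite (linear_map0 (ml _ b)) !mcoeff0 mul0r.
  by rewrite ml !mcoeffD !mcoeffZ Ex Ey mulrDl mulrA.
move: b; apply: malg_ind => [|v].
  split=> [|c x y Ex Ey]; first by rewrite (linear_map0 (mr _ _)) !mcoeff0 mulr0.
  by rewrite mr !mcoeffD !mcoeffZ Ex Ey mulrDr mulrCA.
have -> : op (inr tt) << u >> << v >> = << Node tt u v >> by exact: linext2U.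
rewrite !mcoeffU -natrM mulnb; congr (_%:R); congr nat_of_bool.
by apply/eqP/andP => [[-> ->]|[/eqP-> /eqP->]].
Qed.

Lemma coef_associative (a b : B) s t : (op (inl tt) a b)@_(Node tt s t) = 0.
Proof.
have [ml mr] := @model_bilinear k true None X.
move: a; apply: malg_ind => [|u].
  split=> [|c x y Ex Ey]; first by rewrite (linear_map0 (ml _ b)) mcoeff0.
  by rewrite ml !mcoeffD !mcoeffZ Ex Ey mulr0 addr0.
move: b; apply: malg_ind => [|v].
  split=> [|c x y Ex Ey]; first by rewrite (linear_map0 (mr _ _)) mcoeff0.
  by rewrite mr !mcoeffD !mcoeffZ Ex Ey mulr0 addr0.
have -> : op (inl tt) << u >> << v >> = @model_base k true None X (inl tt) u v by exact: linext2U.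
by case: u => [u|[] ? ?]; case: v => [v|[] ? ?]; rewrite /= ?mcoeff0 // mcoeffU.
Qed.

(** The general binary operation of the trivial combined operad: [c 0] and [c 1] weight [•] and its
    opposite, [c 2] and [c 3] weight [∘] and its opposite. *)
Definition bin_op (c : nat -> k) (a b : B) : B :=
  comb4 c (op (inl tt) a b) (op (inl tt) b a) (op (inr tt) a b) (op (inr tt) b a).

Lemma coef_bin_op c a b s t :
  (bin_op c a b)@_(Node tt s t) = c 2%N * (a@_s * b@_t) + c 3%N * (b@_s * a@_t).
Proof.
pose m (u : B) : k^o := u@_(Node tt s t).
have lm : linear m by move=> z u v; rewrite /m mcoeffD mcoeffZ.
apply: etrans (comb4_morph c _ _ _ _ lm) _; rewrite /comb4 /m.
rewrite (coef_associative a b) (coef_associative b a) (coef_magmatic a b) (coef_magmatic b a).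
by rewrite !scaler0 !add0r.
Qed.

End TrivialModel.

(** * Morphisms into the trivial combined operad, evaluated in its model *)

Section NotIso.
Context (k : fieldType).
Local Notation F := (free_operad k (unit + unit)%type).
Local Notation corolla g i j := (monomial k (Node g (Leaf i) (Leaf j)) : F bool).

Lemma mlinear_bool g b : @mlinear (unit + unit)%type bool (Node g (Leaf b) (Leaf (~~ b))).
Proof. by apply: uniq_perm => [||[]]; rewrite ?enum_uniq ?mem_enum //; case: b. Qed.

(** Arity two is taken on the set [bool], where these trees form a basis of the free operad. *)
Definition corollas : seq (tree (unit + unit) bool) :=
  [:: Node (inl tt) (Leaf true) (Leaf false); Node (inl tt) (Leaf false) (Leaf true);
      Node (inr tt) (Leaf true) (Leaf false); Node (inr tt) (Leaf false) (Leaf true)].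

Lemma corollas_mem (t : tree (unit + unit) bool) : mlinear t -> t \in corollas.
Proof.
move=> mt; have sz : size (leaves t) = 2%N by rewrite (perm_size mt) -cardE card_bool.
have ut : uniq (leaves t) by rewrite (perm_uniq mt) enum_uniq.
have gt0 (u : tree (unit + unit) bool) : (0 < size (leaves u))%N by rewrite lt0n leaves_neq0.
have leaf u : (size (leaves u) <= 1)%N -> exists i : bool, u = Leaf i :> tree (unit + unit) bool.
  case: u => [i|g l r]; first by exists i.
  by rewrite /= size_cat; move: (gt0 l) (gt0 r) => l0 r0; lia.
case: t {mt} sz ut => [//|g l r] /=; rewrite size_cat => sz.
have [|i ->] := leaf l; first by move: (gt0 r) => r0; lia.
have [|j ->] := leaf r; first by move: (gt0 l) => l0; lia.
by case: g => -[]; case: i; case: j; vm_compute.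
Qed.

Definition bool_elt (c : nat -> k) : F bool :=
  \sum_(i <- iota 0 4) c i *: (monomial k (nth (Leaf true) corollas i) : F bool).

Lemma bool_eltP (x : F bool) : exists c, x = bool_elt c.
Proof.
exists (fun i => (free_val x)@_(nth (Leaf true) corollas i)).
have lf := @free_val_linear k (unit + unit)%type bool.
apply: free_val_inj; rewrite /bool_elt (linear_map_sum lf).
have mc i : i \in iota 0 4 -> mlinear (nth (Leaf true) corollas i).
  by rewrite mem_iota; case: i => [|[|[|[|i]]]] // _; apply: mlinear_bool.
transitivity (\sum_(t <- corollas) (free_val x)@_t *: << t >>); last first.
  have -> : corollas = [seq nth (Leaf true) corollas i | i <- iota 0 4] by [].
  rewrite big_map; apply: eq_big_seq => i /mc mi.
  by rewrite (linear_mapZ lf) (val_monomial k mi).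
apply/malgP => u; rewrite raddf_sum /=.
have E t : ((free_val x)@_t *: << t >> : {malg k[tree (unit + unit) bool]})@_u =
    (free_val x)@_t *+ (t == u) by rewrite mcoeffZ mcoeffU mulr_natr.
under eq_bigr => t _ do rewrite E.
have [ub|nub] := boolP (u \in corollas).
  rewrite (bigD1_seq u ub) //= eqxx big1 ?addr0 // => t /negPf ->.
  by rewrite mulr0n.
rewrite big_seq big1 => [|t tb].
  apply: mcoeff_outdom; apply: contra nub => uv; apply: corollas_mem.
  by have /allP := free_valP x; apply.
by case: eqP tb nub => [->|_ _ _]; rewrite ?mulr0n // => ->.
Qed.

Lemma aeval_bool_elt (V : lmodType k) (op : unit + unit -> V -> V -> V) (f : bool -> V) c :
  aeval op f (free_val (bool_elt c)) =
  comb4 c (op (inl tt) (f true) (f false)) (op (inl tt) (f false) (f true))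
    (op (inr tt) (f true) (f false)) (op (inr tt) (f false) (f true)).
Proof.
have lf := @free_val_linear k (unit + unit)%type bool; have la := aeval_linear op f.
rewrite /bool_elt (linear_map_sum lf) (linear_map_sum la).
transitivity (\sum_(i <- iota 0 4) c i *: teval op f (nth (Leaf true) corollas i)).
  apply: eq_big_seq => i; rewrite mem_iota => i4.
  rewrite (linear_mapZ lf) (linear_mapZ la) val_monomial ?aevalU //.
  by case: i i4 => [|[|[|[|i]]]] // _; apply: mlinear_bool.
by rewrite /= !big_cons big_nil addr0 /comb4 -!addrA.
Qed.

Section Evaluation.
Context (X : choiceType).
Local Notation B := {malg k[wtree X]}.
Local Notation op := (@model_op k true None X).
Local Notation D0 := (zero_law k unit unit).
Local Notation rel0 := (combined_rel (@Ass_rel k) (@Mag_rel k) D0).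
Local Notation P0 := (combined (@Ass_rel k) (@Mag_rel k) D0).

(** The representative does not matter, since the model is an algebra over the trivial combined
    operad ([model_eval]). *)
Definition qeval (I : finType) (f : I -> B) (p : P0 I) : B :=
  aeval op f (free_val (repr (p : quot_space rel0 I))).

Lemma qeval_pi (I : finType) (f : I -> B) x : qeval f (qpi rel0 x) = aeval op f (free_val x).
Proof.
apply/aeval_sub0; apply: (model_eval (lab := None) (zero_law_monomial k)).
exact: qpi_repr.
Qed.

Lemma qeval_relabel (I J : finType) (h : I -> J) (f : J -> B) p : bijective h ->
  qeval f (relabel h p) = qeval (f \o h) p.
Proof.
move=> bh; have [x ->] := qpi_ex p; have [_ qr _ _] := @qpi_hom k F 3 rel0.
apply: etrans (congr1 (qeval f) (esym (qr _ _ h x bh))) _.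
rewrite !qeval_pi (val_relabel x bh).
exact: (aeval_mrelabel (@model_bilinear k true None X)).
Qed.

Lemma qeval_unit (f : unit -> B) : qeval f (ounit : P0 unit) = f tt.
Proof. by apply: etrans (qeval_pi f _) _; rewrite val_unit [LHS]aevalU. Qed.

Lemma qeval_comp (J : finType) (K : J -> finType) (f : {j : J & K j} -> B)
    (mu : P0 J) (nu : forall j, P0 (K j)) :
  qeval f (ocomp mu nu) = qeval (fun j => qeval (fun i => f (existT (fun j => K j : Type) j i)) (nu j)) mu.
Proof.
have [x ->] := qpi_ex mu; have [y ->] := qpi_exf nu.
have [_ _ _ qc] := @qpi_hom k F 3 rel0.
apply: etrans (congr1 (qeval f) (esym (qc _ _ x y))) _.
rewrite !qeval_pi; apply: etrans (aeval_bind (@model_bilinear k true None X) _ _ _) _.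
apply: eq_aeval => j; rewrite qeval_pi.
exact: (aeval_mrelabel (@model_bilinear k true None X)).
Qed.

Context (D : AssMag_law k).
Local Notation rel := (combined_rel (@Ass_rel k) (@Mag_rel k) D).
Local Notation P := (combined (@Ass_rel k) (@Mag_rel k) D).
Context (phi : forall I, P I -> P0 I) (phiH : operad_hom phi).
Context (c : unit + unit -> nat -> k).
Hypothesis phic : forall g, phi (qpi rel (corolla g true false)) = qpi rel0 (bool_elt (c g)).

Lemma qeval_corolla g (f : bool -> B) :
  qeval f (phi (qpi rel (corolla g true false))) = bin_op (c g) (f true) (f false).
Proof. by rewrite phic qeval_pi aeval_bool_elt. Qed.

Lemma qeval_phi_unit (f : unit -> B) : qeval f (phi (qpi rel (ounit : F unit))) = f tt.
Proof.
have [pl pr pu pc] := phiH; have [_ qr qu qc] := @qpi_hom k F 3 rel.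
have -> : qpi rel (ounit : F unit) = (ounit : P unit) := qu.
by rewrite pu qeval_unit.
Qed.

Lemma qeval_ocomp (J I : finType) (K : J -> finType) (h : {j : J & K j} -> I) (f : I -> B)
    (mu : F J) (nu : forall j, F (K j)) : bijective h ->
  qeval f (phi (qpi rel (relabel h (ocomp mu nu)))) =
  qeval (fun j => qeval (fun i => f (h (existT (fun j => K j : Type) j i))) (phi (qpi rel (nu j))))
    (phi (qpi rel mu)).
Proof.
move=> bh; have [pl pr pu pc] := phiH; have [_ qr qu qc] := @qpi_hom k F 3 rel.
have -> : qpi rel (relabel h (ocomp mu nu)) =
    relabel h (ocomp (qpi rel mu : P J) (fun j => qpi rel (nu j) : P (K j))).
  exact: etrans (qr _ _ h _ bh) (congr1 (@relabel k P _ _ h) (qc _ _ mu nu)).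
by rewrite (pr _ _ h _ bh) (qeval_relabel _ _ bh) pc qeval_comp.
Qed.

Definition left_labels : {j : bool & if j then (bool : finType) else (unit : finType)} -> 'I_3 :=
  fun u => match u with
  | existT true b => if b then 0 else 1
  | existT false _ => 2
  end.

Definition right_labels : {j : bool & if j then (unit : finType) else (bool : finType)} -> 'I_3 :=
  fun u => match u with
  | existT true _ => 0
  | existT false b => if b then 1 else 2
  end.

Lemma left_labels_bij : bijective left_labels.
Proof.
pose K (j : bool) : finType := if j then (bool : finType) else (unit : finType).
exists (fun i : 'I_3 => match val i with
  | 0%N => existT (fun j => K j : Type) true true
  | 1%N => existT (fun j => K j : Type) true false
  | _ => existT (fun j => K j : Type) false tt
  end); first by move=> [[] []].
by move=> [[|[|[|i]]] // lti]; apply: val_inj.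
Qed.

Lemma right_labels_bij : bijective right_labels.
Proof.
pose K (j : bool) : finType := if j then (unit : finType) else (bool : finType).
exists (fun i : 'I_3 => match val i with
  | 0%N => existT (fun j => K j : Type) true tt
  | 1%N => existT (fun j => K j : Type) false true
  | _ => existT (fun j => K j : Type) false false
  end); first by move=> [[] []].
by move=> [[|[|[|i]]] // lti]; apply: val_inj.
Qed.

(** The tree is a composite of two-leaf trees, so the images [c g] of the generators determine the
    value of the morphism [phi] on it. *)
Lemma qeval_left g h (f : 'I_3 -> B) :
  qeval f (phi (qpi rel (monomial k (Node g (Node h (Leaf 0) (Leaf 1)) (Leaf 2))))) =
  bin_op (c g) (bin_op (c h) (f 0) (f 1)) (f 2).
Proof.
pose K (j : bool) : finType := if j then (bool : finType) else (unit : finType).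
pose nu (j : bool) : F (K j) := if j is true then corolla h true false else ounit.
have E : monomial k (Node g (Node h (Leaf 0) (Leaf 1)) (Leaf 2)) =
    relabel (left_labels : {j : bool & K j} -> 'I_3) (ocomp (corolla g true false) nu).
  have [ma _] := @mlinear_base (unit + unit)%type g h.
  apply: free_val_inj; rewrite (val_monomial k ma) (val_relabel _ left_labels_bij).
  rewrite ocomp_corolla_val [nu true]/= [nu false]/= (val_monomial k (mlinear_bool h true)) val_unit.
  by rewrite !mrelabelE graftU mrelabelE.
rewrite E (qeval_ocomp _ _ _ left_labels_bij) qeval_corolla.
have Ec := qeval_corolla h (fun i => f (left_labels (existT (fun j => K j : Type) true i))).
have Eu := qeval_phi_unit (fun i => f (left_labels (existT (fun j => K j : Type) false i))).
exact: (etrans (congr1 (fun u => bin_op (c g) u _) Ec) (congr1 (bin_op (c g) _) Eu)).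
Qed.

Lemma qeval_right g h (f : 'I_3 -> B) :
  qeval f (phi (qpi rel (monomial k (Node g (Leaf 0) (Node h (Leaf 1) (Leaf 2)))))) =
  bin_op (c g) (f 0) (bin_op (c h) (f 1) (f 2)).
Proof.
pose K (j : bool) : finType := if j then (unit : finType) else (bool : finType).
pose nu (j : bool) : F (K j) := if j is true then ounit else corolla h true false.
have E : monomial k (Node g (Leaf 0) (Node h (Leaf 1) (Leaf 2))) =
    relabel (right_labels : {j : bool & K j} -> 'I_3) (ocomp (corolla g true false) nu).
  have [_ mb] := @mlinear_base (unit + unit)%type g h.
  apply: free_val_inj; rewrite (val_monomial k mb) (val_relabel _ right_labels_bij).
  rewrite ocomp_corolla_val [nu true]/= [nu false]/= (val_monomial k (mlinear_bool h true)) val_unit.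
  by rewrite !mrelabelE graftU mrelabelE.
rewrite E (qeval_ocomp _ _ _ right_labels_bij) qeval_corolla.
have Eu := qeval_phi_unit (fun i => f (right_labels (existT (fun j => K j : Type) true i))).
have Ec := qeval_corolla h (fun i => f (right_labels (existT (fun j => K j : Type) false i))).
exact: (etrans (congr1 (fun u => bin_op (c g) u _) Eu) (congr1 (bin_op (c g) _) Ec)).
Qed.

End Evaluation.

End NotIso.

(** * Coefficients of a hypothetical isomorphism *)

Section NotIsoTheorem.
Context (k : fieldType) (D : AssMag_law k) (Db : truncated Label_b D).
Local Notation F := (free_operad k (unit + unit)%type).
Local Notation rel := (combined_rel (@Ass_rel k) (@Mag_rel k) D).
Local Notation corolla g i j := (monomial k (Node g (Leaf i) (Leaf j)) : F bool).
Local Notation b0 := (corolla (inl tt) true false).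
Local Notation b1 := (corolla (inl tt) false true).
Local Notation b2 := (corolla (inr tt) true false).
Local Notation b3 := (corolla (inr tt) false true).

Lemma sum_comb4 (V : lmodType k) (c : nat -> k) (w : nat -> V) :
  \sum_(i <- iota 0 4) c i *: w i = comb4 c (w 0%N) (w 1%N) (w 2%N) (w 3%N).
Proof. by rewrite /= !big_cons big_nil addr0 /comb4 -!addrA. Qed.

Lemma bool_elt_comb4 c : bool_elt c = comb4 c b0 b1 b2 b3.
Proof. exact: sum_comb4. Qed.

Lemma coef_comb4 (T : choiceType) (c : nat -> k) (w0 w1 w2 w3 : {malg k[T]}) t :
  (comb4 c w0 w1 w2 w3)@_t =
  c 0%N * w0@_t + c 1%N * w1@_t + (c 2%N * w2@_t + c 3%N * w3@_t).
Proof.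
pose m (u : {malg k[T]}) : k^o := u@_t.
have lm : linear m by move=> z u v; rewrite /m mcoeffD mcoeffZ.
exact: (comb4_morph c _ _ _ _ lm).
Qed.

Lemma coef_basis (T : choiceType) (s t : T) (b : bool) : (s == t) = b ->
  (<< s >> : {malg k[T]})@_t = b%:R.
Proof. by move=> <-; rewrite mcoeffU. Qed.

Lemma coef_comb4_basis (T : choiceType) (c : nat -> k) (s0 s1 s2 s3 t : T) (e0 e1 e2 e3 : bool) :
  (s0 == t) = e0 -> (s1 == t) = e1 -> (s2 == t) = e2 -> (s3 == t) = e3 ->
  (comb4 c << s0 >> << s1 >> << s2 >> << s3 >> : {malg k[T]})@_t =
  c 0%N * e0%:R + c 1%N * e1%:R + (c 2%N * e2%:R + c 3%N * e3%:R).
Proof.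
move=> h0 h1 h2 h3; apply: etrans (coef_comb4 _ _ _ _ _ _) _.
by rewrite (coef_basis h0) (coef_basis h1) (coef_basis h2) (coef_basis h3).
Qed.

(** The four corollas are distinct normal forms for rule (b). *)
Lemma corollas_free c : qpi rel (comb4 c b0 b1 b2 b3) = 0 -> forall i, (i < 4)%N -> c i = 0.
Proof.
have lq := @qpi_linear k F 3 rel bool; rewrite -(linear_map0 lq) => q0.
have Dlab : monomial_law (Some Label_b) D by apply/truncated_monomial.
have := nf_elt_ideal Dlab q0; have ln := @nf_elt_linear k (Some Label_b) bool.
pose t0 : wtree bool := Leaf (true, [:: false]); pose t1 : wtree bool := Leaf (false, [:: true]).
pose t2 : wtree bool := Node tt (Leaf (true, [::])) (Leaf (false, [::])).
pose t3 : wtree bool := Node tt (Leaf (false, [::])) (Leaf (true, [::])).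
rewrite (linear_map0 ln) (comb4_morph c _ _ _ _ ln).
have E g b (t : wtree bool) : Node g (Leaf b) (Leaf (~~ b)) = emb t ->
    nf_elt (Some Label_b) (corolla g b (~~ b)) = << t >>.
  by move=> Et; have := mlinear_bool g b; rewrite Et; exact: nf_elt_emb.
have E4 := f_equal4 (@comb4 k {malg k[wtree bool]} c) (E (inl tt) true t0 erefl)
  (E (inl tt) false t1 erefl) (E (inr tt) true t2 erefl) (E (inr tt) false t3 erefl).
move/(etrans (esym E4)) => E0 i; have H t : (comb4 c << t0 >> << t1 >> << t2 >> << t3 >>)@_t = 0.
  by rewrite E0 mcoeff0.
have B t e0 e1 e2 e3 h0 h1 h2 h3 :=
  etrans (esym (@coef_comb4_basis _ c t0 t1 t2 t3 t e0 e1 e2 e3 h0 h1 h2 h3)) (H t).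
have := B t0 true false false false erefl erefl erefl erefl.
have := B t1 false true false false erefl erefl erefl erefl.
have := B t2 false false true false erefl erefl erefl erefl.
have := B t3 false false false true erefl erefl erefl erefl.
rewrite /= !mulr0 !mulr1 !addr0 !add0r => c3 c2 c1 c0.
by case: i => [|[|[|[|i]]]].
Qed.

Section Coefficients.
Context (c1 c2 : nat -> k).
Local Notation L i := (<< Leaf (i, [::]) : wtree 'I_3 >> : {malg k[wtree 'I_3]}).
Local Notation lf s := (Leaf s : wtree 'I_3).
Hypothesis assoc : bin_op c1 (bin_op c1 (L 0) (L 1)) (L 2) = bin_op c1 (L 0) (bin_op c1 (L 1) (L 2)).
Hypothesis rule_b : bin_op c1 (L 0) (bin_op c2 (L 1) (L 2)) = bin_op c2 (bin_op c1 (L 0) (L 1)) (L 2).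

Lemma bin_op_letters c (i j : 'I_3) : bin_op c (L i) (L j) =
  comb4 c << lf (i, [:: j]) >> << lf (j, [:: i]) >>
    << Node tt (lf (i, [::])) (lf (j, [::])) >> << Node tt (lf (j, [::])) (lf (i, [::])) >>.
Proof.
have E g s t : @model_op k true None 'I_3 g << s >> << t >> = @model_base k true None 'I_3 g s t.
  exact: linext2U.
exact: (f_equal4 (@comb4 k {malg k[wtree 'I_3]} c) (E (inl tt) (lf (i, [::])) (lf (j, [::])))
  (E (inl tt) (lf (j, [::])) (lf (i, [::]))) (E (inr tt) (lf (i, [::])) (lf (j, [::])))
  (E (inr tt) (lf (j, [::])) (lf (i, [::])))).
Qed.

Lemma coef_bin_op_eq (X : choiceType) c (a b : {malg k[wtree X]}) s t as_ bt bs at_ :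
  a@_s = as_ -> b@_t = bt -> b@_s = bs -> a@_t = at_ ->
  (bin_op c a b)@_(Node tt s t) = c 2%N * (as_ * bt) + c 3%N * (bs * at_).
Proof. by move=> <- <- <- <-; exact: coef_bin_op. Qed.

Let coefL (i : 'I_3) (t : wtree 'I_3) (b : bool) :
  (lf (i, [::]) == t) = b -> (L i)@_t = b%:R.
Proof. exact: coef_basis. Qed.

(** The tree (x ∘ y) ∘ z has as coefficient the square of [c1 2] on the left-hand side, and 0 on the
    right-hand side, where x alone would have to be a child of the root. The tree z ∘ (y ∘ x) gives
    [c1 3] likewise. *)
Lemma associative_coeffs : c1 2%N = 0 /\ c1 3%N = 0.
Proof.
pose u := bin_op c1 (L 0) (L 1); pose w := bin_op c1 (L 1) (L 2).
have H t : (bin_op c1 u (L 2))@_t = (bin_op c1 (L 0) w)@_t := congr1 (mcoeff t) assoc.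
pose l0 := lf (0, [::]); pose l1 := lf (1, [::]); pose l2 := lf (2, [::]).
have val (a : {malg k[wtree 'I_3]}) t : exists x, a@_t = x by exists a@_t.
split.
  pose s : wtree 'I_3 := Node tt l0 l1.
  have us := @coef_bin_op_eq _ c1 (L 0) (L 1) l0 l1 _ _ _ _
    (@coefL 0 l0 true erefl) (@coefL 1 l1 true erefl) (@coefL 1 l0 false erefl) (@coefL 0 l1 false erefl).
  have [x ux] := val u l2; have [y wy] := val w l2; have [z wz] := val w s.
  have El := @coef_bin_op_eq _ c1 u (L 2) s l2 _ _ _ _ us (@coefL 2 l2 true erefl)
    (@coefL 2 s false erefl) ux.
  have Er := @coef_bin_op_eq _ c1 (L 0) w s l2 _ _ _ _ (@coefL 0 s false erefl) wy
    wz (@coefL 0 l2 false erefl).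
  have := etrans (esym El) (etrans (H (Node tt s l2)) Er).
  rewrite mul1r !(mulr0, mul0r, mulr1, addr0) => /eqP.
  by rewrite mulf_eq0 orbb => /eqP.
pose t : wtree 'I_3 := Node tt l1 l0.
have ut := @coef_bin_op_eq _ c1 (L 0) (L 1) l1 l0 _ _ _ _
  (@coefL 0 l1 false erefl) (@coefL 1 l0 false erefl) (@coefL 1 l1 true erefl) (@coefL 0 l0 true erefl).
have [x ux] := val u l2; have [y wy] := val w t; have [z wz] := val w l2.
have El := @coef_bin_op_eq _ c1 u (L 2) l2 t _ _ _ _ ux (@coefL 2 t false erefl)
  (@coefL 2 l2 true erefl) ut.
have Er := @coef_bin_op_eq _ c1 (L 0) w l2 t _ _ _ _ (@coefL 0 l2 false erefl) wy
  wz (@coefL 0 t false erefl).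
have := etrans (esym El) (etrans (H (Node tt l2 t)) Er).
rewrite !(mulr0, mul0r, mulr1, mul1r, addr0, add0r) => /eqP.
by rewrite mulf_eq0 orbb => /eqP.
Qed.

(** As the image of [•] has no magmatic part, no magmatic product occurs in the left-hand side of
    [rule_b]. On the right, these are the coefficients of xy ∘ z, yx ∘ z, z ∘ xy and z ∘ yx. *)
Lemma rule_coeffs : [/\ c2 2%N * c1 0%N = 0, c2 2%N * c1 1%N = 0,
  c2 3%N * c1 0%N = 0 & c2 3%N * c1 1%N = 0].
Proof.
have [c12 c13] := associative_coeffs.
pose u := bin_op c1 (L 0) (L 1); pose w := bin_op c2 (L 1) (L 2).
have H s t : (bin_op c2 u (L 2))@_(Node tt s t) = 0.
  have -> : (bin_op c2 u (L 2))@_(Node tt s t) = (bin_op c1 (L 0) w)@_(Node tt s t).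
    exact: (congr1 (mcoeff (Node tt s t)) (esym rule_b)).
  by rewrite coef_bin_op c12 c13 !mul0r addr0.
have Eu t (e0 e1 : bool) h0 h1 h2 h3 : u@_t = _ := etrans (congr1 (mcoeff t) (bin_op_letters c1 0 1))
  (@coef_comb4_basis _ c1 _ _ _ _ t e0 e1 false false h0 h1 h2 h3).
pose l2 := lf (2, [::]); pose l01 := lf (0, [:: 1]); pose l10 := lf (1, [:: 0]).
have u01 := Eu l01 true false erefl erefl erefl erefl.
have u10 := Eu l10 false true erefl erefl erefl erefl.
have L2 := @coefL 2 l2 true erefl.
split.
- have := etrans (esym (@coef_bin_op_eq _ c2 u (L 2) l01 l2 _ _ _ _ u01 L2 (@coefL 2 l01 false erefl) erefl)) (H _ _).
  by rewrite !(mulr0, mul0r, mulr1, mul1r, addr0, add0r).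
- have := etrans (esym (@coef_bin_op_eq _ c2 u (L 2) l10 l2 _ _ _ _ u10 L2 (@coefL 2 l10 false erefl) erefl)) (H _ _).
  by rewrite !(mulr0, mul0r, mulr1, mul1r, addr0, add0r).
- have := etrans (esym (@coef_bin_op_eq _ c2 u (L 2) l2 l01 _ _ _ _ erefl (@coefL 2 l01 false erefl) L2 u01)) (H _ _).
  by rewrite !(mulr0, mul0r, mulr1, mul1r, addr0, add0r).
- have := etrans (esym (@coef_bin_op_eq _ c2 u (L 2) l2 l10 _ _ _ _ erefl (@coefL 2 l10 false erefl) L2 u10)) (H _ _).
  by rewrite !(mulr0, mul0r, mulr1, mul1r, addr0, add0r).
Qed.

End Coefficients.
End NotIsoTheorem.

Section NotIsoMain.
Context (k : fieldType).
Local Notation F := (free_operad k (unit + unit)%type).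
Local Notation rel0 := (combined_rel (@Ass_rel k) (@Mag_rel k) (zero_law k unit unit)).
Local Notation corolla g i j := (monomial k (Node g (Leaf i) (Leaf j)) : F bool).
Local Notation b0 := (corolla (inl tt) true false).
Local Notation b1 := (corolla (inl tt) false true).
Local Notation b2 := (corolla (inr tt) true false).
Local Notation b3 := (corolla (inr tt) false true).

Definition comb4_swap (c : nat -> k) (i : nat) : k := [:: c 1%N; c 0%N; c 3%N; c 2%N]`_i.

Lemma comb4_lin (V : lmodType k) (p : k) (a b : nat -> k) (w0 w1 w2 w3 : V) :
  comb4 (fun i => p * a i + b i) w0 w1 w2 w3 =
  p *: comb4 a w0 w1 w2 w3 + comb4 b w0 w1 w2 w3.
Proof.
rewrite /comb4 !scalerDl !scalerDr -!scalerA.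
by rewrite (addrACA (p *: _)) (addrACA (p *: (a 2%N *: _))) (addrACA (p *: _ + p *: _)).
Qed.

Lemma comb4_comb4 (V : lmodType k) (d a0 a1 a2 a3 : nat -> k) (w0 w1 w2 w3 : V) :
  comb4 d (comb4 a0 w0 w1 w2 w3) (comb4 a1 w0 w1 w2 w3)
          (comb4 a2 w0 w1 w2 w3) (comb4 a3 w0 w1 w2 w3) =
  comb4 (fun i => d 0%N * a0 i + (d 1%N * a1 i + (d 2%N * a2 i + (d 3%N * a3 i + 0)))) w0 w1 w2 w3.
Proof.
have z : comb4 (fun=> 0) w0 w1 w2 w3 = 0 :> V by rewrite /comb4 !scale0r !addr0.
by rewrite !comb4_lin z addr0 [LHS]/comb4 -!addrA.
Qed.

Lemma comb4_swapE (V : lmodType k) (a : nat -> k) (w0 w1 w2 w3 : V) :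
  comb4 a w1 w0 w3 w2 = comb4 (comb4_swap a) w0 w1 w2 w3.
Proof. by rewrite /comb4 /=; congr (_ + _); rewrite addrC. Qed.

(** [a] and [e] are the coefficients of the images of [•] and [∘]. Either the image of [•] vanishes,
    or that of [∘] has no magmatic part; then it and the images of [•] and its opposite are three
    elements of a plane. Both cases contradict the independence stated by the last hypothesis. *)
Lemma no_kernel (a e : nat -> k) :
  a 2%N = 0 -> a 3%N = 0 -> e 2%N * a 0%N = 0 -> e 2%N * a 1%N = 0 ->
  e 3%N * a 0%N = 0 -> e 3%N * a 1%N = 0 ->
  (forall d : nat -> k,
    (forall i, (i < 4)%N -> d 0%N * a i + (d 1%N * comb4_swap a i +
       (d 2%N * e i + (d 3%N * comb4_swap e i + 0))) = 0) ->
    forall i, (i < 4)%N -> d i = 0) -> False.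
Proof.
move=> a2 a3 e20 e21 e30 e31 ker.
have K d0 d1 d2 : d0 * a 0%N + d1 * a 1%N + d2 * e 0%N = 0 ->
    d0 * a 1%N + d1 * a 0%N + d2 * e 1%N = 0 -> d2 * e 2%N = 0 -> d2 * e 3%N = 0 ->
    [/\ d0 = 0, d1 = 0 & d2 = 0].
  move=> k0 k1 k2 k3.
  have H i : (i < 4)%N -> d0 * a i + (d1 * comb4_swap a i + (d2 * e i + (0 * comb4_swap e i + 0))) = 0.
    rewrite mul0r !addr0 addrA; case: i => [|[|[|[|i]]]] // _.
    - by rewrite /comb4_swap /= a2 a3 !mulr0 !add0r.
    - by rewrite /comb4_swap /= a2 a3 !mulr0 !add0r.
  have Z := ker (nth 0 [:: d0; d1; d2; 0]) H.
  by split; [exact: (Z 0%N)|exact: (Z 1%N)|exact: (Z 2%N)].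
suff [a0 a1] : a 0%N = 0 /\ a 1%N = 0.
  have [||||/eqP] := K 1 0 0; rewrite ?mul0r ?a0 ?a1 ?mulr0 ?addr0 //.
  by rewrite oner_eq0.
have [e2|/negPf e2] := eqVneq (e 2%N) 0; last first.
  by move: e20 e21 => /eqP; rewrite mulf_eq0 e2 => /eqP a0 /eqP; rewrite mulf_eq0 e2 => /eqP a1.
have [e3|/negPf e3] := eqVneq (e 3%N) 0; last first.
  by move: e30 e31 => /eqP; rewrite mulf_eq0 e3 => /eqP a0 /eqP; rewrite mulf_eq0 e3 => /eqP a1.
(* The linear dependence given by the 2 by 2 minors. It yields a0^2 = a1^2, so that (a0, -a1) is in
   turn a dependence between the image of [•] and its opposite. *)
have [||||_ _ a01] := K (a 1%N * e 1%N - a 0%N * e 0%N) (a 1%N * e 0%N - a 0%N * e 1%N)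
  (a 0%N * a 0%N - a 1%N * a 1%N); rewrite ?e2 ?e3 ?mulr0 //; try by ring.
have [||||-> /eqP] := K (a 0%N) (- a 1%N) 0; rewrite ?mul0r ?addr0 ?mulNr //.
- by rewrite mulrC subrr.
by rewrite oppr_eq0 => /eqP.
Qed.

Section Kernel.
Context (D : AssMag_law k) (Db : truncated Label_b D).
Local Notation rel := (combined_rel (@Ass_rel k) (@Mag_rel k) D).
Local Notation P := (combined (@Ass_rel k) (@Mag_rel k) D).
Local Notation P0 := (combined (@Ass_rel k) (@Mag_rel k) (zero_law k unit unit)).
Context (phi : forall I, P I -> P0 I) (phiH : operad_hom phi) (phi_inj : injective (@phi bool)).
Context (c : unit + unit -> nat -> k).
Hypothesis phic : forall g, phi (qpi rel (corolla g true false)) = qpi rel0 (bool_elt (c g)).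

Lemma phi_corolla g :
  phi (qpi rel (corolla g true false)) =
    comb4 (c g) (qpi rel0 b0) (qpi rel0 b1) (qpi rel0 b2) (qpi rel0 b3) /\
  phi (qpi rel (corolla g false true)) =
    comb4 (comb4_swap (c g)) (qpi rel0 b0) (qpi rel0 b1) (qpi rel0 b2) (qpi rel0 b3).
Proof.
have lq := @qpi_linear k F 3 rel0 bool.
have E : phi (qpi rel (corolla g true false)) =
    comb4 (c g) (qpi rel0 b0) (qpi rel0 b1) (qpi rel0 b2) (qpi rel0 b3).
  by rewrite phic bool_elt_comb4; exact: (comb4_morph (c g) _ _ _ _ lq).
split=> //; have bn : bijective negb by exists negb; apply: negbK.
have [pl pr pu pc] := phiH; have [_ qr _ _] := @qpi_hom k F 3 rel; have [_ qr0 _ _] := @qpi_hom k F 3 rel0.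
have R h b (S : F 'I_3 -> Prop) (qrS : forall (I J : finType) (f : I -> J) (x : F I),
    bijective f -> qpi S (relabel f x) = relabel f (qpi S x : quot_operad S I)) :
    relabel negb (qpi S (corolla h b (~~ b)) : quot_operad S bool) = qpi S (corolla h (~~ b) b).
  apply: etrans (esym (qrS _ _ negb _ bn)) _; apply: (congr1 (qpi S)).
  apply: etrans (relabel_monomial k bn (mlinear_bool h b)) _.
  by rewrite /= negbK.
have <- := R g true rel qr; apply: etrans (pr _ _ negb _ bn) _; rewrite E.
have lr := @relabel_linear k P0 bool bool negb bn.
apply: etrans (comb4_morph (c g) _ _ _ _ lr) _; rewrite -comb4_swapE.
exact: (f_equal4 (@comb4 k (P0 bool) (c g)) (R (inl tt) true rel0 qr0)
  (R (inl tt) false rel0 qr0) (R (inr tt) true rel0 qr0) (R (inr tt) false rel0 qr0)).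
Qed.

Lemma phi_kernel (d : nat -> k) :
  (forall i, (i < 4)%N -> d 0%N * c (inl tt) i + (d 1%N * comb4_swap (c (inl tt)) i +
     (d 2%N * c (inr tt) i + (d 3%N * comb4_swap (c (inr tt)) i + 0))) = 0) ->
  forall i, (i < 4)%N -> d i = 0.
Proof.
move=> d0; apply: (corollas_free Db); have [pl _ _ _] := phiH.
have lq := @qpi_linear k F 3 rel bool.
apply: phi_inj; rewrite (linear_map0 (pl bool)).
rewrite (comb4_morph d _ _ _ _ lq) (comb4_morph d _ _ _ _ (pl bool)).
have [E0 E1] := phi_corolla (inl tt); have [E2 E3] := phi_corolla (inr tt).
apply: etrans (f_equal4 (@comb4 k (P0 bool) d) E0 E1 E2 E3) _.
by apply: etrans (comb4_comb4 _ _ _ _ _ _ _ _ _) _; apply: comb4_0.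
Qed.

(** Associativity and rule (b) are evaluated at three letters in the trivial model, which supplies
    the hypotheses of [no_kernel]. *)
Lemma no_injection : False.
Proof.
pose f (i : 'I_3) : {malg k[wtree 'I_3]} := << Leaf (i, [::]) >>.
have ql g h := qeval_left phiH phic g h f.
have qr g h := qeval_right phiH phic g h f.
have [r Rr Er] := free_map_Ass_rel k.
have assoc : qpi rel (monomial k (Node (inl tt) (Node (inl tt) (Leaf 0) (Leaf 1)) (Leaf (2 : 'I_3)))) =
    qpi rel (monomial k (Node (inl tt) (Leaf (0 : 'I_3)) (Node (inl tt) (Leaf 1) (Leaf 2)))).
  apply/qpi_eq; rewrite -Er; apply: ideal_gen_sub; exact: combined_rel1.
have rule : qpi rel (monomial k (Node (inl tt) (Leaf (0 : 'I_3)) (Node (inr tt) (Leaf 1) (Leaf 2)))) =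
    qpi rel (monomial k (Node (inr tt) (Node (inl tt) (Leaf 0) (Leaf 1)) (Leaf (2 : 'I_3)))).
  have [_ [w Ew EDw]] := Db; apply/qpi_eq; rewrite -EDw -Ew; apply: ideal_gen_sub.
  exact: combined_relD.
have A := etrans (esym (ql (inl tt) (inl tt))) (etrans (congr1 (fun u => qeval f (phi u)) assoc) (qr (inl tt) (inl tt))).
have B := etrans (esym (qr (inl tt) (inr tt))) (etrans (congr1 (fun u => qeval f (phi u)) rule) (ql (inr tt) (inl tt))).
have [a2 a3] := associative_coeffs A; have [e20 e21 e30 e31] := rule_coeffs A B.
exact: (no_kernel a2 a3 e20 e21 e30 e31 phi_kernel).
Qed.

End Kernel.

Lemma truncated_not_iso_zero r (D : AssMag_law k) :
  truncated r D -> ~ AssMag_iso D (zero_law k unit unit).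
Proof.
move=> rD isoD; have [Db bDb] := law_exists k Label_b.
have [isob _] := truncated_iso_b rD bDb.
have [phi [phiH phiB]] := operad_iso_trans isob isoD.
have C g : exists c, phi bool (qpi (combined_rel (@Ass_rel k) (@Mag_rel k) Db) (corolla g true false)) =
    qpi rel0 (bool_elt c).
  have [x ->] := qpi_ex (phi bool (qpi _ (corolla g true false))).
  by have [c ->] := bool_eltP x; exists c.
have [c phic] := choice C.
exact: (no_injection bDb phiH (bij_inj (phiB _)) phic).
Qed.

End NotIsoMain.

Theorem theorem7p1 (k : fieldType) (char0 : [pchar k] =i pred0) :
  AssMag_distributive (zero_law k unit unit) /\
  (forall r : truncated_label, exists D : AssMag_law k, truncated r D) /\
  (forall (r : truncated_label) (D : AssMag_law k),
     truncated r D -> AssMag_distributive D) /\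
  (forall (r r' : truncated_label) (D D' : AssMag_law k),
     truncated r D -> truncated r' D' -> AssMag_iso D D') /\
  (forall (r : truncated_label) (D : AssMag_law k),
     truncated r D -> ~ AssMag_iso D (zero_law k unit unit)) /\
  (forall D : AssMag_law k, AssMag_distributive D ->
     AssMag_iso D (zero_law k unit unit) \/
     exists (r : truncated_label) (D' : AssMag_law k),
       truncated r D' /\ AssMag_iso D D').
Proof.
split; first exact: (monomial_distributive (zero_law_monomial k)).
split; first exact: law_exists.
split; first by move=> r D /truncated_monomial Dr; exact: (monomial_distributive Dr).
split; first by move=> r r' D D'; exact: truncated_iso.
split; first by move=> r D; exact: truncated_not_iso_zero.
by move=> D; exact: classification.
Qed.
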